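(* Let $a,b,k,m\in\mathbb{N}$ with $a,b>1$ and $\gcd(a,b)=1$, and let $S=\langle a^k,a^{k-1}b,\dots,ab^{k-1},b^k\rangle$. Then the set of gaps $\mathrm{H}(S)$ is equidistributed modulo $m$ if and only if $\gcd(ab,m)=1$ and, for $r$ an integer with $r\equiv a^{-1}b\pmod{m}$ and $R$ the subgroup of $(\mathbb{Z}/m\mathbb{Z})^\times$ generated multiplicatively by $r$, at least one of the following holds: (1) $a\equiv 1\pmod m$ or $b\equiv 1\pmod m$; (2) $a\equiv b\equiv -1\pmod m$, $k$ is even, and $m\mid k$; (3) $a\equiv b\equiv -1\pmod m$, $k$ is odd, and $m\mid (k+1)$; (4) $a\not\equiv b\pmod m$, $a^k\equiv b^k\equiv 1\pmod m$, and $a\in R$; (5) $a\not\equiv b\pmod m$, $a^k\equiv b^k\equiv 1\pmod m$, $-a\in R$, $k$ is even, and $m\mid (1+r+\cdots+r^{k-1})$; (6) $a\not\equiv b\pmod m$, $a^{k+1}\equiv b^{k+1}\equiv 1\pmod m$, and $a\in R$; (7) $a\not\equiv b\pmod m$, $a^{k+1}\equiv b^{k+1}\equiv 1\pmod m$, $-a\in R$, $k$ is odd, and $m\mid (1+r+\cdots+r^{k})$.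
   Context: $\mathbb{N}$ denotes the positive integers and $\mathbb{N}_0$ the non-negative integers. For positive integers $g_1,\dots,g_\ell$, $\langle g_1,\dots,g_\ell\rangle$ denotes the set of all $\mathbb{N}_0$-linear combinations of $g_1,\dots,g_\ell$ (a submonoid of $\mathbb{N}_0$; when $\gcd(g_1,\dots,g_\ell)=1$ its complement in $\mathbb{N}_0$ is finite). The gaps of such a monoid $S$ are the elements of $\mathrm{H}(S)=\mathbb{N}_0\setminus S$. A finite set $T\subset\mathbb{Z}$ is equidistributed modulo $m$ if $T$ contains the same number of elements in each congruence class modulo $m$. Membership of an integer in $R$ means membership of its residue class. *)

(* Defs.v *)
From mathcomp Require Import all_boot all_order all_algebra all_fingroup.
From mathcomp Require Import boolp classical_sets functions cardinality.

Set Implicit Arguments.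
Unset Strict Implicit.
Unset Printing Implicit Defensive.

Import GRing.Theory.

Local Open Scope ring_scope.
Local Open Scope classical_set_scope.
Local Open Scope card_scope.

Definition nat_span (l : nat) (g : 'I_l -> nat) : set nat :=
  [set n | exists c : 'I_l -> nat, n = (\sum_(i < l) c i * g i)%N].

Definition geom_monoid (a b k : nat) : set nat :=
  nat_span (fun i : 'I_k.+1 => (a ^ (k - i) * b ^ i)%N).

Definition gaps (S : set nat) : set int := [set n%:Z | n in ~` S].

Definition equidistributed (T : set int) (m : nat) : Prop :=
  finite_set T /\
  forall c d : int,
    [set x | T x /\ (x = c %[mod m])%Z] #= [set x | T x /\ (x = d %[mod m])%Z].

(* [repr_unit u x] says that the unit u of Z/mZ is the residue class of x.    *)
(* It is phrased with a congruence instead of the cast x%:~R : 'Z_m because   *)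
(* 'Z_1 is Z/2Z: {unit 'Z_1} is the trivial group, as it should be, but the   *)
(* cast would not send every integer to a unit.                               *)
Definition repr_unit (m : nat) (u : {unit 'Z_m}) (x : int) : bool :=
  ((FinRing.uval u : nat)%:Z == x %[mod m])%Z.

(* For r coprime to m > 0 the generating set is the single class of r.        *)
Definition unit_subgroup (m : nat) (r : int) : {group {unit 'Z_m}} :=
  <<[set u : {unit 'Z_m} | repr_unit u r]%SET>>%G.

Definition class_in (m : nat) (R : {group {unit 'Z_m}}) (x : int) : Prop :=
  exists2 u : {unit 'Z_m}, u \in R & repr_unit u x.

(* Main.v *)
(* The elements of the Apery set of S with respect to a^k are distinct modulo a^k, so the
   polynomial G of the gaps has a closed form, and the gaps are equidistributed modulo m
   iff G vanishes at every m-th root of unity z <> 1. This forces gcd(ab, m) = 1, and then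
   it says (1 - z) P(z^a) = P(z) (1 - z^(a^(k+1))), where P(z) is the product of the
   1 - z^(a^(k-i) b^i); by symmetry the same holds with a and b exchanged.

   Eliminating P from the two identities leaves a relation between two products of three
   factors 1 - z^u; comparing Fourier coefficients, the exponents agree modulo m, whence
   a = 1, b = 1, a = b, or a^K = b^K = 1 modulo m with K = k or k + 1. When a = b, the
   maximum principle for |1 - z^(a^n)| gives a = 1 or a = -1. When a^K = b^K = 1, the identity
   says that Q(z) = prod_(i < K) (1 - z^(r^i)) is invariant under z -> z^a.

   Such an invariance forces a to lie in the group H generated by -1 and r (the
   independence theorem of Franz). Fourier inversion turns it into the vanishing
   of the sums of chi(x k) / k over k, where chi(n) = [n in H] - [n in a H]. By
   Mertens' method this puts almost all of the mass of Lambda(n) / n in a H. If there were a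
   third coset g H, the same argument for [n in H] - [n in g H] would put almost all of the
   mass in g H as well. Otherwise chi is a real character with L(1, chi) = 0, which
   Monsky's elementary argument excludes. *)

Require Import Defs.
From mathcomp Require Import all_boot all_order all_algebra all_fingroup.
From mathcomp Require Import boolp classical_sets functions cardinality.
From mathcomp Require Import cyclic separable cyclotomic complex.
From mathcomp Require Import reals topology normedtype sequences derive realfun exp.
From mathcomp Require Import Rstruct ring lra zify.

Set Implicit Arguments.
Unset Strict Implicit.
Unset Printing Implicit Defensive.

Import Order.TTheory GRing.Theory Num.Theory.
Import numFieldNormedType.Exports.

Local Open Scope ring_scope.

(** * Divisor sums, the von Mangoldt function and Chebyshev's bound *)

(** The classical proof of independence runs over complex Dirichlet characters and needs L(1, chi)
    <> 0 for each even one. Here only indicators of cosets of H occur, so all sums are real; as -1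
    lies in H they are even, cosines suffice to expand them, and the numbers ln |1 - w^y| arise as
    values of their series. The relation makes every dilated series of chi(x k) / k vanish, and its
    partial sums are O(1/N) because chi is periodic with mean zero. As chi(1) = 1, Moebius inversion
    gives - ln N + O(1) for the sum of chi(n) Lambda(n) / n over n <= N. The total mass of Lambda(n)
    / n is at most ln N + 4, so the coset a H, where chi = -1, carries all but O(1) of it. For a
    third coset g H nothing is known at first about the values L(x) of the dilated series. However,
    the sum of L(x e) Lambda(e) / e is bounded, and L(x e) does not change while e stays in a H,
    whose mass is unbounded; this forces L = 0. Two disjoint cosets cannot both carry almost all of
    the mass. *)

Section DivisorSums.
Variable V : nmodType.
Implicit Types (F : nat -> V) (n d p N : nat).

Definition divisor_sum n F : V := \sum_(1 <= d < n.+1 | (d %| n)%N) F d.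

Lemma divisor_sum_widen n N F : (0 < n <= N)%N ->
  divisor_sum n F = \sum_(1 <= d < N.+1 | (d %| n)%N) F d.
Proof.
case/andP=> n0 nN; rewrite /divisor_sum [RHS](@big_cat_nat _ _ _ n.+1) //=.
rewrite [X in _ + X]big1_seq ?addr0 // => d; rewrite mem_index_iota.
by case/andP=> /(dvdn_leq n0) dn /andP[]; rewrite ltnNge dn.
Qed.

Lemma sum_multiples N d F : (0 < d)%N ->
  \sum_(1 <= n < N.+1 | (d %| n)%N) F n
  = \sum_(1 <= k < (N %/ d).+1) F (d * k)%N.
Proof.
move=> d0; rewrite big_mkcond /=.
elim: N => [|N IH]; first by rewrite div0n !big_geq.
rewrite big_nat_recr //= IH divnS //; case: ifP => [dN|_]; last by rewrite addr0.
rewrite add1n [RHS]big_nat_recr //=; congr (_ + F _).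
by rewrite -[LHS](divnK dN) mulnC divnS // dN add1n.
Qed.

(** Divisors divisible by p are the p e with e dividing n / p. This split serves both the Moebius
    sum and the divisor sums of a real character. *)
Lemma divisor_sum_prime n p F : (0 < n)%N -> (0 < p)%N -> (p %| n)%N ->
  divisor_sum n F = divisor_sum n (fun d => if (p %| d)%N then 0 else F d)
                    + divisor_sum (n %/ p) (fun e => F (p * e)%N).
Proof.
move=> n0 p0 pn; rewrite /divisor_sum (bigID (fun d => (p %| d)%N)) /= addrC.
congr (_ + _).
  by rewrite !big_mkcondr; apply: eq_bigr => d _; case: (p %| d)%N.
under eq_bigl do rewrite andbC.
rewrite big_mkcondr sum_multiples // -big_mkcond /=; apply: eq_bigl => k.
by rewrite -{1}(divnK pn) mulnC dvdn_pmul2r.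
Qed.

(** Both sides run over the pairs (d, e) with d e dividing n. *)
Lemma divisor_sum_exchange n (f : nat -> nat -> V) : (0 < n)%N ->
  divisor_sum n (fun d => divisor_sum (n %/ d) (f d))
  = divisor_sum n (fun e => divisor_sum (n %/ e) (f^~ e)).
Proof.
move=> n0.
have W d F : (d %| n)%N ->
    divisor_sum (n %/ d) F = \sum_(1 <= e < n.+1 | (d * e %| n)%N) F e.
  move=> dn; rewrite (divisor_sum_widen (N := n)); last first.
    by rewrite divn_gt0 ?(dvdn_gt0 n0 dn) // dvdn_leq //= leq_div.
  apply: eq_bigl => e.
  by rewrite -{2}(divnK dn) mulnC dvdn_pmul2r // (dvdn_gt0 n0 dn).
rewrite {1 3}/divisor_sum.
rewrite (eq_bigr _ (fun d dn => W d _ dn)).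
rewrite [RHS](eq_bigr _ (fun d dn => W d _ dn)).
rewrite [LHS](exchange_big_dep xpredT) //=.
rewrite [RHS]big_mkcond /=; apply: eq_bigr => e _.
case: ifP => en.
  apply: eq_bigl => d; rewrite mulnC; case: (boolP (e * d %| n)%N) => [h|]; last by rewrite andbF.
  by rewrite (dvdn_trans _ h) ?dvdn_mull.
rewrite big1 // => d /andP[_ h]; move: en.
by rewrite (dvdn_trans _ h) ?dvdn_mull.
Qed.

Lemma divisor_sum_hyperbola N (f : nat -> nat -> V) :
  \sum_(1 <= n < N.+1) divisor_sum n (f n)
  = \sum_(1 <= d < N.+1) \sum_(1 <= k < (N %/ d).+1) f (d * k)%N d.
Proof.
transitivity (\sum_(1 <= n < N.+1) \sum_(1 <= d < N.+1 | (d %| n)%N) f n d).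
  rewrite !big_nat; apply: eq_bigr => n /andP[n0]; rewrite ltnS => nN.
  by rewrite (divisor_sum_widen (N := N)) ?n0.
rewrite (exchange_big_dep_nat xpredT) //= !big_nat.
apply: eq_bigr => d /andP[d0 _].
by rewrite (sum_multiples _ (fun n => f n d)).
Qed.

End DivisorSums.

Section VonMangoldt.
Variable R : realType.
Implicit Types (n d p N M : nat).

Definition von_mangoldt n : R := if primes n is [:: p] then ln p%:R else 0.

Definition moebius n : R :=
  if all (fun p => logn p n == 1%N) (primes n) then (-1) ^+ size (primes n) else 0.

Lemma ln_nat_ge0 n : 0 <= ln (n%:R : R).
Proof.
case: n => [|n]; first by rewrite ln0.
by apply: ln_ge0; rewrite ler1n.
Qed.

Lemma lnM_nat m n : (0 < m)%N -> (0 < n)%N ->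
  ln ((m * n)%N%:R : R) = ln m%:R + ln n%:R.
Proof. by move=> m0 n0; rewrite natrM lnM // posrE ltr0n. Qed.

Lemma von_mangoldt_ge0 n : 0 <= von_mangoldt n.
Proof. by rewrite /von_mangoldt; case: (primes n) => [|p [|]] //; exact: ln_nat_ge0. Qed.

Lemma von_mangoldt_primeX p i : prime p -> (0 < i)%N ->
  von_mangoldt (p ^ i) = ln p%:R.
Proof. by move=> pp i0; rewrite /von_mangoldt primesX // primes_prime. Qed.

Lemma von_mangoldt_neq0 n : von_mangoldt n != 0 ->
  exists p i, [/\ prime p, (0 < i)%N & n = (p ^ i)%N].
Proof.
rewrite /von_mangoldt; case E: (primes n) => [|p [|]]; rewrite ?eqxx // => _.
have : p \in primes n by rewrite E mem_head.
rewrite mem_primes => /and3P[pp n0 pn].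
exists p, (logn p n); split => //; first by rewrite logn_gt0 mem_primes pp n0.
rewrite [LHS]prod_prime_decomp // prime_decompE E /=.
by rewrite big_cons big_nil muln1.
Qed.

(** Let p be a prime factor of n. The only prime power that divides n but not n / p is the full
    power of p in n, which accounts for ln n - ln (n / p) = ln p. *)
Lemma divisor_sum_von_mangoldt n : (0 < n)%N ->
  divisor_sum n von_mangoldt = ln n%:R.
Proof.
elim/ltn_ind: n => n IH n0; have [n1|n1] := leqP n 1.
  have -> : n = 1%N by lia.
  by rewrite /divisor_sum big_mkcond big_nat1 /= ln1 /von_mangoldt.
set p := pdiv n; have pp : prime p by exact: pdiv_prime.
have pn : (p %| n)%N by exact: pdiv_dvd.
have p1 := prime_gt1 pp; have p0 := prime_gt0 pp.
set n' := (n %/ p)%N; have En : n = (p * n')%N by rewrite mulnC divnK.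
have n'0 : (0 < n')%N by rewrite divn_gt0 // dvdn_leq.
have n'n : (n' < n)%N by rewrite ltn_Pdiv.
have n'd : (n' %| n)%N by rewrite En dvdn_mull.
rewrite {2}En lnM_nat // -(IH _ n'n n'0) /divisor_sum (bigID (fun d => (d %| n')%N)) /=.
rewrite addrC; congr (_ + _); last first.
  rewrite -/(divisor_sum _ _) (divisor_sum_widen (N := n)) ?n'0 ?(ltnW n'n) //.
  apply: eq_bigl => d; case: (boolP (d %| n')%N) => [h|]; last by rewrite andbF.
  by rewrite (dvdn_trans h).
set v := logn p n.
have v0 : (0 < v)%N by rewrite logn_gt0 mem_primes pp n0.
have vE : v = (logn p n').+1.
  by rewrite /v En lognM // logn_prime // eqxx.
have pv : (p ^ v %| n)%N by rewrite pfactor_dvdn.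
have npv : ~~ (p ^ v %| n')%N by rewrite pfactor_dvdn // vE ltnn.
rewrite big_mkcond (bigD1_seq (p ^ v)%N) /= ?iota_uniq //; last first.
  by rewrite mem_index_iota expn_gt0 p0 /= ltnS dvdn_leq.
rewrite pv npv /= von_mangoldt_primeX // big1 ?addr0 // => d dpv.
case: ifP => // /andP[dn dn'].
apply/eqP; apply: contraNT dpv => /von_mangoldt_neq0[q [i [qp i0 dE]]].
have qE : q = p.
  apply/eqP; apply: contraNT dn' => qp'.
  move: dn; rewrite dE En Gauss_dvdr // coprimeXl //.
  by rewrite prime_coprime // dvdn_prime2.
move: dn dn'; rewrite dE qE !pfactor_dvdn // -/v vE => h1 h2.
by rewrite (_ : i = (logn p n').+1) //; lia.
Qed.

Lemma moebius_prime_mul p n : prime p -> (0 < n)%N ->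
  moebius (p * n) = if (p %| n)%N then 0 else - moebius n.
Proof.
move=> pp n0; have p0 := prime_gt0 pp; rewrite /moebius.
have pm : p \in primes (p * n) by rewrite mem_primes pp muln_gt0 p0 n0 dvdn_mulr.
case: (boolP (p %| n)%N) => pn.
  rewrite ifF //; apply/negbTE/allPn; exists p => //.
  rewrite lognM // logn_prime // eqxx -[X in _ != X]addn0 eqn_add2l.
  by rewrite -lt0n logn_gt0 mem_primes pp n0.
have pe : perm_eq (primes (p * n)) (p :: primes n).
  apply: uniq_perm; rewrite ?primes_uniq //= ?primes_uniq ?andbT.
    by rewrite mem_primes pp n0.
  by move=> q; rewrite primesM // primes_prime // !inE.
rewrite (perm_size pe) /= exprS mulN1r (perm_all _ pe) /=.
have -> : logn p (p * n) = 1%N.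
  by rewrite lognM // logn_prime // eqxx lognE pp n0 (negbTE pn).
rewrite eqxx /=.
rewrite (_ : all _ _ = all (fun q => logn q n == 1%N) (primes n)).
  by case: ifP => _ //; rewrite oppr0.
apply: eq_in_all => q; rewrite mem_primes => /and3P[qp _ qn].
rewrite lognM // logn_prime //; case: (eqVneq q p) => [qE|//].
by move: pn; rewrite -qE qn.
Qed.

Lemma normr_moebius_le1 n : `|moebius n| <= 1.
Proof. by rewrite /moebius; case: ifP => _; rewrite ?normr0 // normrX normrN1 expr1n. Qed.

(** For a prime factor p of n, each divisor d prime to p cancels against p d, and multiples of p^2
    contribute 0. *)
Lemma divisor_sum_moebius n : (0 < n)%N ->
  divisor_sum n moebius = (n == 1%N)%:R.
Proof.
move=> n0; have [n1|n1] := leqP n 1.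
  have -> : n = 1%N by lia.
  by rewrite /divisor_sum big_mkcond big_nat1 /= /moebius.
rewrite gtn_eqF //=; set p := pdiv n; have pp : prime p by exact: pdiv_prime.
have p0 := prime_gt0 pp; have pn : (p %| n)%N by exact: pdiv_dvd.
have m0 : (0 < n %/ p)%N by rewrite divn_gt0 // dvdn_leq.
rewrite (divisor_sum_prime moebius n0 p0 pn).
rewrite !(divisor_sum_widen (N := n)) ?n0 ?m0 ?leq_div //=.
rewrite !(big_mkcond (fun d => (d %| _)%N)) -big_split /= big_nat big1 // => d /andP[d0 _].
rewrite moebius_prime_mul //; case: (boolP (p %| d)%N) => pd.
  by rewrite !if_same addr0.
rewrite -{1}(divnK pn) Gauss_dvdl; last by rewrite coprime_sym prime_coprime.
by case: ifP => _; rewrite ?subrr ?addr0.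
Qed.

Lemma divisor_sumZ (n : nat) (c : R) F :
  divisor_sum n (fun d => c * F d) = c * divisor_sum n F.
Proof. by rewrite /divisor_sum mulr_sumr. Qed.

(** Inverting ln = sum of Lambda gives Lambda n as the sum of mu d times ln (n / d); adding the sum
    of mu d times ln d leaves ln n times the sum of mu, which is 0. *)
Lemma divisor_sum_moebius_ln n : (0 < n)%N ->
  divisor_sum n (fun d => moebius d * ln d%:R) = - von_mangoldt n.
Proof.
move=> n0.
have E : divisor_sum n (fun d => moebius d * ln (n %/ d)%:R) = von_mangoldt n.
  transitivity (divisor_sum n (fun d =>
      divisor_sum (n %/ d) (fun e => moebius d * von_mangoldt e))).
    rewrite /divisor_sum [LHS]big_nat_cond [RHS]big_nat_cond; apply: eq_bigr => d /andP[/andP[d0 _] dn].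
    rewrite -/(divisor_sum _ _) divisor_sumZ divisor_sum_von_mangoldt //.
    by rewrite divn_gt0 // dvdn_leq.
  rewrite divisor_sum_exchange // /divisor_sum.
  rewrite big_mkcond (bigD1_seq n) /= ?iota_uniq ?mem_index_iota ?n0 ?ltnS ?leqnn //.
  rewrite dvdnn divnn n0 big_mkcond big_nat1 /= {1}/moebius /= mul1r.
  rewrite big_nat_cond big1 ?addr0 // => d /andP[/andP[d0 _] dn].
  case: ifP => // dvd.
  rewrite (_ : \sum_(_ <= _ < _ | _) _
      = von_mangoldt d * divisor_sum (n %/ d) moebius); last first.
    by rewrite /divisor_sum mulr_sumr; apply: eq_bigr => e _; rewrite mulrC.
  rewrite divisor_sum_moebius ?divn_gt0 ?(dvdn_leq n0 dvd) //.
  case: eqP => [nd|]; rewrite ?mulr0 //; case/negP: dn; apply/eqP.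
  by rewrite -(divnK dvd) nd mul1n.
rewrite -E; apply/eqP; rewrite -addr_eq0 /divisor_sum -big_split /=; apply/eqP.
rewrite (eq_bigr (fun d => ln n%:R * moebius d)).
  rewrite -mulr_sumr -/(divisor_sum _ _) divisor_sum_moebius //.
  by case: eqVneq => [->|_]; rewrite ?ln1 ?mul0r ?mulr0.
move=> d dn; have d0 := dvdn_gt0 n0 dn.
rewrite -mulrDr -lnM_nat ?divn_gt0 ?(dvdn_leq n0 dn) //.
by rewrite (mulnC d) divnK // mulrC.
Qed.

End VonMangoldt.

Section LogarithmicSums.
Variable R : realType.
Implicit Types (n d e N M : nat).
Local Notation Lambda := (@von_mangoldt R).

Lemma ln_natS_diff n : (0 < n)%N -> ln n.+1%:R - ln n%:R <= (n%:R)^-1 :> R.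
Proof.
move=> n0; have n0' : 0 < n%:R :> R by rewrite ltr0n.
rewrite -ln_div ?posrE ?ltr0n //.
have -> : n.+1%:R / n%:R = 1 + n%:R^-1 :> R.
  by rewrite -addn1 natrD mulrDl divff ?lt0r_neq0 // mul1r addrC.
by apply: le_ln1Dx; rewrite (lt_trans _ (y := 0)) ?invr_gt0 // ltrN10.
Qed.

Lemma le_natr_ln n : ln n%:R <= n%:R :> R.
Proof.
case: n => [|n]; first by rewrite ln0.
by apply/ltW/ln_sublinear; rewrite ltr0n.
Qed.

Definition ln_fact N : R := \sum_(1 <= n < N.+1) ln n%:R.

Lemma ln_factS N : ln_fact N.+1 = ln_fact N + ln N.+1%:R.
Proof. by rewrite /ln_fact big_nat_recr. Qed.

(** The range may extend to any K >= N because the floor N / d vanishes there; thus ln (2M)! and ln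
    M! can be subtracted term by term. *)
Lemma ln_fact_von_mangoldt N K : (N <= K)%N ->
  ln_fact N = \sum_(1 <= d < K.+1) Lambda d * (N %/ d)%:R.
Proof.
move=> NK; transitivity (\sum_(1 <= n < N.+1) divisor_sum n Lambda).
  rewrite /ln_fact !big_nat; apply: eq_bigr => n /andP[n0 _].
  by rewrite divisor_sum_von_mangoldt.
rewrite (divisor_sum_hyperbola N (fun _ => Lambda)).
rewrite [RHS](@big_cat_nat _ _ _ N.+1) //= [X in _ + X]big_nat_cond.
rewrite [X in _ + X]big1 ?addr0; last first.
  by move=> d /andP[/andP[Nd _] _]; rewrite divn_small ?mulr0.
apply: eq_bigr => d _; rewrite sumr_const_nat subn1 /=.
by rewrite mulr_natr.
Qed.

(** This is the bound 4^M for the central binomial coefficient, weakened by ln 2 <= 1. *)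
Lemma ln_fact_double M : ln_fact M.*2 - 2 * ln_fact M <= M.*2%:R.
Proof.
have ln2 : ln 2 <= 1 :> R.
  have -> : 2 = 1 + 1 :> R by ring.
  by apply: le_ln1Dx; lra.
suff : ln_fact M.*2 - 2 * ln_fact M <= M.*2%:R * ln 2.
  move/le_trans; apply; rewrite ler_piMr //.
elim: M => [|M IH]; first by rewrite /ln_fact !big_geq //= mulr0 subr0 mul0r.
rewrite doubleS !ln_factS.
have h1 : ln M.*2.+1%:R <= ln M.*2.+2%:R :> R by rewrite ler_ln ?posrE ?ltr0n // ler_nat.
have h2 : ln M.*2.+2%:R = ln 2 + ln M.+1%:R :> R by rewrite -lnM_nat // mul2n doubleS.
have h3 : M.*2.+2%:R = M.*2%:R + 2 :> R by rewrite -addn2 natrD.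
by rewrite {2}h3; move: IH h1; rewrite h2; lra.
Qed.

Definition chebyshev_psi N : R := \sum_(1 <= d < N.+1) Lambda d.

Lemma chebyshev_psi_le M N : (M <= N)%N -> chebyshev_psi M <= chebyshev_psi N.
Proof.
move=> MN; rewrite /chebyshev_psi [leRHS](@big_cat_nat _ _ _ M.+1) //=.
by rewrite lerDl sumr_ge0 // => *; exact: von_mangoldt_ge0.
Qed.

(** In ln (2M)! - 2 ln M!, the coefficient floor(2M / d) - 2 floor(M / d) of Lambda d is never
    negative, and it is at least 1 for M < d <= 2M. *)
Lemma chebyshev_psi_double M : chebyshev_psi M.*2 - chebyshev_psi M <= M.*2%:R.
Proof.
have MM : (M <= M.*2)%N by rewrite -addnn leq_addr.
apply: le_trans (ln_fact_double M).
rewrite (ln_fact_von_mangoldt (leqnn _)) (ln_fact_von_mangoldt MM) mulr_sumr -sumrB.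
rewrite /chebyshev_psi [X in X - _](@big_cat_nat _ _ _ M.+1) //= [leLHS]addrC addKr.
rewrite [leRHS](@big_cat_nat _ _ _ M.+1) //=.
rewrite ler_wpDl //.
  apply: sumr_ge0 => d _; rewrite mulrCA -mulrBr mulr_ge0 ?von_mangoldt_ge0 //.
  rewrite subr_ge0 -natrM ler_nat mul2n; case: d => [|d]; first by rewrite !divn0.
  by rewrite leq_divRL // -doubleMl leq_double leq_trunc_div.
rewrite !big_nat; apply: ler_sum => d /andP[Md dM].
rewrite [X in _ - 2 * (_ * X)](_ : _ = 0) ?mulr0 ?subr0; last by rewrite divn_small.
rewrite ler_peMr ?von_mangoldt_ge0 // ler1n divn_gt0 //.
by apply: leq_trans Md.
Qed.

(** Doubling gives 2^(j+1) as a bound at 2^j; rounding N up to a power of two, at most 2 N, yields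
    the factor 4. *)
Lemma chebyshev_psi_linear N : chebyshev_psi N <= 4 * N%:R.
Proof.
have H j : chebyshev_psi (2 ^ j) <= (2 ^ j.+1)%:R.
  elim: j => [|j IH].
    by rewrite expn0 /chebyshev_psi big_nat1 /von_mangoldt /=.
  have := chebyshev_psi_double (2 ^ j); rewrite -mul2n -expnS.
  have e : (2 ^ j.+2)%:R = 2 * (2 ^ j.+1)%:R :> R by rewrite expnS natrM.
  by rewrite e; move: IH; lra.
have [->|N0] := posnP N; first by rewrite /chebyshev_psi big_geq // mulr0.
have lt : (N <= 2 ^ (trunc_log 2 N).+1)%N by rewrite ltnW // trunc_log_ltn.
apply: le_trans (chebyshev_psi_le lt) _; apply: le_trans (H _) _.
by rewrite -natrM ler_nat !expnS mulnA leq_mul2l /= trunc_logP.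
Qed.

Lemma ln_fact_le N : ln_fact N <= N%:R * ln N%:R.
Proof.
rewrite /ln_fact; apply: le_trans (_ : \sum_(1 <= n < N.+1) ln N%:R <= _).
  rewrite !big_nat; apply: ler_sum => n /andP[n0 nN].
  by rewrite ler_ln ?posrE ?ltr0n ?ler_nat // (leq_trans n0).
by rewrite sumr_const_nat subn1 mulr_natl.
Qed.

Lemma ln_fact_ge N : (0 < N)%N -> N%:R * ln N%:R - ln_fact N <= N%:R.
Proof.
case: N => // N _; elim: N => [|N IH].
  by rewrite ln1 mulr0 /ln_fact big_nat1 ln1 subr0.
rewrite ln_factS.
have h : N.+1%:R * (ln N.+2%:R - ln N.+1%:R) <= 1 :> R.
  have := ler_wpM2l (ler0n R N.+1) (ln_natS_diff (ltn0Sn N)).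
  by rewrite divff ?pnatr_eq0.
have e : N.+2%:R = N.+1%:R + 1 :> R by rewrite natr1.
move: IH h; set u := ln _; set v := ln _; rewrite e; nra.
Qed.

(** Since N / d is at most its floor plus 1, N times the sum is at most ln N! plus
    [chebyshev_psi N]; the 4 is Chebyshev's constant. *)
Lemma sum_von_mangoldt_div_le N : (0 < N)%N ->
  \sum_(1 <= n < N.+1) Lambda n / n%:R <= ln N%:R + 4.
Proof.
move=> N0; have N0' : 0 < N%:R :> R by rewrite ltr0n.
rewrite -(ler_pM2l N0') mulrDr mulr_sumr.
apply: le_trans (_ : ln_fact N + chebyshev_psi N <= _); last first.
  by apply: lerD (ln_fact_le N) _; rewrite mulrC chebyshev_psi_linear.
rewrite (ln_fact_von_mangoldt (leqnn _)) /chebyshev_psi -big_split /=.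
rewrite !big_nat; apply: ler_sum => d /andP[d0 _].
rewrite mulrCA -[X in _ <= _ + X]mulr1 -mulrDr ler_wpM2l ?von_mangoldt_ge0 //.
rewrite ler_pdivrMr ?ltr0n // natr1 -natrM ler_nat.
by rewrite ltnW // ltn_ceil.
Qed.

End LogarithmicSums.

(** * Mertens-type estimates from periodic series *)

Section VanishingSeries.
Variable R : realType.
Implicit Types (n d e k x N M : nat) (c : nat -> R).
Local Notation Lambda := (@von_mangoldt R).

(** The dilation by x is what remains when a sum of c n / n is regrouped along n = x k. *)
Definition log_series c x N : R := \sum_(1 <= k < N.+1) c (x * k)%N / k%:R.

(* This rests on [\sum_(d | n) mu d * ln (N / d) = Lambda n + (n == 1) * ln N]. *)
Lemma sum_moebius_weighted N (F : nat -> R) : (0 < N)%N ->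
  \sum_(1 <= n < N.+1) F n * Lambda n + F 1%N * ln N%:R
  = \sum_(1 <= d < N.+1) moebius R d * (ln N%:R - ln d%:R)
      * \sum_(1 <= k < (N %/ d).+1) F (d * k)%N.
Proof.
move=> N0; transitivity (\sum_(1 <= n < N.+1)
    divisor_sum n (fun d => F n * (moebius R d * (ln N%:R - ln d%:R)))).
  have -> : F 1%N * ln N%:R = \sum_(1 <= n < N.+1) F n * ((n == 1%N)%:R * ln N%:R).
    rewrite big_ltn // eqxx mul1r big_nat big1 ?addr0 // => n /andP[n1 _].
    by rewrite gtn_eqF // mul0r mulr0.
  rewrite -big_split /= !big_nat; apply: eq_bigr => n /andP[n0 _].
  rewrite divisor_sumZ -mulrDr; congr (_ * _).
  rewrite -divisor_sum_moebius // -[Lambda n]opprK -divisor_sum_moebius_ln //.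
  rewrite /divisor_sum mulr_suml -sumrN -big_split /=.
  by apply: eq_bigr => d _; rewrite mulrBr addrC.
rewrite (divisor_sum_hyperbola N (fun n d => F n * (moebius R d * (ln N%:R - ln d%:R)))).
by apply: eq_bigr => d _; rewrite mulr_sumr; apply: eq_bigr => k _; rewrite mulrC.
Qed.

Lemma inv_floor_div_le N d : (0 < d)%N -> (0 < N)%N ->
  ((N %/ d).+1%:R : R)^-1 <= d%:R / N%:R.
Proof.
move=> d0 N0; rewrite ler_pdivlMr ?ltr0n // mulrC ler_pdivrMr ?ltr0n //.
by rewrite -natrM ler_nat mulnC ltnW // ltn_ceil.
Qed.

(** With the weights ln N - ln d the error is at most (B / N) (N ln N - ln N!), which is at most B
    by [ln_fact_ge]. The weights - ln d alone would cost B ln N, as much as the main term. *)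
Lemma sum_von_mangoldt_of_vanishing c (B : R) N : (0 < N)%N ->
  (forall x n, (0 < x)%N -> `|log_series c x n| <= B / n.+1%:R) ->
  `|\sum_(1 <= n < N.+1) c n * Lambda n / n%:R + c 1%N * ln N%:R| <= B.
Proof.
move=> N0 cB; have B0 : 0 <= B.
  by have := le_trans (normr_ge0 _) (cB 1%N 0%N isT); rewrite divr1.
have N0' : 0 < N%:R :> R by rewrite ltr0n.
have := sum_moebius_weighted (fun n => c n / n%:R) N0.
rewrite divr1; under eq_bigr do rewrite mulrAC; move=> ->.
apply: le_trans (ler_norm_sum _ _ _) _.
apply: le_trans (_ : \sum_(1 <= d < N.+1) (ln N%:R - ln d%:R) * (B / N%:R) <= _).
  rewrite !big_nat; apply: ler_sum => d /andP[d0]; rewrite ltnS => dN.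
  have d0' : 0 < d%:R :> R by rewrite ltr0n.
  have l0 : 0 <= ln N%:R - ln d%:R :> R.
    by rewrite subr_ge0 ler_ln ?posrE // ler_nat.
  rewrite !normrM (ger0_norm l0) -mulrA.
  apply: le_trans (ler_wpM2r _ (normr_moebius_le1 _ _)) _; first by rewrite mulr_ge0.
  rewrite mul1r ler_wpM2l //.
  have -> : \sum_(1 <= k < (N %/ d).+1) c (d * k)%N / (d * k)%N%:R
            = (log_series c d (N %/ d)) / d%:R.
    rewrite /log_series mulr_suml; apply: eq_bigr => k _.
    by rewrite natrM invfM mulrA mulrAC.
  rewrite normrM normfV (ger0_norm (ltW d0')) ler_pdivrMr //.
  apply: le_trans (cB _ _ d0) _; rewrite -mulrA ler_wpM2l //.
  by rewrite mulrC inv_floor_div_le.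
rewrite -mulr_suml mulrCA ler_piMr // ler_pdivrMr // mul1r.
rewrite sumrB sumr_const_nat subn1 /= -(mulr_natl (ln _)).
exact: ln_fact_ge.
Qed.

(** Partial summation against the remainders of the series: the increments of ln telescope to at
    most B (1 - 1 / N), and the boundary term costs another B. *)
Lemma sum_ln_weighted_bounded c (B L : R) x N : (0 < N)%N ->
  (forall n, `|log_series c x n - L| <= B / n.+1%:R) ->
  `|\sum_(1 <= n < N.+1) c (x * n)%N / n%:R * ln n%:R| <= 2 * B.
Proof.
move=> N0 cB; have B0 : 0 <= B.
  by have := le_trans (normr_ge0 _) (cB 0%N); rewrite divr1.
pose T n := log_series c x n - L.
have N0' : 0 < N%:R :> R by rewrite ltr0n.
suff H : `|\sum_(1 <= n < N.+1) c (x * n)%N / n%:R * ln n%:R - T N * ln N%:R|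
    <= B * (1 - N%:R^-1).
  have TN : `|T N * ln N%:R| <= B.
    rewrite normrM (ger0_norm (ln_nat_ge0 _ _)).
    apply: le_trans (ler_pM (normr_ge0 _) (ln_nat_ge0 _ _) (cB N) (le_natr_ln _ _)) _.
    by rewrite -mulrA ler_piMr // mulrC ler_pdivrMr ?ltr0n // mul1r ler_nat.
  rewrite -[X in `|X|](subrK (T N * ln N%:R)).
  apply: le_trans (ler_normD _ _) _; rewrite mulr_natl mulr2n lerD //.
  apply: le_trans H _; rewrite ler_piMr // lerBlDr lerDl invr_ge0 ltW //.
case: N N0 N0' => // N _ _; elim: N => [|N IH].
  by rewrite big_nat1 ln1 !mulr0 subr0 normr0 invr1 subrr mulr0.
rewrite big_nat_recr //=; move: IH; set S := \sum_(1 <= n < N.+2) _ => IH.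
have e : T N.+2 = T N.+1 + c (x * N.+2)%N / N.+2%:R.
  by rewrite /T /log_series big_nat_recr //= addrAC.
have -> : S + c (x * N.+2)%N / N.+2%:R * ln N.+2%:R - T N.+2 * ln N.+2%:R
   = (S - T N.+1 * ln N.+1%:R) - T N.+1 * (ln N.+2%:R - ln N.+1%:R).
  by rewrite e; ring.
apply: le_trans (ler_normB _ _) _.
apply: le_trans (lerD IH (_ : _ <= B * (N.+1%:R^-1 - N.+2%:R^-1))) _; last first.
  by rewrite -mulrDr addrA subrK.
rewrite normrM [X in _ * X]ger0_norm; last by rewrite subr_ge0 ler_ln ?posrE ?ltr0n // ler_nat.
apply: le_trans (ler_pM _ _ (cB N.+1) (ln_natS_diff _ _)) _ => //.
  by rewrite subr_ge0 ler_ln ?posrE ?ltr0n // ler_nat.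
rewrite -mulrA ler_wpM2l //.
rewrite -[N.+2%:R in leRHS]natr1 -[N.+2%:R in leLHS]natr1.
have : 0 < N.+1%:R :> R by rewrite ltr0n.
move: (N.+1%:R) => t t0.
have -> // : (t + 1)^-1 / t = t^-1 - (t + 1)^-1.
by field; rewrite !lt0r_neq0 // addr_gt0.
Qed.

(** Writing ln as a divisor sum of Lambda turns the sum weighted by ln, at most 2 B, into one of
    partial series. Replacing these by their limits costs at most (B / N) times [chebyshev_psi N],
    that is 4 B. *)
Lemma sum_von_mangoldt_log_series_bounded c (B : R) (L : nat -> R) x N :
  (0 < N)%N -> (0 < x)%N ->
  (forall y n, (0 < y)%N -> `|log_series c y n - L y| <= B / n.+1%:R) ->
  `|\sum_(1 <= e < N.+1) Lambda e / e%:R * L (x * e)%N| <= 6 * B.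
Proof.
move=> N0 x0 cB; have B0 : 0 <= B.
  by have := le_trans (normr_ge0 _) (cB 1%N 0%N isT); rewrite divr1.
have N0' : 0 < N%:R :> R by rewrite ltr0n.
pose S := \sum_(1 <= n < N.+1) c (x * n)%N / n%:R * ln n%:R.
have SE : S = \sum_(1 <= e < N.+1) Lambda e / e%:R * log_series c (x * e) (N %/ e).
  transitivity (\sum_(1 <= n < N.+1)
      divisor_sum n (fun e => c (x * n)%N / n%:R * Lambda e)).
    rewrite /S !big_nat; apply: eq_bigr => n /andP[n0 _].
    by rewrite divisor_sumZ divisor_sum_von_mangoldt.
  rewrite (divisor_sum_hyperbola N (fun n e => c (x * n)%N / n%:R * Lambda e)).
  apply: eq_bigr => e _; rewrite /log_series mulr_sumr; apply: eq_bigr => k _.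
  by rewrite natrM invfM mulnA; ring.
have -> : \sum_(1 <= e < N.+1) Lambda e / e%:R * L (x * e)%N = S -
    \sum_(1 <= e < N.+1) Lambda e / e%:R * (log_series c (x * e) (N %/ e) - L (x * e)%N).
  by rewrite SE -sumrB; apply: eq_bigr => e _; ring.
apply: le_trans (ler_normB _ _) _.
rewrite (_ : 6 * B = 2 * B + 4 * B); last by ring.
apply: lerD; first exact: (sum_ln_weighted_bounded N0 (fun n => cB x n x0)).
apply: le_trans (ler_norm_sum _ _ _) _.
apply: le_trans (_ : \sum_(1 <= e < N.+1) Lambda e * (B / N%:R) <= _).
  rewrite !big_nat; apply: ler_sum => e /andP[e0 _].
  have e0' : 0 < e%:R :> R by rewrite ltr0n.
  rewrite normrM normrM (ger0_norm (von_mangoldt_ge0 _ _)) normfV (ger0_norm (ltW e0')).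
  rewrite -mulrA ler_wpM2l ?von_mangoldt_ge0 // mulrC ler_pdivrMr //.
  apply: le_trans (cB _ _ _) _; first by rewrite muln_gt0 x0.
  by rewrite -mulrA ler_wpM2l // mulrC inv_floor_div_le.
rewrite -mulr_suml mulrCA [leRHS]mulrC ler_wpM2l //.
by rewrite ler_pdivrMr // chebyshev_psi_linear.
Qed.

End VanishingSeries.

(** * Series with periodic coefficients *)

Lemma closed_prim_root_exists (F : numClosedFieldType) n :
  (0 < n)%N -> exists w : F, n.-primitive_root w.
Proof.
move=> n0; pose p : {poly F} := 'X^n - 1.
have [r Dp] := closed_field_poly_normal p.
rewrite (monicP _) ?monicXnsubC // scale1r in Dp.
have rn1 : all n.-unity_root r by apply/allP=> z; rewrite -root_prod_XsubC -Dp.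
have sz_r : (n < (size r).+1)%N by rewrite -(size_prod_XsubC r id) -Dp size_XnsubC.
have [|z] := hasP (has_prim_root n0 rn1 _ sz_r); last by exists z.
by rewrite -separable_prod_XsubC -Dp separable_Xn_sub_1 // pnatr_eq0 -lt0n.
Qed.

Section RootOfUnityCoordinates.
Variables (R : rcfType) (m : nat) (w : R[i]).
Hypothesis w_prim : m.-primitive_root w.
Implicit Types n k y N : nat.

(* An arbitrary primitive root replaces exp (2 i pi / m); in place of trigonometric
   functions only the coordinates of its powers are used. *)
Definition co n : R := complex.Re (w ^+ n).
Definition si n : R := complex.Im (w ^+ n).

Let m_gt0 : (0 < m)%N := prim_order_gt0 w_prim.

Lemma coD n k : co (n + k) = co n * co k - si n * si k.
Proof. by rewrite /co /si exprD; case: (w ^+ n) => a b; case: (w ^+ k) => c d. Qed.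

Lemma siD n k : si (n + k) = co n * si k + si n * co k.
Proof. by rewrite /co /si exprD; case: (w ^+ n) => a b; case: (w ^+ k) => c d. Qed.

Lemma co0 : co 0 = 1. Proof. by rewrite /co expr0. Qed.
Lemma si0 : si 0 = 0. Proof. by rewrite /si expr0. Qed.

Lemma co_mod n k : n = k %[mod m] -> co n = co k.
Proof. by rewrite /co => h; rewrite -(prim_expr_mod w_prim) h prim_expr_mod. Qed.

Lemma si_mod n k : n = k %[mod m] -> si n = si k.
Proof. by rewrite /si => h; rewrite -(prim_expr_mod w_prim) h prim_expr_mod. Qed.

Lemma co2Dsi2 n : co n ^+ 2 + si n ^+ 2 = 1.
Proof.
apply: (@complexI R); rewrite add_Re2_Im2.
have -> : `|w ^+ n| = 1.
  apply/eqP; rewrite -(@pexpr_eq1 _ _ m) ?normr_ge0 //.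
  by rewrite -normrX exprAC (prim_expr_order w_prim) expr1n normr1.
by rewrite expr1n.
Qed.

(** Throughout, [m.-1 * n] plays the role of - n among natural numbers modulo m. *)
Lemma oppn_mod n : (n + m.-1 * n = 0 %[mod m])%N.
Proof. by rewrite -mulSn prednK // modnMr mod0n. Qed.

Lemma coN n : co (m.-1 * n) = co n.
Proof.
have /co_mod := oppn_mod n; have /si_mod := oppn_mod n; have := co2Dsi2 n.
rewrite coD siD co0 si0; set A := co n; set S := si n; set A' := co _; set S' := si _.
move=> h1 h2 h3.
have -> : A' = A' * (A ^+ 2 + S ^+ 2) by rewrite h1 mulr1.
have -> : A' * (A ^+ 2 + S ^+ 2) = A * (A * A' - S * S') + S * (A * S' + S * A') by ring.
by rewrite h2 h3 mulr0 mulr1 addr0.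
Qed.

Lemma siN n : si (m.-1 * n) = - si n.
Proof.
have /co_mod := oppn_mod n; have /si_mod := oppn_mod n; have := co2Dsi2 n.
rewrite coD siD co0 si0; set A := co n; set S := si n; set A' := co _; set S' := si _.
move=> h1 h2 h3.
have -> : S' = S' * (A ^+ 2 + S ^+ 2) by rewrite h1 mulr1.
have -> : S' * (A ^+ 2 + S ^+ 2) = A * (A * S' + S * A') - S * (A * A' - S * S') by ring.
by rewrite h2 h3 mulr0 mulr1 sub0r.
Qed.

Lemma coM n k : co n * co k = (co (n + k) + co (n + m.-1 * k)) / 2.
Proof. by rewrite !coD coN siN; field. Qed.

Lemma norm_co_le1 n : `|co n| <= 1.
Proof.
rewrite -(@ler_pXn2r _ 2) ?nnegrE ?normr_ge0 ?ler01 // expr1n real_normK ?num_real //.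
by rewrite -(co2Dsi2 n) lerDl sqr_ge0.
Qed.

Lemma co_le1 n : co n <= 1.
Proof. exact: le_trans (ler_norm _) (norm_co_le1 n). Qed.

Lemma co_eq1 n : (co n == 1) = (m %| n)%N.
Proof.
rewrite (prim_order_dvd w_prim); apply/idP/idP => [/eqP c1|/eqP h]; last first.
  by rewrite /co h.
have := co2Dsi2 n; rewrite c1 expr1n => /eqP; rewrite -subr_eq0 addrAC subrr add0r.
rewrite sqrf_eq0 => /eqP s0; apply/eqP.
by move: c1 s0; rewrite /co /si; case: (w ^+ n) => a b /= -> ->.
Qed.

Lemma co_recurrence n y : co (n + y + y) + co n = 2 * co y * co (n + y).
Proof.
have e := co2Dsi2 y; rewrite (coD (n + y)) !coD siD.
apply/eqP; rewrite -subr_eq0; apply/eqP.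
transitivity (co n * (1 - (co y ^+ 2 + si y ^+ 2))); first by ring.
by rewrite e subrr mulr0.
Qed.

(** This is |1 - t w^y|^2, the denominator of the Poisson kernel. *)
Definition kernel_denom y (t : R) := 1 - 2 * t * co y + t ^+ 2.

(** The recurrence for cosines makes the product telescope; when m divides N the boundary values are
    those at 0 and y. *)
Lemma cosine_sum_closed y t N : (m %| N)%N ->
  kernel_denom y t * \sum_(1 <= n < N.+1) co (y * n) * t ^+ n.-1
  = (co y - t) * (1 - t ^+ N).
Proof.
have H K : kernel_denom y t * \sum_(1 <= n < K.+1) co (y * n) * t ^+ n.-1
    = (co y - t) - t ^+ K * (co (y * K.+1) - t * co (y * K)).
  elim: K => [|K IH].
    by rewrite big_geq // muln1 muln0 co0 mulr0 mul1r mulr1 subrr.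
  rewrite big_nat_recr //= mulrDr IH.
  have e : co (y * K.+2) + co (y * K) = 2 * co y * co (y * K.+1).
    by rewrite !mulnSr co_recurrence.
  move/eqP: e; rewrite -subr_eq0 => /eqP; rewrite /kernel_denom [t ^+ K.+1]exprS => e.
  apply/eqP; rewrite -subr_eq0; apply/eqP.
  transitivity (t * t ^+ K * (co (y * K.+2) + co (y * K) - 2 * co y * co (y * K.+1))).
    by ring.
  by rewrite e mulr0.
move=> mN; rewrite H (co_mod (n := y * N.+1) (k := y)); last first.
  by rewrite mulnS -modnDmr (eqP (dvdn_mull y mN)) addn0.
have -> : co (y * N) = 1 by apply/eqP; rewrite co_eq1 dvdn_mull.
by ring.
Qed.

Lemma kernel_denom_gt0 y t : ~~ (m %| y)%N -> 0 <= t -> 0 < kernel_denom y t.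
Proof.
rewrite -co_eq1 => c1 t0; have c := co_le1 y.
have {}c1 : co y < 1 by rewrite lt_neqAle c1.
rewrite /kernel_denom; have -> : 1 - 2 * t * co y + t ^+ 2
  = (1 - t) ^+ 2 + 2 * (t * (1 - co y)) by ring.
have [->|tn0] := eqVneq t 0; first by rewrite mul0r mulr0 addr0 subr0 expr1n.
by rewrite ltr_wpDl ?sqr_ge0 // mulr_gt0 // mulr_gt0 ?subr_gt0 // lt0r tn0.
Qed.

End RootOfUnityCoordinates.

Section PowerBoundedDerivative.
Variable R : realType.

Lemma is_derive_bigsum (r : seq nat) (f : nat -> R -> R) (df : nat -> R) (x : R) :
  (forall i, i \in r -> is_derive x 1 (f i) (df i)) ->
  is_derive x 1 (fun t => \sum_(i <- r) f i t) (\sum_(i <- r) df i).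
Proof.
elim: r => [|i r IH] H.
  rewrite big_nil (_ : (fun _ => _) = cst 0); first exact: is_derive_cst.
  by apply/funext => t; rewrite big_nil.
rewrite big_cons (_ : (fun _ => _) = f i + (fun t => \sum_(j <- r) f j t)); last first.
  by apply/funext => t; rewrite big_cons.
apply: is_deriveD; first by apply: H; rewrite mem_head.
by apply: IH => j jr; apply: H; rewrite inE jr orbT.
Qed.

Lemma is_derive_monomial (a t : R) n :
  is_derive t 1 (fun s : R => a * s ^+ n) (a * (n%:R * t ^+ n.-1)).
Proof.
rewrite (_ : (fun s => _) = a \*: ((id : R -> R) ^+ n)); last first.
  by apply/funext => s /=; rewrite exprfctE.
apply: is_derive_eq.
by rewrite /GRing.scale /= mulr1.
Qed.

Lemma is_derive_ln_quadratic (c t : R) : 0 < 1 - 2 * t * c + t ^+ 2 ->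
  is_derive t 1 (fun s : R => ln (1 - 2 * s * c + s ^+ 2))
    ((2 * (t - c)) / (1 - 2 * t * c + t ^+ 2)).
Proof.
move=> q0.
have q' : is_derive t 1 (fun s : R => 1 - 2 * s * c + s ^+ 2) (2 * (t - c)).
  rewrite (_ : (fun s => _) = (fun s => 1 * s ^+ 0) + (fun s => (- (2 * c)) * s ^+ 1)
      + (fun s => 1 * s ^+ 2)); last first.
    by apply/funext => s /=; rewrite !fctE; ring.
  have d0 := is_derive_monomial 1 t 0; have d1 := is_derive_monomial (- (2 * c)) t 1.
  have d2 := is_derive_monomial 1 t 2.
  by apply: is_derive_eq; rewrite /=; ring.
have lnd := is_derive1_ln q0.
have := @is_derive1_comp R (@ln R) (fun s : R => 1 - 2 * s * c + s ^+ 2) t _ _ lnd q'.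
by rewrite [_ * (2 * _)]mulrC.
Qed.

(** The bound obtained by integrating K t^N over [0, 1], derived without integrals from the mean
    value theorem for K t^(N+1) / (N+1) - f. *)
Lemma diff_le_of_derive_le_power (f df : R -> R) (K : R) (N : nat) :
  (forall t : R, 0 <= t <= 1 -> is_derive t 1 f (df t)) ->
  (forall t : R, 0 < t < 1 -> df t <= K * t ^+ N) ->
  f 1 - f 0 <= K / N.+1%:R.
Proof.
move=> fd fK.
pose g := fun t : R => K / N.+1%:R * t ^+ N.+1 - f t.
pose dg := fun t : R => K * t ^+ N - df t.
have gd (t : R) : 0 <= t <= 1 -> is_derive t 1 g (dg t).
  move=> t01; have := fd t t01 => ?.
  apply: is_deriveB; apply: (is_derive_eq (is_derive_monomial _ _ _)).
  by rewrite mulrA mulfVK ?pnatr_eq0.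
have [||t t01] := @MVT R g dg 0 1 ltr01.
- by move=> t; rewrite in_itv /= => /andP[t0 t1]; apply: gd; rewrite !ltW.
- apply: derivable_within_continuous => t; rewrite in_itv /= => /gd [].
  by [].
rewrite subr0 mulr1 /g /dg expr1n mulr1 expr0n /= mulr0 sub0r opprK => e.
have : 0 <= K * t ^+ N - df t by rewrite subr_ge0 fK //; move: t01; rewrite in_itv.
by rewrite -e; move: (K / _) => a; lra.
Qed.

End PowerBoundedDerivative.

Section CosineSeries.
Variables (R : realType) (m : nat) (w : R[i]).
Hypothesis w_prim : m.-primitive_root w.
Implicit Types n k y N : nat.
Local Notation co := (co w).
Local Notation denom := (kernel_denom w).

Let m_gt0 : (0 < m)%N := prim_order_gt0 w_prim.

(** This is 2 ln |1 - w^y|, which explains the halves in the series values below. *)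
Definition log_dist y : R := ln (denom y 1).

Section FixedCoefficients.
Variables h c : nat -> R.
Hypothesis c_cos : forall n, c n = \sum_(1 <= y < m) h y * co (y * n).
Hypothesis c_le1 : forall n, `|c n| <= 1.

Let denom_gt0 y (t : R) : (0 < y < m)%N -> 0 <= t -> 0 < denom y t.
Proof.
move=> /andP[y0 ym]; apply: (kernel_denom_gt0 w_prim).
by apply/negP => /(dvdn_leq y0); rewrite leqNgt ym.
Qed.

(* [W] is the sum of the periodic power series [\sum_n c n * t ^ (n - 1)], whose
   integral over [0, 1] is [L] below. *)
Let W (t : R) := \sum_(1 <= y < m) h y * (co y - t) / denom y t.

Let W_partial_sum N (t : R) : (m %| N)%N -> 0 <= t ->
  \sum_(1 <= n < N.+1) c n * t ^+ n.-1 = W t * (1 - t ^+ N).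
Proof.
move=> mN t0; transitivity
  (\sum_(1 <= y < m) h y * \sum_(1 <= n < N.+1) co (y * n) * t ^+ n.-1).
  under eq_bigr do rewrite c_cos mulr_suml.
  rewrite exchange_big /=; apply: eq_bigr => y _; rewrite mulr_sumr.
  by apply: eq_bigr => n _; rewrite mulrA.
rewrite /W mulr_suml !big_nat; apply: eq_bigr => y y_lt.
have d0 : denom y t != 0 by rewrite lt0r_neq0 // denom_gt0.
rewrite -!mulrA; congr (_ * _); apply: (mulfI d0).
by rewrite (cosine_sum_closed w_prim) // [RHS]mulrCA mulVKf.
Qed.

(** At t = 1 the closed form shows that c sums to 0 over a period, so each t^(n-1) may be replaced
    by t^(n-1) - 1, of absolute value at most 1 - t^m. The factor 1 - t^m then cancels. *)
Let W_le (t : R) : 0 < t < 1 -> `|W t| <= m%:R.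
Proof.
move=> /andP[t0 t1]; have t0' := ltW t0.
have tm : 0 < 1 - t ^+ m by rewrite subr_gt0 exprn_ilt1 // -lt0n.
rewrite -(ler_pM2r tm) -{1}(ger0_norm (ltW tm)) -normrM -W_partial_sum //.
have c0 : \sum_(1 <= n < m.+1) c n = 0.
  transitivity (\sum_(1 <= n < m.+1) c n * 1 ^+ n.-1).
    by apply: eq_bigr => n _; rewrite expr1n mulr1.
  by rewrite (W_partial_sum (dvdnn m) ler01) expr1n subrr mulr0.
have -> : \sum_(1 <= n < m.+1) c n * t ^+ n.-1
    = \sum_(1 <= n < m.+1) (c n * t ^+ n.-1 - c n) by rewrite sumrB c0 subr0.
apply: le_trans (ler_norm_sum _ _ _) _.
apply: le_trans (_ : \sum_(1 <= n < m.+1) (1 - t ^+ m) <= _); last first.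
  by rewrite sumr_const_nat subn1 /= mulr_natl.
rewrite !big_nat; apply: ler_sum => n /andP[n0 nm].
rewrite -[X in _ - X]mulr1 -mulrBr normrM; apply: le_trans (ler_piMl _ (c_le1 n)) _ => //.
rewrite distrC ger0_norm ?subr_ge0 ?exprn_ile1 ?(ltW t1) //.
by rewrite lerD2l lerN2 ler_wiXn2l ?(ltW t1) //; lia.
Qed.

Let L := - (\sum_(1 <= y < m) h y * log_dist y) / 2.

(** An antiderivative of - W t^N that vanishes at 0 and whose value at 1 is the N-th partial sum
    minus L. *)
Let f N (t : R) := \sum_(1 <= n < N.+1) (c n / n%:R) * t ^+ n
  + \sum_(1 <= y < m) (h y / 2) * ln (1 - 2 * t * co y + t ^+ 2).

Let f_derive N (t : R) : (m %| N)%N -> 0 <= t -> is_derive t 1 (f N) (- (W t * t ^+ N)).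
Proof.
move=> mN t0.
have -> : - (W t * t ^+ N) = \sum_(1 <= n < N.+1) (c n / n%:R) * (n%:R * t ^+ n.-1)
  + \sum_(1 <= y < m) (h y / 2) * ((2 * (t - co y)) / (1 - 2 * t * co y + t ^+ 2)).
  have -> : \sum_(1 <= n < N.+1) (c n / n%:R) * (n%:R * t ^+ n.-1)
      = W t * (1 - t ^+ N).
    rewrite -W_partial_sum // !big_nat; apply: eq_bigr => n /andP[n0 _].
    by rewrite mulrA mulfVK // pnatr_eq0 -lt0n.
  have -> : \sum_(1 <= y < m) (h y / 2) *
      ((2 * (t - co y)) / (1 - 2 * t * co y + t ^+ 2)) = - W t.
    rewrite /W -sumrN; apply: eq_bigr => y _; rewrite /kernel_denom.
    by move: (1 - 2 * t * co y + t ^+ 2)^-1 => d; field.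
  by ring.
apply: is_deriveD.
  by apply: is_derive_bigsum => n _; exact: is_derive_monomial.
apply: is_derive_bigsum => y; rewrite mem_index_iota => y_lt.
have d := is_derive_ln_quadratic (denom_gt0 y_lt t0).
exact: (is_deriveZ (h y / 2) d).
Qed.

Let series_bound_multiple N : (m %| N)%N ->
  `|\sum_(1 <= n < N.+1) c n / n%:R - L| <= m%:R / N.+1%:R.
Proof.
move=> mN; have -> : \sum_(1 <= n < N.+1) c n / n%:R - L = f N 1 - f N 0.
  have -> : f N 0 = 0.
    rewrite /f [X in _ + X]big1 ?addr0; last first.
      by move=> y _; rewrite mulr0 mul0r subr0 expr0n addr0 ln1 mulr0.
    rewrite big_nat big1 // => n /andP[n0 _].
    by rewrite expr0n eqn0Ngt n0 mulr0.
  rewrite subr0 /f /L mulNr opprK mulr_suml; congr (_ + _).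
    by apply: eq_bigr => n _; rewrite expr1n mulr1.
  by apply: eq_bigr => y _; rewrite mulrAC.
have Wt (t : R) : 0 < t < 1 -> `|W t * t ^+ N| <= m%:R * t ^+ N.
  move=> t01; have t0 : 0 <= t by rewrite ltW //; case/andP: t01.
  by rewrite normrM (ger0_norm (exprn_ge0 _ t0)) ler_wpM2r ?exprn_ge0 // W_le.
have d (t : R) : 0 <= t <= 1 -> is_derive t 1 (f N) (- (W t * t ^+ N)).
  by case/andP => t0 _; exact: f_derive.
have d' (t : R) : 0 <= t <= 1 -> is_derive t 1 (- f N) (W t * t ^+ N).
  by move=> /d dt; rewrite -[W t * _]opprK; exact: is_deriveN.
rewrite ler_norml lerNl; apply/andP; split.
  rewrite opprB addrC -[f N 0]opprK; apply: (diff_le_of_derive_le_power d') => t t01.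
  by apply: le_trans (ler_norm _) (Wt t t01).
apply: (diff_le_of_derive_le_power d) => t t01.
by apply: le_trans (ler_norm _) _; rewrite normrN Wt.
Qed.

Lemma cosine_series_bound N :
  `|\sum_(1 <= n < N.+1) c n / n%:R - L| <= (2 * m ^ 2)%N%:R / N.+1%:R.
Proof.
(* The closed form holds only at multiples of m. Past the last one, N0, there are at most m terms,
   each at most 1 / (N0 + 1); with N + 1 <= m (N0 + 1) the total is at most 2 m^2 / (N + 1). *)
pose N0 := (N %/ m * m)%N.
have N0N : (N0 <= N)%N by rewrite leq_trunc_div.
have NN0 : (N.+1 <= m * N0.+1)%N.
  by rewrite /N0 mulnS {1}(divn_eq N m) -addnS addnC leq_add ?ltn_mod // leq_pmull.
have NmN0 : (N - N0 <= m)%N by rewrite leq_subLR {1}(divn_eq N m) leq_add2l ltnW // ltn_mod.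
rewrite (@big_cat_nat _ _ _ N0.+1) //= addrAC.
apply: le_trans (_ : m%:R / N0.+1%:R + m%:R / N0.+1%:R <= _); last first.
  rewrite -mulrDl -natrD ler_pdivrMr ?ltr0n // mulrAC ler_pdivlMr ?ltr0n //.
  by rewrite -!natrM ler_nat; nia.
apply: le_trans (ler_normD _ _) (lerD (series_bound_multiple (dvdn_mull _ (dvdnn m))) _).
apply: le_trans (ler_norm_sum _ _ _) _.
apply: le_trans (_ : \sum_(N0.+1 <= n < N.+1) N0.+1%:R^-1 <= _).
  rewrite !big_nat; apply: ler_sum => n /andP[n0 _].
  rewrite normrM normfV (ger0_norm (ler0n R n)) -[leRHS]mul1r.
  apply: (ler_pM (normr_ge0 _) _ (c_le1 n)); rewrite ?invr_ge0 //.
  by rewrite lef_pV2 ?posrE ?ltr0n ?ler_nat // (leq_trans _ n0).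
rewrite sumr_const_nat subSS -[_ *+ (N - N0)]mulr_natl ler_wpM2r ?invr_ge0 //.
by rewrite ler_nat.
Qed.

End FixedCoefficients.

End CosineSeries.

Section PeriodicSums.
Variables (V : nmodType) (m : nat).
Hypothesis m_gt0 : (0 < m)%N.
Implicit Types (F : nat -> V) (u x : nat).

Lemma mulmod_inj u : coprime u m -> {in iota 0 m &, injective (fun x => (u * x) %% m)%N}.
Proof.
move=> um x y; rewrite !mem_iota !add0n /= => xm ym /eqP.
wlog yx : x y xm ym / (y <= x)%N.
  by move=> h; case/orP: (leq_total x y) => [yx|xy] e; [symmetry; apply: h => //; rewrite eq_sym|apply: h].
rewrite eqn_mod_dvd ?leq_mul // -mulnBr Gauss_dvdr ?(coprime_sym m) // => d.
apply/eqP; rewrite eqn_leq yx andbT -subn_eq0 -leqn0.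
have [->//|h0] := posnP (x - y).
by have := dvdn_leq h0 d; lia.
Qed.

Lemma periodic_sum_mul F u : (forall x, F (x %% m)%N = F x) -> coprime u m ->
  \sum_(0 <= x < m) F (u * x)%N = \sum_(0 <= x < m) F x.
Proof.
move=> Fm um; under eq_bigr do rewrite -Fm.
rewrite -(big_map (fun x => (u * x) %% m)%N xpredT F) /= /index_iota subn0.
apply: perm_big.
have un : uniq [seq (u * x) %% m | x <- iota 0 m]%N.
  by rewrite map_inj_in_uniq ?iota_uniq //; exact: mulmod_inj.
apply: uniq_perm; rewrite ?iota_uniq //.
have sub : {subset [seq (u * x) %% m | x <- iota 0 m]%N <= iota 0 m}.
  by move=> y /mapP[x _ ->]; rewrite mem_iota ltn_mod.
by have [] := uniq_min_size un sub _; rewrite ?size_map.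
Qed.

End PeriodicSums.

Lemma periodic_sum1_mul (V : zmodType) m (F : nat -> V) u :
  (0 < m)%N -> (forall x, F (x %% m)%N = F x) -> coprime u m ->
  \sum_(1 <= x < m) F (u * x)%N = \sum_(1 <= x < m) F x.
Proof.
move=> m0 Fm um; have := periodic_sum_mul m0 Fm um.
by rewrite !(big_ltn m0) muln0 => /addrI.
Qed.

(** * Cosine expansion of even periodic functions of mean zero *)

Section FourierInversion.
Variables (R : realType) (m : nat) (w : R[i]).
Hypothesis w_prim : m.-primitive_root w.
Implicit Types n k y N : nat.
Local Notation co := (co w).

Let m_gt0 : (0 < m)%N := prim_order_gt0 w_prim.

Lemma sum_co z : \sum_(0 <= y < m) co (z * y) = if (m %| z)%N then m%:R else 0.
Proof.
case: ifP => [mz|/negbT mz].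
  rewrite (eq_bigr (fun=> 1)) ?sumr_const_nat ?subn0 // => y _.
  by apply/eqP; rewrite (co_eq1 w_prim) dvdn_mulr.
have := cosine_sum_closed w_prim z 1 (dvdnn m).
rewrite expr1n subrr mulr0 => /eqP; rewrite mulf_eq0 gt_eqF ?(kernel_denom_gt0 w_prim) //=.
move=> /eqP h.
transitivity (\sum_(1 <= n < m.+1) co (z * n) * 1 ^+ n.-1); last exact: h.
rewrite big_ltn // [RHS]big_nat_recr //= addrC muln0; congr (_ + _).
  by rewrite expr1n mulr1; apply: (co_mod w_prim); rewrite modnMl mod0n.
by apply: eq_bigr => y _; rewrite expr1n mulr1.
Qed.

Section Inversion.
Variable c : nat -> R.
Hypothesis c_mod : forall n, c (n %% m)%N = c n.
Hypothesis c_even : forall n, c (m.-1 * n)%N = c n.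
Hypothesis c_sum0 : \sum_(0 <= x < m) c x = 0.

Let delta_sum z : \sum_(0 <= x < m) c x * (if (m %| x + z)%N then m%:R else 0)
  = m%:R * c z.
Proof.
rewrite (bigD1_seq ((m.-1 * z) %% m)%N) ?iota_uniq //=; last first.
  by rewrite mem_index_iota ltn_mod.
rewrite ifT; last first.
  by apply/eqP; rewrite modnDml addnC (oppn_mod w_prim) mod0n.
rewrite c_mod c_even mulrC -[RHS]addr0; congr (_ + _).
rewrite big1_seq // => x; rewrite mem_index_iota /= => /andP[xz xm].
rewrite ifF ?mulr0 //; apply: contraNF xz => /eqP h; apply/eqP.
rewrite -[LHS](modn_small xm); apply/eqP; rewrite -(eqn_modDr z) h.
by rewrite addnC eq_sym (oppn_mod w_prim) mod0n.
Qed.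

Definition cosine_coef y : R := (\sum_(0 <= x < m) c x * co (x * y)) / m%:R.

(** The product formula for cosines picks out x = n and x = - n with weight one half each, and
    evenness merges them. Mean zero removes the frequency y = 0, where 1 - w^y vanishes. *)
Lemma cosine_inversion n : c n = \sum_(1 <= y < m) cosine_coef y * co (y * n).
Proof.
have m0 : m%:R != 0 :> R by rewrite pnatr_eq0 -lt0n.
transitivity (\sum_(0 <= y < m) cosine_coef y * co (y * n)); last first.
  rewrite big_ltn // /cosine_coef (eq_bigr c) ?c_sum0 ?mul0r ?add0r //.
  by move=> x _; rewrite muln0 co0 mulr1.
under eq_bigr do rewrite /cosine_coef mulrAC mulr_suml.
rewrite -mulr_suml exchange_big /=; apply: (mulIf m0); rewrite mulfVK //.
transitivity ((m%:R * c n + m%:R * c (m.-1 * n)%N) / 2).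
  by rewrite c_even; field.
rewrite -!delta_sum -big_split mulr_suml /=; apply: eq_bigr => x _.
rewrite -mulrDr -!sum_co -big_split -mulrA mulr_suml mulr_sumr /=.
by apply: eq_bigr => y _; rewrite -mulrA (coM w_prim) !mulnDl -mulnA (mulnC n y) (mulnCA m.-1).
Qed.

Definition cosine_log_sum : R :=
  - (\sum_(1 <= y < m) cosine_coef y * log_dist w y) / 2.

Lemma periodic_series_bound N : (forall n, `|c n| <= 1) ->
  `|\sum_(1 <= n < N.+1) c n / n%:R - cosine_log_sum| <= (2 * m ^ 2)%N%:R / N.+1%:R.
Proof. by move=> c1; exact: (cosine_series_bound w_prim cosine_inversion). Qed.

End Inversion.
End FourierInversion.

(** * Independence of the logarithms [ln |1 - w ^ y|] *)

(** A subgroup of the units modulo m that contains -1, as a predicate on representatives. The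
    equality in [residue_mul] contains both closure under products and cancellation. *)
Record residue_subgroup m (H : pred nat) : Prop := ResidueSubgroup {
  residue_mod : forall n, H (n %% m)%N = H n;
  residue1 : H 1%N;
  residue_coprime : forall x, H x -> coprime x m;
  residue_mul : forall x y, H x -> H (x * y)%N = H y;
  residue_opp : H m.-1 }.

Section CosetDifference.
Variables (R : realType) (m : nat) (w : R[i]).
Hypothesis w_prim : m.-primitive_root w.
Variable H : pred nat.
Hypothesis H_sub : residue_subgroup m H.
Implicit Types (n k y N x u v b : nat).
Local Notation co := (co w).

Let m_gt0 : (0 < m)%N := prim_order_gt0 w_prim.
Let H_mod := residue_mod H_sub.
Let H_mul := residue_mul H_sub.

Lemma residue_eqmod x y : x = y %[mod m] -> H x = H y.
Proof. by move=> e; rewrite -H_mod e H_mod. Qed.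

Lemma residue_mulC x y : H x -> H (y * x)%N = H y.
Proof. by rewrite mulnC => h; rewrite H_mul. Qed.

Lemma residue_mul_eq1 u v x : (u * v = 1 %[mod m])%N -> H (u * v * x)%N = H x.
Proof. by move=> uv; apply: residue_eqmod; rewrite -modnMml uv modnMml mul1n. Qed.

Lemma coprime_mul_eq1 u v : (u * v = 1 %[mod m])%N -> coprime u m.
Proof.
move=> e; have : coprime (u * v) m by rewrite -coprime_modl e coprime_modl coprime1n.
by rewrite coprimeMl => /andP[].
Qed.

(** For u prime to m, the indicator of H minus that of the coset of the inverse of u. *)
Definition coset_diff u x : R := (H x)%:R - (H (u * x)%N)%:R.

Lemma coset_diff_le1 u x : `|coset_diff u x| <= 1.
Proof.
rewrite /coset_diff; case: (H x); case: (H _);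
  by rewrite ?subrr ?subr0 ?sub0r ?normrN ?normr0 ?normr1.
Qed.

Lemma coset_diff_mod u x n : coset_diff u (x * (n %% m)) = coset_diff u (x * n).
Proof.
rewrite /coset_diff (@residue_eqmod (x * (n %% m)) (x * n)) ?modnMmr //.
by rewrite (@residue_eqmod (u * (x * (n %% m))) (u * (x * n))) // !mulnA modnMmr.
Qed.

Lemma coset_diff_even u x n : coset_diff u (x * (m.-1 * n)) = coset_diff u (x * n).
Proof.
have h := residue_opp H_sub.
rewrite /coset_diff [(x * (_ * _))%N]mulnCA [(u * (_ * _))%N]mulnCA.
by rewrite !(H_mul _ h).
Qed.

Lemma residue_noncoprime x n : ~~ coprime x m -> H (x * n)%N = false.
Proof.
move=> xm; apply: contraNF xm => /(residue_coprime H_sub).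
by rewrite coprimeMl => /andP[].
Qed.

Lemma coset_diff_noncoprime u x n : ~~ coprime x m -> coset_diff u (x * n) = 0.
Proof.
move=> xm; rewrite /coset_diff residue_noncoprime // mulnCA residue_noncoprime //.
by rewrite subrr.
Qed.

Lemma coset_diff_sum0 u x : coprime u m ->
  \sum_(0 <= n < m) coset_diff u (x * n) = 0.
Proof.
move=> um; have [xm|xm] := boolP (coprime x m); last first.
  by rewrite big1 // => n _; rewrite coset_diff_noncoprime.
rewrite (periodic_sum_mul m_gt0 (F := coset_diff u)) //; last first.
  by move=> n; have := coset_diff_mod u 1 n; rewrite !mul1n.
rewrite /coset_diff sumrB (periodic_sum_mul m_gt0 (F := fun x => (H x)%:R)) ?subrr //.
by move=> n; rewrite H_mod.
Qed.

Definition coset_log_sum u x : R := cosine_log_sum m w (fun n => coset_diff u (x * n)).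

Lemma coset_series_bound u x N : coprime u m ->
  `|log_series (coset_diff u) x N - coset_log_sum u x| <= (2 * m ^ 2)%N%:R / N.+1%:R.
Proof.
move=> um; apply: (periodic_series_bound w_prim).
- exact: coset_diff_mod.
- exact: coset_diff_even.
- exact: coset_diff_sum0.
- by move=> n; exact: coset_diff_le1.
Qed.

Lemma coset_log_sum_eq u x y : (forall n, H (x * n)%N = H (y * n)%N) ->
  coset_log_sum u x = coset_log_sum u y.
Proof.
move=> e; congr (cosine_log_sum _ _); apply/funext => n.
by rewrite /coset_diff e (mulnCA u) e (mulnCA u).
Qed.

Let log_dist_mod y : log_dist w (y %% m) = log_dist w y.
Proof. by rewrite /log_dist /kernel_denom (co_mod w_prim (modn_mod y m)). Qed.

(* Averaging the Fourier coefficient of the coset of [d] over the substitutions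
   y -> t y, t in H, turns [log_dist y] into its sum over the coset [H y]. *)
Lemma coset_log_sum_eq0 a b x : (a * b = 1 %[mod m])%N ->
  (forall y, (0 < y < m)%N ->
    \sum_(0 <= s < m) (H s)%:R * log_dist w (s * (a * y)) =
    \sum_(0 <= s < m) (H s)%:R * log_dist w (s * y)) ->
  coset_log_sum b x = 0.
Proof.
move=> ab rel; have am := coprime_mul_eq1 ab.
pose U y := \sum_(0 <= s < m) (H s)%:R * log_dist w (s * y).
pose K d y := \sum_(0 <= s < m) (H (d * s)%N)%:R * co (s * y).
pose T d := \sum_(1 <= y < m) K d y * log_dist w y.
pose kappa : R := \sum_(0 <= t < m) (H t)%:R.
have K_mod d y : K d (y %% m)%N = K d y.
  by apply: eq_bigr => s _; rewrite (co_mod w_prim (k := s * y)) // modnMmr.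
have U_mod y : U (y %% m)%N = U y.
  apply: eq_bigr => s _; rewrite -log_dist_mod modnMmr.
  by rewrite log_dist_mod.
have K_inv d t y : H t -> K d (t * y)%N = K d y.
  move=> Ht; rewrite -[RHS](@periodic_sum_mul _ _ m_gt0 _ t) ?(residue_coprime H_sub) //.
    by apply: eq_bigr => s _; rewrite (mulnCA d t) (H_mul _ Ht) mulnCA mulnA.
  move=> s; rewrite (co_mod w_prim (k := s * y)) ?modnMml //.
  by rewrite (@residue_eqmod (d * (s %% m)) (d * s)) ?modnMmr.
have kT d : kappa * T d = \sum_(1 <= y < m) K d y * U y.
  rewrite mulr_suml.
  transitivity (\sum_(0 <= t < m) \sum_(1 <= y < m)
      K d y * ((H t)%:R * log_dist w (t * y))).
    apply: eq_bigr => t _; have [Ht|_] := boolP (H t); last first.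
      by rewrite mul0r big1 // => y _; rewrite mul0r mulr0.
    rewrite mul1r /T -(@periodic_sum1_mul _ m _ t) ?(residue_coprime H_sub) //.
      by apply: eq_bigr => y _; rewrite K_inv // mul1r.
    by move=> y; rewrite K_mod log_dist_mod.
  by rewrite exchange_big /=; apply: eq_bigr => y _; rewrite mulr_sumr.
have kappa_gt0 : 0 < kappa.
  (* Modulo 1 the class of 1 is represented by 0, and 1 falls outside the summation range. *)
  have [m1|m1] := leqP m 1.
    have -> : kappa = 1; last exact: ltr01.
    have e : m = 1%N by apply/eqP; rewrite eqn_leq m1.
    rewrite /kappa e big_nat1 -H_mod e.
    by have := residue1 H_sub; rewrite -H_mod e => ->.
  rewrite /kappa (bigD1_seq 1%N) ?iota_uniq ?mem_index_iota //= (residue1 H_sub) ?m1 //.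
  by rewrite ltr_wpDr ?ltr01 // sumr_ge0.
(* Substituting s -> a s gives [K (b * x) y] = [K x (a * y)]; the relation replaces [U y] by
   [U (a * y)], and then y -> a y is a permutation of the residues. *)
have TE : T (b * x)%N = T x.
  apply: (mulfI (lt0r_neq0 kappa_gt0)); rewrite !kT.
  rewrite -[RHS](@periodic_sum1_mul _ m _ a) //; last by move=> y; rewrite K_mod U_mod.
  rewrite !big_nat; apply: eq_bigr => y y_lt; rewrite {2}/U rel //; congr (_ * _).
  rewrite /K -[LHS](@periodic_sum_mul _ _ m_gt0 _ a) //.
    apply: eq_bigr => s _; rewrite (mulnCA s a); congr (_%:R * co _); last by ring.
    by rewrite -(residue_mul_eq1 (x * s) ab) !mulnA; congr (H _); ring.
  move=> s; rewrite (co_mod w_prim (k := s * y)) ?modnMml //.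
  by rewrite (@residue_eqmod (b * x * (s %% m)) (b * x * s)) ?modnMmr.
rewrite /coset_log_sum /cosine_log_sum.
suff -> : \sum_(1 <= y < m) cosine_coef m w (fun n => coset_diff b (x * n)) y
    * log_dist w y = (T x - T (b * x)%N) / m%:R.
  by rewrite TE subrr mul0r oppr0 mul0r.
rewrite /T -sumrB mulr_suml; apply: eq_bigr => y _.
rewrite mulrAC -mulrBl /cosine_coef; congr (_ * _ * _).
rewrite /K -sumrB; apply: eq_bigr => s _.
by rewrite /coset_diff mulrBl mulnA.
Qed.

End CosetDifference.

Lemma ln_nat_unbounded (R : realType) (C : R) : exists2 N, (0 < N)%N & C < ln N%:R.
Proof.
exists (Num.truncn (expR C)).+1 => //.
rewrite -[ltLHS]expRK ltr_ln ?posrE ?expR_gt0 ?ltr0n //.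
by have /andP[] := truncn_itv (ltW (expR_gt0 C)).
Qed.

(** * Distribution of the von Mangoldt mass among cosets *)

Section MertensCosets.
Variables (R : realType) (m : nat) (w : R[i]).
Hypothesis w_prim : m.-primitive_root w.
Variable H : pred nat.
Hypothesis H_sub : residue_subgroup m H.
Implicit Types (n k y N x u v b : nat).
Local Notation Lambda := (@von_mangoldt R).
Local Notation coset_log_sum := (coset_log_sum m w H).

Let B : R := (2 * m ^ 2)%N%:R.

Definition coset_mangoldt u N : R :=
  \sum_(1 <= n < N.+1) (H (u * n)%N)%:R * Lambda n / n%:R.

Let Lambda_div_ge0 n : 0 <= Lambda n / n%:R.
Proof. by rewrite divr_ge0 ?von_mangoldt_ge0. Qed.

Lemma coset_mangoldt_ge0 u N : 0 <= coset_mangoldt u N.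
Proof. by apply: sumr_ge0 => n _; rewrite -mulrA mulr_ge0. Qed.

(** As u is outside H, the coset difference is 1 at 1, so the mass on H minus that on the coset is
    within B of - ln N; the mass on H is then dropped by positivity. *)
Lemma coset_mangoldt_lower u N : coprime u m -> ~~ H u -> (0 < N)%N ->
  (forall x, (0 < x)%N -> coset_log_sum u x = 0) ->
  ln N%:R - B <= coset_mangoldt u N.
Proof.
move=> um Hu N0 L0.
have vanishing x n : (0 < x)%N ->
    `|log_series (coset_diff R H u) x n| <= B / n.+1%:R.
  move=> x0; by have := coset_series_bound w_prim H_sub x n um; rewrite L0 // subr0.
have := sum_von_mangoldt_of_vanishing N0 vanishing.
rewrite {2}/coset_diff muln1 (residue1 H_sub) (negbTE Hu) subr0 mul1r.
have -> : \sum_(1 <= n < N.+1) coset_diff R H u n * Lambda n / n%:R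
    = coset_mangoldt 1 N - coset_mangoldt u N.
  rewrite -sumrB; apply: eq_bigr => n _.
  by rewrite /coset_diff mul1n !mulrBl.
by move=> /ler_normlW; have := coset_mangoldt_ge0 1 N; lra.
Qed.

Lemma coset_mangoldt_disjoint u v N : (0 < N)%N ->
  (forall n, H (u * n)%N -> ~~ H (v * n)%N) ->
  coset_mangoldt u N + coset_mangoldt v N <= ln N%:R + 4.
Proof.
move=> N0 uv; apply: le_trans (sum_von_mangoldt_div_le R N0).
rewrite -big_split /=; apply: ler_sum => n _.
rewrite -!mulrA -mulrDl; apply: ler_piMl (Lambda_div_ge0 n) _.
rewrite -natrD -[1]/(1%:R) ler_nat.
by have := uv n; case: (H _); case: (H _) => //= /(_ isT).
Qed.

Section SecondCoset.
Variables a b g g' : nat.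
Hypotheses (ab1 : (a * b = 1 %[mod m])%N) (gg1 : (g' * g = 1 %[mod m])%N).
Hypotheses (Hb : ~~ H b) (Hg : ~~ H g) (Hbg : ~~ H (b * g)%N).
Hypothesis Lb0 : forall x, (0 < x)%N -> coset_log_sum b x = 0.

Let b_coprime : coprime b m.
Proof. by apply: (@coprime_mul_eq1 m b a); rewrite mulnC. Qed.

Let g'_coprime : coprime g' m.
Proof. exact: (coprime_mul_eq1 gg1). Qed.

Let b_g'_disjoint n : H (b * n)%N -> ~~ H (g' * n)%N.
Proof.
move=> h1; apply: contraNN Hbg => h2; rewrite -(residue_mulC H_sub _ h2).
by rewrite (_ : _ * _ = g' * g * (b * n))%N ?(residue_mul_eq1 H_sub _ gg1) //; ring.
Qed.

(* Almost all of the mass of [Lambda n / n] lies in the coset [H (b * n)], on which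
   [coset_log_sum g'] is constant, while its total weighted by [Lambda n / n] is
   bounded. *)
Let Lg0 x : (0 < x)%N -> coset_log_sum g' (x * a) = 0.
Proof.
move=> x0; set l := coset_log_sum g' (x * a).
apply/eqP; apply: contraT => l0.
have Le y : `|coset_log_sum g' y| <= B.
  have := coset_series_bound w_prim H_sub y 0 g'_coprime.
  by rewrite /log_series big_geq // sub0r normrN divr1.
have Lxe e : H (b * e)%N -> coset_log_sum g' (x * e) = l.
  move=> he; apply: coset_log_sum_eq => n.
  rewrite -(residue_mul_eq1 H_sub (x * e * n) ab1).
  rewrite (_ : _ * _ = b * e * (x * a * n))%N; last by ring.
  by rewrite (residue_mul H_sub).
(* The mass outside the coset is at most (ln N + 4) - (ln N - B) = 4 + B and is weighted by values
   at most B, while the full weighted sum is at most 6 B. Hence |l| (ln N - B) is at most 6 B + B (4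
   + B). *)
have [N N0 NC] := ln_nat_unbounded ((6 * B + B * (4 + B)) / `|l| + B).
have := sum_von_mangoldt_log_series_bounded N0 x0
  (fun y n _ => coset_series_bound w_prim H_sub y n g'_coprime).
have -> : \sum_(1 <= e < N.+1) Lambda e / e%:R * coset_log_sum g' (x * e)
   = l * coset_mangoldt b N + \sum_(1 <= e < N.+1)
      (~~ H (b * e)%N)%:R * Lambda e / e%:R * coset_log_sum g' (x * e).
  rewrite mulr_sumr -big_split; apply: eq_bigr => e _ /=.
  case: (boolP (H _)) => [/Lxe ->|_] /=.
    by rewrite !mul0r addr0 mul1r mulrC.
  by rewrite !mul0r mulr0 add0r mul1r.
set r := \sum_(1 <= e < N.+1) _.
have rB : `|r| <= B * (4 + B).
  apply: le_trans (ler_norm_sum _ _ _) _.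
  apply: le_trans (_ : B * \sum_(1 <= e < N.+1) (~~ H (b * e)%N)%:R * Lambda e / e%:R <= _).
    rewrite mulr_sumr; apply: ler_sum => e _.
    have q0 : 0 <= (~~ H (b * e)%N)%:R * Lambda e / e%:R by rewrite -mulrA mulr_ge0.
    by rewrite normrM (ger0_norm q0) mulrC ler_wpM2r.
  rewrite ler_wpM2l //.
  have := sum_von_mangoldt_div_le R N0.
  have -> : \sum_(1 <= n < N.+1) Lambda n / n%:R = coset_mangoldt b N
      + \sum_(1 <= e < N.+1) (~~ H (b * e)%N)%:R * Lambda e / e%:R.
    rewrite -big_split; apply: eq_bigr => e _ /=.
    by case: (H _); rewrite /= !mul0r mul1r ?addr0 ?add0r.
  by have := coset_mangoldt_lower b_coprime Hb N0 Lb0; lra.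
have l_gt0 : 0 < `|l| by rewrite normr_gt0.
have Db := coset_mangoldt_lower b_coprime Hb N0 Lb0.
move=> tot; move: NC; rewrite -ltrBrDr ltr_pdivrMr // => NC.
have : `|l * coset_mangoldt b N| <= 6 * B + B * (4 + B).
  rewrite -[l * _](addrK r); apply: le_trans (ler_normB _ _) _.
  exact: lerD.
rewrite normrM (ger0_norm (coset_mangoldt_ge0 _ _)) => h.
have := le_lt_trans h NC; rewrite mulrC ltr_pM2r // => h2.
by have := lt_le_trans h2 Db; rewrite ltxx.
Qed.

(** Each of the two disjoint cosets has mass at least ln N - B, but together they have at most ln N
    + 4. *)
Lemma two_nontrivial_cosets : False.
Proof.
have Hg' : ~~ H g'.
  apply: contraNN Hg => h; rewrite -(residue_mul H_sub _ h).
  by rewrite -[(_ * _)%N]muln1 (residue_mul_eq1 H_sub _ gg1) (residue1 H_sub).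
have b0 : (0 < b)%N.
  rewrite lt0n; apply: contraNneq Hb => b0.
  by have := residue_eqmod H_sub ab1; rewrite b0 muln0 (residue1 H_sub).
have Lg x : (0 < x)%N -> coset_log_sum g' x = 0.
  move=> x0; rewrite -(@Lg0 (x * b)) ?muln_gt0 ?x0 //.
  apply: coset_log_sum_eq => n; rewrite -(residue_mul_eq1 H_sub _ ab1).
  by congr (H _); ring.
have [N N0 NC] := ln_nat_unbounded (4 + 2 * B).
have := coset_mangoldt_lower b_coprime Hb N0 Lb0.
have := coset_mangoldt_lower g'_coprime Hg' N0 Lg.
have := coset_mangoldt_disjoint N0 b_g'_disjoint.
by move: NC; lra.
Qed.

End SecondCoset.
End MertensCosets.

(** * Monsky's argument for real characters *)

Section ElementaryInequalities.
Variable R : realType.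
Implicit Types (n k N K : nat).

Lemma abel_bound (a b : nat -> R) (A : R) N : (0 < N)%N ->
  (forall k, `|\sum_(1 <= n < k.+1) a n| <= A) ->
  (forall n, (0 < n)%N -> b n.+1 <= b n) -> (forall n, (0 < n)%N -> 0 <= b n) ->
  `|\sum_(1 <= n < N.+1) a n * b n| <= A * b 1%N.
Proof.
move=> N0 aA bdec b0; pose S k := \sum_(1 <= n < k.+1) a n.
suff H : `|\sum_(1 <= n < N.+1) a n * b n - S N * b N| <= A * (b 1%N - b N).
  rewrite -[X in `|X|](subrK (S N * b N)); apply: le_trans (ler_normD _ _) _.
  apply: le_trans (lerD H (_ : _ <= A * b N)) _; last by rewrite -mulrDr subrK.
  by rewrite normrM (ger0_norm (b0 _ N0)); exact: ler_wpM2r (b0 _ N0) _ _ (aA N).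
case: N N0 => // N _; elim: N => [|N IH].
  by rewrite /S !big_nat1 !subrr normr0 mulr0.
rewrite big_nat_recr //=; move: IH; set s := \sum_(1 <= n < N.+2) a n * b n => IH.
have -> : s + a N.+2 * b N.+2 - S N.+2 * b N.+2
   = (s - S N.+1 * b N.+1) + S N.+1 * (b N.+1 - b N.+2).
  by rewrite /S (big_nat_recr N.+2) //=; ring.
apply: le_trans (ler_normD _ _) _.
apply: le_trans (lerD IH (_ : _ <= A * (b N.+1 - b N.+2))) _; last first.
  by rewrite -mulrDr addrA subrK.
have d : 0 <= b N.+1 - b N.+2 by rewrite subr_ge0 bdec.
by rewrite normrM (ger0_norm d); exact: ler_wpM2r d _ _ (aA N.+1).
Qed.

Lemma bernoulli_sub (u : R) n : 0 <= u <= 1 -> 1 - n%:R * u <= (1 - u) ^+ n.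
Proof.
move=> /andP[u0 u1]; elim: n => [|n IH]; first by rewrite mul0r subr0.
have n0 : 0 <= n%:R :> R by [].
have u1' : 0 <= 1 - u by rewrite subr_ge0.
rewrite exprS; apply: le_trans (ler_wpM2l u1' IH).
by rewrite -natr1; nra.
Qed.

Lemma exp_sub_le (u : R) n : 0 <= u <= 1 -> (1 - u) ^+ n * (1 + n%:R * u) <= 1.
Proof.
move=> /andP[u0 u1]; elim: n => [|n IH]; first by rewrite mul0r addr0 mulr1.
apply: le_trans IH; rewrite exprSr -mulrA ler_wpM2l ?exprn_ge0 ?subr_ge0 //.
have n0 : 0 <= n%:R :> R by [].
by rewrite -natr1; nra.
Qed.

Definition geom_sum (x : R) n : R := \sum_(j < n) x ^+ j.

Lemma geom_sumS x n : geom_sum x n.+1 = 1 + x * geom_sum x n.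
Proof.
rewrite /geom_sum big_ord_recl expr0 mulr_sumr; congr (_ + _).
by apply: eq_bigr => j _; rewrite exprS.
Qed.

Lemma geom_sumSr x n : geom_sum x n.+1 = geom_sum x n + x ^+ n.
Proof. by rewrite /geom_sum big_ord_recr. Qed.

Lemma mul1B_geom_sum x n : (1 - x) * geom_sum x n = 1 - x ^+ n.
Proof.
elim: n => [|n IH]; first by rewrite /geom_sum big_ord0 mulr0 subrr.
by rewrite geom_sumSr mulrDr IH exprS; ring.
Qed.

(** Arithmetic-geometric mean on the terms j and n - 1 - j, whose geometric mean is y^(n-1); the
    induction removes the outer pair. The base is a square so that this mean is a power of y. *)
Lemma geom_sum_lower (y : R) n : 0 <= y -> n%:R * y ^+ n.-1 <= geom_sum (y ^+ 2) n.
Proof.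
move=> y0; elim/ltn_ind: n => [[|[|n]]] IH; first by rewrite /geom_sum big_ord0 mul0r.
  by rewrite geom_sumS /geom_sum big_ord0 mulr0 mulr1 addr0.
rewrite geom_sumSr geom_sumS /= -!natr1.
have h1 : 2 * y ^+ n.+1 <= 1 + (y ^+ 2) ^+ n.+1.
  by rewrite exprAC; have := sqr_ge0 (1 - y ^+ n.+1); lra.
have h2 : n%:R * y ^+ n.+1 <= y ^+ 2 * geom_sum (y ^+ 2) n.
  apply: le_trans (ler_wpM2l _ (IH n _)) => //; last by rewrite exprn_ge0.
  case: n {IH h1} => [|n] /=; first by rewrite !mul0r mulr0.
  by rewrite [leRHS]mulrCA -exprD add2n.
lra.
Qed.

(* [(1 - x)] times the weight [1 / (n (1 - x)) - x^n / (1 - x^n)] of Monsky's proof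
   that L(1, chi) <> 0. *)
Definition monsky_weight (x : R) n : R := n%:R^-1 - x ^+ n / geom_sum x n.

Lemma geom_sum_ge1 (x : R) n : 0 <= x -> (0 < n)%N -> 1 <= geom_sum x n.
Proof.
case: n => // n x0 _; rewrite geom_sumS lerDl mulr_ge0 // sumr_ge0 // => j _.
exact: exprn_ge0.
Qed.

Lemma monsky_weight_ge0 (x : R) n : 0 <= x <= 1 -> (0 < n)%N -> 0 <= monsky_weight x n.
Proof.
move=> /andP[x0 x1] n0; have g1 := geom_sum_ge1 x0 n0.
have g0 := lt_le_trans ltr01 g1.
rewrite /monsky_weight subr_ge0 ler_pdivrMr // mulrC ler_pdivlMr ?ltr0n //.
rewrite mulr_natr -[n in _ *+ n]card_ord -sumr_const /geom_sum.
by apply: ler_sum => j _; rewrite ler_wiXn2l // ltnW.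
Qed.

(** The difference has the sign of G_n G_(n+1) - n (n+1) x^n, where G is [geom_sum x]; the lower
    bounds n y^(n-1) and (n+1) y^n for the two factors suffice. *)
Lemma monsky_weight_decr (y : R) n : 0 <= y <= 1 -> (0 < n)%N ->
  monsky_weight (y ^+ 2) n.+1 <= monsky_weight (y ^+ 2) n.
Proof.
move=> /andP[y0 y1] n0; set x := y ^+ 2; have x0 : 0 <= x by rewrite exprn_ge0.
have g1 := lt_le_trans ltr01 (geom_sum_ge1 x0 n0).
have g2 := lt_le_trans ltr01 (geom_sum_ge1 x0 (ltn0Sn n)).
have n1 : 0 < n%:R :> R by rewrite ltr0n.
have n2 : 0 < n.+1%:R :> R by rewrite ltr0n.
rewrite -subr_ge0 /monsky_weight.
have -> : n%:R^-1 - x ^+ n / geom_sum x n - (n.+1%:R^-1 - x ^+ n.+1 / geom_sum x n.+1)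
  = (geom_sum x n * geom_sum x n.+1 - n%:R * n.+1%:R * x ^+ n)
    / (n%:R * n.+1%:R * (geom_sum x n * geom_sum x n.+1)).
  move: g1 g2 n1 n2; rewrite geom_sumS exprS -natr1; move: (geom_sum x n) (n%:R) => g t.
  by do 4!move=> /lt0r_neq0 ?; field; apply/and4P.
rewrite divr_ge0 ?mulr_ge0 ?(ltW g1) ?(ltW g2) // subr_ge0.
have -> : n%:R * n.+1%:R * x ^+ n = (n%:R * y ^+ n) * (n.+1%:R * y ^+ n).
  by rewrite /x exprAC expr2; ring.
apply: ler_pM; rewrite ?mulr_ge0 ?exprn_ge0 //.
  apply: le_trans (geom_sum_lower n y0); rewrite ler_wpM2l //.
  by rewrite ler_wiXn2l // leq_pred.
exact: (geom_sum_lower n.+1 y0).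
Qed.

End ElementaryInequalities.

Section RealCharacter.
Variables (R : realType) (chi : nat -> R) (A B : R).
Implicit Types (n k N p v : nat).
Hypothesis chiM : forall x y, chi (x * y)%N = chi x * chi y.
Hypothesis chi1 : chi 1%N = 1.
Hypothesis chi_val : forall n, [|| chi n == 0, chi n == 1 | chi n == -1].
Hypothesis chi_sum : forall N, `|\sum_(1 <= n < N.+1) chi n| <= A.
Hypothesis chi_series : forall N, `|\sum_(1 <= n < N.+1) chi n / n%:R| <= B / N.+1%:R.

Let f n : R := divisor_sum n chi.

Let f_primeX p v n : prime p -> (0 < n)%N -> ~~ (p %| n)%N ->
  f (p ^ v * n) = f n * geom_sum (chi p) v.+1.
Proof.
move=> pp n0 pn; have p0 := prime_gt0 pp; elim: v => [|v IH].
  by rewrite expn0 mul1n /geom_sum big_ord1 expr0 mulr1.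
have N0 : (0 < p ^ v.+1 * n)%N by rewrite muln_gt0 expn_gt0 p0.
have pN : (p %| p ^ v.+1 * n)%N by rewrite expnS -mulnA dvdn_mulr.
rewrite {1}/f (divisor_sum_prime chi N0 p0 pN) geom_sumS mulrDr mulr1 mulrCA -IH.
congr (_ + _).
  rewrite -[f n]/(divisor_sum n chi) (@divisor_sum_widen _ n (p ^ v.+1 * n)); last first.
    by rewrite n0 leq_pmull // expn_gt0 p0.
  rewrite {1}/divisor_sum big_mkcond [RHS]big_mkcond; apply: eq_bigr => d _ /=.
  case: (boolP (p %| d)%N) => [pd|pd].
    by rewrite if_same; case: ifP => // dn; rewrite (dvdn_trans pd dn) in pn.
  rewrite Gauss_dvdr // coprime_sym coprimeXl // prime_coprime //.
rewrite {1}expnS -mulnA mulKn // /f /divisor_sum mulr_sumr.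
by apply: eq_bigr => e _; rewrite chiM.
Qed.

(** For s in {0, 1, -1}, appending two consecutive powers of s never lowers the sum, and a sum of
    length one is 1. *)
Let geom_sum_chi n v : 0 <= geom_sum (chi n) v /\ 1 <= geom_sum (chi n) v.*2.+1.
Proof.
set s := chi n.
have s2 k : 0 <= s ^+ k.+1 * (1 + s).
  by rewrite /s; have /or3P[] := chi_val n => /eqP ->;
     rewrite ?expr0n ?expr1n ?subrr ?mul0r ?mulr0 ?mul1r ?addr_ge0.
have s1 : 0 <= 1 + s.
  by rewrite /s; have /or3P[] := chi_val n => /eqP ->; rewrite ?subrr ?addr0 ?addr_ge0.
have gS k : geom_sum s k.+1 <= geom_sum s k.+3.
  by rewrite (geom_sumSr s k.+2) (geom_sumSr s k.+1) -addrA lerDl; have := s2 k; rewrite mulrDr mulr1 -exprSr.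
have g1 : geom_sum s 1 = 1 by rewrite /geom_sum big_ord1 expr0.
split.
  elim/ltn_ind: v => [[|[|[|v]]]] IH.
  - by rewrite /geom_sum big_ord0.
  - by rewrite g1.
  - by rewrite geom_sumS g1 mulr1.
  - by apply: le_trans (IH v.+1 _) (gS v) => //; lia.
elim: v => [|v IH]; first by rewrite g1.
by rewrite doubleS; apply: le_trans IH (gS _).
Qed.

(** One prime is split off at a time. In a square its exponent is even, so the corresponding
    geometric sum has odd length and is at least 1. *)
Let f_ge n : (0 < n)%N -> 0 <= f n /\ 1 <= f (n * n).
Proof.
elim/ltn_ind: n => n IH n0; have [n1|n1] := leqP n 1.
  have -> : n = 1%N by lia.
  by rewrite muln1 /f /divisor_sum big_mkcond big_nat1 /= chi1.
set p := pdiv n; have pp : prime p by exact: pdiv_prime.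
have [v [n' [n'0 pn' En]]] : exists v n', [/\ (0 < n')%N, ~~ (p %| n')%N & n = (p ^ v.+1 * n')%N].
  have [u pu En] := pfactor_coprime pp n0.
  have lv : (0 < logn p n)%N by rewrite logn_gt0 mem_primes pp n0 pdiv_dvd.
  exists (logn p n).-1, u; rewrite prednK // mulnC -En -prime_coprime // pu; split => //.
  by move: n0; rewrite En muln_gt0 => /andP[].
have n'n : (n' < n)%N.
  rewrite En -[X in (X < _)%N]mul1n ltn_pmul2r // -(expn0 p) ltn_exp2l // prime_gt1 //.
have [f0 f1] := IH _ n'n n'0.
split.
  by rewrite En f_primeX // mulr_ge0 //; case: (geom_sum_chi p v.+2).
have -> : (n * n = p ^ (v.+1).*2 * (n' * n'))%N.
  by rewrite En -addnn expnD; ring.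
rewrite f_primeX ?muln_gt0 ?n'0 // ?Euclid_dvdM ?negb_or ?pn' //.
have [_ g] := geom_sum_chi p v.+1.
by rewrite -[1]mulr1; apply: ler_pM.
Qed.

Let sum_squares_le (F : nat -> R) J M : (forall n, (0 < n)%N -> 0 <= F n) ->
  (J * J <= M)%N -> \sum_(1 <= j < J.+1) F (j * j)%N <= \sum_(1 <= n < M.+1) F n.
Proof.
move=> F0; elim: J M => [|J IH] M JM.
  by rewrite big_geq // big_nat sumr_ge0 // => n /andP[n0 _]; exact: F0.
have JJ : (J * J < J.+1 * J.+1)%N by rewrite ltn_mul.
have JM' : (J * J <= M)%N by apply: leq_trans JM; exact: ltnW.
rewrite big_nat_recr //= [leRHS](@big_cat_nat _ _ _ (J * J).+1) //=.
apply: lerD; first exact: IH.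
rewrite (@big_cat_nat _ _ _ (J.+1 * J.+1)) //=; last exact: leqW.
rewrite ler_wpDl //.
  by rewrite big_nat sumr_ge0 // => n /andP[n0 _]; rewrite F0 // (leq_trans _ n0).
rewrite big_ltn ?ltnS // lerDl big_nat sumr_ge0 // => n /andP[n0 _].
by rewrite F0 // (leq_trans _ n0).
Qed.

(* Monsky's Lambert series argument, with all series truncated at [M]. *)
Let lambert_bound (y : R) M : 0 < y < 1 -> (0 < M)%N ->
  \sum_(1 <= n < M.+1) f n * (y ^+ 2) ^+ n
  <= B / M.+1%:R / (1 - y ^+ 2) + A + M%:R * (y ^+ 2) ^+ M / (1 - y ^+ 2).
Proof.
move=> /andP[y0 y1] M0; set x := y ^+ 2.
have x0 : 0 < x by rewrite exprn_gt0.
have x1 : x < 1 by rewrite /x exprn_ilt1 // ltW.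
have q0 : 0 < 1 - x by rewrite subr_gt0.
have gp n : (0 < n)%N -> 0 < geom_sum x n.
  by move=> n0; apply: lt_le_trans (geom_sum_ge1 (ltW x0) n0).
pose T := \sum_(1 <= n < M.+1) chi n * (x ^+ n / geom_sum x n).
have TB : T <= B / M.+1%:R + A * (1 - x).
  have -> : T = \sum_(1 <= n < M.+1) chi n / n%:R
     - \sum_(1 <= n < M.+1) chi n * monsky_weight x n.
    by rewrite -sumrB; apply: eq_bigr => n _; rewrite /monsky_weight; ring.
  apply: lerD; first exact: ler_normlW (chi_series M).
  apply: ler_normlW; rewrite normrN.
  have -> : A * (1 - x) = A * monsky_weight x 1.
    by rewrite /monsky_weight /geom_sum big_ord1 expr0 expr1 invr1 mulr1.
  apply: abel_bound => // n n0.
    by apply: monsky_weight_decr => //; rewrite !ltW.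
  by apply: monsky_weight_ge0 => //; rewrite !ltW.
(* Grouping n = d k gives geometric series in x^d cut at k <= M / d; the subtracted sum collects
   their tails, each at most x^M / (1 - x). *)
have -> : \sum_(1 <= n < M.+1) f n * x ^+ n = T / (1 - x)
   - \sum_(1 <= d < M.+1) chi d * (x ^+ (d * (M %/ d).+1) / ((1 - x) * geom_sum x d)).
  transitivity (\sum_(1 <= n < M.+1) divisor_sum n (fun d => chi d * x ^+ n)).
    by apply: eq_bigr => n _; rewrite /f /divisor_sum mulr_suml.
  rewrite (divisor_sum_hyperbola M (fun n d => chi d * x ^+ n)).
  rewrite /T mulr_suml -sumrB !big_nat; apply: eq_bigr => d /andP[d0 _].
  rewrite -mulr_sumr -!mulrA -mulrBr; congr (_ * _).
  have g0 := lt0r_neq0 (gp d d0); have q0' := lt0r_neq0 q0.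
  have -> : \sum_(1 <= k < (M %/ d).+1) x ^+ (d * k)
     = x ^+ d * geom_sum (x ^+ d) (M %/ d).
    rewrite /geom_sum big_add1 big_mkord mulr_sumr; apply: eq_bigr => k _.
    by rewrite -exprM -exprD mulnS.
  apply: (mulfI (mulf_neq0 q0' g0)).
  rewrite {1}mul1B_geom_sum mulrCA mul1B_geom_sum -exprM mulnS exprD.
  by field; rewrite q0' g0.
apply: lerD.
  by rewrite ler_pdivrMr // mulrDl mulfVK // lt0r_neq0.
apply: le_trans (ler_norm _) _; rewrite normrN; apply: le_trans (ler_norm_sum _ _ _) _.
apply: le_trans (_ : \sum_(1 <= d < M.+1) x ^+ M / (1 - x) <= _); last first.
  by rewrite sumr_const_nat subn1 /= -[_ *+ M]mulr_natl mulrA.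
rewrite !big_nat; apply: ler_sum => d /andP[d0 _].
have chi_le1 : `|chi d| <= 1.
  by have /or3P[] := chi_val d => /eqP ->; rewrite ?normrN ?normr0 ?normr1.
rewrite normrM; apply: le_trans (ler_piMl (normr_ge0 _) chi_le1) _.
have g1 := geom_sum_ge1 (ltW x0) d0.
have xn k : 0 <= x ^+ k by rewrite exprn_ge0 // ltW.
have den : 0 < (1 - x) * geom_sum x d by rewrite mulr_gt0 ?gp.
rewrite (ger0_norm (divr_ge0 (xn _) (ltW den))).
apply: ler_pM; rewrite ?xn ?invr_ge0 ?(ltW den) //.
  by rewrite ler_wiXn2l ?(ltW x0) ?(ltW x1) // mulnC ltnW // ltn_ceil.
by rewrite lef_pV2 ?posrE ?den ?q0 // ler_peMr // ltW.
Qed.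

(** With x = (1 - u)^2 and 4 J^2 u = 1, the squares j^2 with j <= J already contribute J (1 - 2 J^2
    u) = J / 2, whereas the Lambert bound is at most A + 2; J >= 2 A + 5 is a contradiction. *)
Lemma real_character_vanishing_absurd : False.
Proof.
have B0 : 0 <= B.
  by have := le_trans (normr_ge0 _) (chi_series 0); rewrite divr1.
have A0 : 0 <= A by apply: le_trans (normr_ge0 _) (chi_sum 0).
have above (c : R) : exists2 n, (0 < n)%N & c <= n%:R.
  exists (Num.truncn `|c|).+1 => //; apply: le_trans (ler_norm _) _.
  by have /andP[_ /ltW] := truncn_itv (normr_ge0 c).
have [J Jpos JA] := above (2 * A + 5).
have J0 : 0 < J%:R :> R by rewrite ltr0n.
have [u [u0 uJ u1]] : exists u : R, [/\ 0 < u, 4 * J%:R ^+ 2 * u = 1 & u < 1].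
  have J2 : 0 < 4 * J%:R ^+ 2 :> R by rewrite mulr_gt0 // exprn_gt0.
  exists (4 * J%:R ^+ 2)^-1; split; first by rewrite invr_gt0.
    by rewrite mulfV // lt0r_neq0.
  have J1 : 1 <= J%:R :> R by rewrite ler1n.
  by rewrite invf_lt1 //; nra.
(* B / u <= K controls the first term of the Lambert bound. For the last one, (1 - u)^K <= 1 / (K u)
   gives M x^M <= 2 / (K u^2), which is at most u once K >= 2 / u^3. *)
have [K [Kpos KJ K1 K2]] : exists K, [/\ (0 < K)%N, (J * J <= K)%N,
    2 / u ^+ 3 <= K%:R & B / u <= K%:R].
  have [n1 n1p h1] := above (2 / u ^+ 3); have [n2 n2p h2] := above (B / u).
  exists (J * J + n1 + n2)%N; split; first by rewrite addn_gt0 n2p orbT.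
  - by rewrite -addnA leq_addr.
  - by apply: le_trans h1 _; rewrite ler_nat addnAC leq_addl.
  - by apply: le_trans h2 _; rewrite ler_nat leq_addl.
pose M := K.*2; have M0 : (0 < M)%N by rewrite /M double_gt0.
have JM : (J * J <= M)%N by rewrite (leq_trans KJ) // /M -addnn leq_addr.
pose y := 1 - u; pose x := y ^+ 2.
have y01 : 0 < y < 1 by rewrite /y; lra.
have [y0 y1] := andP y01.
have x0 : 0 < x by rewrite exprn_gt0.
have x1 : x < 1 by rewrite /x exprn_ilt1 // ltW.
have qu : u <= 1 - x by rewrite /x /y; nra.
have q0 : 0 < 1 - x by apply: lt_le_trans qu.
have := lambert_bound y01 M0; rewrite -/x.
have t1 : B / M.+1%:R / (1 - x) <= 1.
  rewrite !ler_pdivrMr ?ltr0n // mul1r.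
  move: K2; rewrite ler_pdivrMr // => h; apply: le_trans h _.
  rewrite [leRHS]mulrC; apply: ler_pM; rewrite ?(ltW u0) ?ler0n //.
  by rewrite ler_nat /M -addnn -addnS leq_addr.
have t2 : M%:R * x ^+ M / (1 - x) <= 1.
  rewrite ler_pdivrMr // mul1r; apply: le_trans qu.
  have := exp_sub_le K (_ : 0 <= u <= 1); rewrite -/y; set z := y ^+ K => /(_ _) h.
  have {}h : z * (1 + K%:R * u) <= 1 by apply: h; rewrite !ltW.
  have z0 : 0 <= z by rewrite exprn_ge0 // ltW.
  have xM : x ^+ M <= z ^+ 2.
    have e : (K * 2 <= 2 * M)%N by rewrite /M -muln2 leq_pmull.
    by rewrite /x /z -!exprM (ler_wiXn2l (ltW y0) (ltW y1)) ?e.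
  have zk : z * (K%:R * u) <= 1 by nra.
  have k0 : 0 < K%:R :> R by rewrite ltr0n.
  move: K1; rewrite ler_pdivrMr ?exprn_gt0 // => K1.
  apply: le_trans (ler_wpM2l (ler0n _ _) xM) _.
  have ku : 0 < K%:R * u ^+ 2 by rewrite mulr_gt0 ?exprn_gt0.
  rewrite -(ler_pM2r ku).
  have -> : M%:R = 2 * K%:R :> R by rewrite /M -mul2n natrM.
  have -> : 2 * K%:R * z ^+ 2 * (K%:R * u ^+ 2) = 2 * (z * (K%:R * u)) ^+ 2 by ring.
  have -> : u * (K%:R * u ^+ 2) = K%:R * u ^+ 3 by ring.
  apply: le_trans K1; rewrite ler_piMr // exprn_ile1 // mulr_ge0 //.
  by rewrite mulr_ge0 // ltW.
have low : J%:R / 2 <= \sum_(1 <= n < M.+1) f n * x ^+ n.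
  apply: le_trans (sum_squares_le (F := fun n => f n * x ^+ n) _ JM); last first.
    by move=> n n0; have [fn _] := f_ge n0; exact: mulr_ge0 fn (exprn_ge0 _ (ltW x0)).
  apply: le_trans (_ : \sum_(1 <= j < J.+1) 2^-1 <= _).
    by rewrite sumr_const_nat subn1 /= -[2^-1 *+ J]mulr_natl.
  rewrite !big_nat; apply: ler_sum => j /andP[j0 jJ].
  have [_ f1] := f_ge j0; rewrite -[2^-1]mul1r; apply: ler_pM; rewrite ?ler01 ?invr_ge0 ?ler0n //.
  apply: le_trans (_ : x ^+ (J * J) <= _); last first.
    by rewrite ler_wiXn2l ?ltW // leq_mul.
  rewrite /x -exprM; apply: le_trans (bernoulli_sub _ _); last by rewrite !ltW.
  have -> : (2 * (J * J))%N%:R = 2 * J%:R ^+ 2 :> R by rewrite !natrM expr2.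
  by lra.
by move=> h; have := le_trans low (le_trans h (lerD (lerD t1 (lexx A)) t2)); move: JA; lra.
Qed.

End RealCharacter.

Lemma periodic_partial_sum_bound (R : numDomainType) m (F : nat -> R) N :
  (0 < m)%N -> (forall n, F (n %% m)%N = F n) -> (forall n, `|F n| <= 1) ->
  \sum_(0 <= n < m) F n = 0 -> `|\sum_(1 <= n < N.+1) F n| <= m.+1%:R.
Proof.
move=> m0 Fm F1 F0.
have red q r : \sum_(0 <= n < q * m + r) F n = \sum_(0 <= n < r) F n.
  elim: q => [|q IH]; first by rewrite mul0n.
  rewrite mulSn -addnA (@big_cat_nat _ _ _ m) ?leq_addr //= F0 add0r.
  rewrite -{1}[m]add0n big_addn addKn -IH; apply: eq_bigr => n _.
  by rewrite -Fm modnDr Fm.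
have bound k : `|\sum_(0 <= n < k) F n| <= k%:R.
  apply: le_trans (ler_norm_sum _ _ _) _.
  apply: le_trans (ler_sum _ (fun n _ => F1 n)) _.
  by rewrite sumr_const_nat subn0.
have -> : \sum_(1 <= n < N.+1) F n = \sum_(0 <= n < N.+1) F n - F 0%N.
  by rewrite [in RHS]big_ltn // [RHS]addrC addKr.
apply: le_trans (ler_normB _ _) _; rewrite -natr1; apply: lerD => //.
rewrite (divn_eq N.+1 m) red; apply: le_trans (bound _) _.
by rewrite ler_nat ltnW // ltn_mod.
Qed.

Lemma mod_inverse_exists m g : coprime g m -> exists g', (g' * g = 1 %[mod m])%N.
Proof.
move=> gm; have [m0|m0] := posnP m.
  by exists 1%N; move: gm; rewrite m0 /coprime gcdn0 => /eqP ->.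
exists (g ^ (totient m).-1)%N.
by rewrite -expnSr prednK ?totient_gt0 // Euler_exp_totient.
Qed.

(** The relation says that the product of |1 - w^(s y)| over s in H is unchanged by y -> a y. If b
    were outside H, either a third coset exists and the masses conflict, or H has index two and its
    coset difference is a real character with vanishing series. *)
Lemma franz_independence (R : realType) m (w : R[i]) (H : pred nat) a b :
  m.-primitive_root w -> residue_subgroup m H -> (a * b = 1 %[mod m])%N ->
  (forall y, (0 < y < m)%N ->
    \sum_(0 <= s < m) (H s)%:R * log_dist w (s * (a * y)) =
    \sum_(0 <= s < m) (H s)%:R * log_dist w (s * y)) ->
  H b.
Proof.
move=> w_prim H_sub ab rel; apply: contraT => Hb.
have m0 := prim_order_gt0 w_prim.
have L0 x : coset_log_sum m w H b x = 0 by exact: coset_log_sum_eq0 ab rel.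
have bm : coprime b m by apply: (@coprime_mul_eq1 m b a); rewrite mulnC.
have [[g [gm Hg Hbg]]|nog] := pselect (exists g, [/\ coprime g m, ~~ H g & ~~ H (b * g)%N]).
  have [g' gg] := mod_inverse_exists gm.
  by case: (two_nontrivial_cosets w_prim H_sub ab gg Hb Hg Hbg (fun x _ => L0 x)).
have cover g : coprime g m -> ~~ H g -> H (b * g)%N.
  by move=> gm Hg; apply: contraT => Hbg; case: nog; exists g.
set chi := coset_diff R H b.
have chiH s x : H s -> chi (s * x)%N = chi x.
  by move=> Hs; rewrite /chi /coset_diff mulnCA !(residue_mul H_sub _ Hs).
(* With only two cosets b^2 returns to H, so multiplication by b changes the sign of chi; this gives
   multiplicativity. *)
have Hbb : H (b * b)%N by exact: cover.
have chib x : chi (b * x)%N = - chi x.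
  by rewrite /chi /coset_diff opprB mulnA (residue_mul H_sub _ Hbb).
case: (@real_character_vanishing_absurd R chi m.+1%:R (2 * m ^ 2)%N%:R) => //.
- move=> x y; have [xm|xm] := boolP (coprime x m); last first.
    have c0 n : chi (x * n)%N = 0 by exact: (coset_diff_noncoprime R H_sub).
    by rewrite c0 -[x in chi x * _]muln1 c0 mul0r.
  have [Hx|Hx] := boolP (H x).
    rewrite chiH // -[x in chi x * _]muln1 chiH // /chi /coset_diff.
    by rewrite muln1 (residue1 H_sub) (negbTE Hb) subr0 mul1r.
  have Hbx := cover x xm Hx.
  have cx z : chi (x * z)%N = - chi z by rewrite -[LHS]opprK -(chib (x * z)%N) mulnA chiH.
  rewrite cx -[x in chi x * _]muln1 cx /chi /coset_diff.
  by rewrite muln1 (residue1 H_sub) (negbTE Hb) subr0 mulN1r.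
- by rewrite /chi /coset_diff muln1 (residue1 H_sub) (negbTE Hb) subr0.
- move=> n; rewrite /chi /coset_diff; case: (H n); case: (H _);
    by rewrite ?subrr ?subr0 ?sub0r ?eqxx ?orbT.
- move=> N; apply: periodic_partial_sum_bound => //.
  + by move=> n; have := coset_diff_mod R H_sub b 1 n; rewrite !mul1n.
  + by move=> n; exact: coset_diff_le1.
  + rewrite -[RHS](coset_diff_sum0 w_prim H_sub 1 bm).
    by apply: eq_bigr => n _; rewrite mul1n.
- move=> N; have := coset_series_bound w_prim H_sub 1 N bm; rewrite L0 subr0.
  rewrite /log_series; congr (`|_| <= _).
  by apply: eq_bigr => n _; rewrite mul1n.
Qed.

(** * Multiplicative relations between the numbers [1 - w ^ n] *)

Lemma eqmod_mulr_cancel m u x y : coprime u m -> (x * u = y * u %[mod m])%N ->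
  (x = y %[mod m])%N.
Proof.
move=> um; wlog yx : x y / (y <= x)%N.
  by move=> h e; have [/h|/ltnW/h h'] := leqP y x; [exact|symmetry; apply: h'].
move=> /eqP; rewrite eqn_mod_dvd ?leq_mul2r ?yx ?orbT // -mulnBl.
by rewrite Gauss_dvdl ?(coprime_sym m) // -eqn_mod_dvd // => /eqP.
Qed.

Lemma coprime_eqmod0 m u : (1 < m)%N -> coprime u m -> (m %| u)%N = false.
Proof.
move=> m1 um; apply: contraTF um => mu.
by rewrite /coprime (gcdn_idPr mu); case: m m1 {mu} => [|[]].
Qed.

Section RootOfUnityDifferences.
Variables (R : rcfType) (m : nat) (w : R[i]).
Hypothesis w_prim : m.-primitive_root w.
Implicit Types (t n x y : nat).

Definition rdiff n : R[i] := 1 - w ^+ n.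
Local Notation E := rdiff.

Let m_gt0 : (0 < m)%N := prim_order_gt0 w_prim.

Lemma rdiff_mod x y : (x = y %[mod m])%N -> E x = E y.
Proof. by rewrite /rdiff => h; rewrite -(prim_expr_mod w_prim) h prim_expr_mod. Qed.

Lemma rdiff_eq0 x : (E x == 0) = (m %| x)%N.
Proof. by rewrite /rdiff subr_eq0 eq_sym (prim_order_dvd w_prim). Qed.

(** Replacing an exponent by its opposite costs a sign and a power of w. The parity and divisibility
    conditions of the theorem come from these two factors. *)
Lemma rdiff_opp x y : (m %| x + y)%N -> E y * w ^+ x = - E x.
Proof.
rewrite (prim_order_dvd w_prim) exprD => /eqP e.
by rewrite /rdiff mulrBl mul1r [_ ^+ y * _]mulrC e opprB.
Qed.

Lemma dvdn_mul_coprime t u : coprime u m -> (m %| t * u)%N = (m %| t)%N.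
Proof. by move=> um; rewrite Gauss_dvdl // coprime_sym. Qed.

Lemma sum_prim_root n :
  \sum_(0 <= t < m) w ^+ (t * n) = if (m %| n)%N then m%:R else 0.
Proof.
rewrite (prim_order_dvd w_prim); case: eqP => [h|/eqP h].
  rewrite (eq_bigr (fun=> 1)) ?sumr_const_nat ?subn0 // => t _.
  by rewrite mulnC exprM h expr1n.
have h' : w ^+ n - 1 != 0 by rewrite subr_eq0.
apply: (mulfI h'); rewrite mulr0.
transitivity ((w ^+ n - 1) * \sum_(t < m) (w ^+ n) ^+ t).
  by rewrite big_mkord; congr (_ * _); apply: eq_bigr => t _; rewrite mulnC exprM.
by rewrite -subrX1 exprAC (prim_expr_order w_prim) expr1n subrr.
Qed.

Section ThreeFactors.
Variables A B C D F G : nat.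
Hypothesis m_gt2 : (2 < m)%N.
Hypotheses (cA : coprime A m) (cB : coprime B m) (cC : coprime C m)
  (cD : coprime D m) (cF : coprime F m) (cG : coprime G m).
Hypothesis eqE : forall t, E (t * A) * E (t * B) * E (t * C)
  = E (t * D) * E (t * F) * E (t * G).

Let m_gt1 : (1 < m)%N := ltnW m_gt2.

(** The relation at t = 1 is compared with that at t = -1: negating the three exponents costs the
    same sign on both sides, so the powers of w must agree. *)
Let sum_eqmod : (A + B + C = D + F + G %[mod m])%N.
Proof.
have n0 u : coprime u m -> E u != 0.
  by move=> um; rewrite rdiff_eq0 coprime_eqmod0.
have opp u : E (m.-1 * u) * w ^+ u = - E u.
  by apply: rdiff_opp; rewrite -mulSn prednK // dvdn_mulr.
have prod_opp x y z : E (m.-1 * x) * E (m.-1 * y) * E (m.-1 * z) * w ^+ (x + y + z)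
    = - (E x * E y * E z).
  transitivity ((E (m.-1 * x) * w ^+ x) * (E (m.-1 * y) * w ^+ y)
      * (E (m.-1 * z) * w ^+ z)); first by rewrite !exprD; ring.
  by rewrite !opp; ring.
have e : - (E A * E B * E C) = - (E D * E F * E G).
  by congr (- _); have := eqE 1; rewrite !mul1n.
have Y0 : E (m.-1 * D) * E (m.-1 * F) * E (m.-1 * G) != 0.
  have : - (E D * E F * E G) != 0 by rewrite oppr_eq0 !mulf_neq0 ?n0.
  by apply: contraNneq => Y0; rewrite -prod_opp Y0 mul0r.
move: e; rewrite -!prod_opp eqE => /(mulfI Y0) /eqP.
by rewrite (eq_prim_root_expr w_prim) => /eqP.
Qed.

Let fourier_coef x y z n : \sum_(0 <= t < m) E (t * x) * E (t * y) * E (t * z) * w ^+ (t * n)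
  = m%:R * (((m %| n) + (m %| x + y + n) + (m %| x + z + n) + (m %| y + z + n))%N%:R
     - ((m %| x + n) + (m %| y + n) + (m %| z + n) + (m %| x + y + z + n))%N%:R).
Proof.
have S k : \sum_(0 <= t < m) w ^+ (t * k) = m%:R * (m %| k)%N%:R.
  by rewrite sum_prim_root; case: (m %| k)%N; rewrite ?mulr1 ?mulr0.
rewrite mulrBr !natrD !mulrDr -!S -!big_split -sumrB; apply: eq_bigr => t _ /=.
by rewrite /rdiff !mulnDr !exprD; ring.
Qed.

Let dvdn_addN u x : (m %| x + m.-1 * u)%N = (x == u %[mod m]).
Proof.
have e : (u + m.-1 * u = 0 %[mod m])%N by rewrite -mulSn prednK // modnMr mod0n.
by rewrite -(eqn_modDr (m.-1 * u)) e mod0n.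
Qed.

(* Compares the coefficients of [w ^ (t * A)] on both sides of [eqE]. *)
Lemma three_factors_first : [|| A == D %[mod m], A == F %[mod m], A == G %[mod m]
  | A == B + C %[mod m]].
Proof.
have := fourier_coef D F G (m.-1 * A); rewrite -(eq_bigr _ (fun t _ =>
  congr1 (fun X => X * _) (eqE t))) fourier_coef => /mulfI.
rewrite pnatr_eq0 -lt0n => /(_ m_gt0) /eqP.
rewrite subr_eq addrAC eq_sym subr_eq -!natrD eqr_nat !dvdn_addN.
have false0 x y : coprime y m -> (x + y == x %[mod m])%N = false.
  by move=> ym; rewrite -{2}[x]addn0 eqn_modDl mod0n; exact: coprime_eqmod0.
rewrite -[(m.-1 * A)%N]add0n !dvdn_addN -sum_eqmod eqxx.
rewrite (false0 A B) // (false0 A C) //.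
rewrite !(eq_sym (A %% m)%N).
(* If all four alternatives failed, the coefficient left on the side of A, B, C would be at most -1
   and that on the side of D, F, G nonnegative. *)
case: (D %% m == A %% m)%N => //; case: (F %% m == A %% m)%N => //.
case: (G %% m == A %% m)%N => //; case: ((B + C) %% m == A %% m)%N => //.
by do 7!case: (_ == (A %% m)%N).
Qed.

(** After cancelling the common factor, w^B, w^C and w^F, w^G have the same product and the same
    sum, hence are the roots of one quadratic. *)
Lemma three_factors_rest : (A = D %[mod m])%N ->
  ((B = F %[mod m])%N /\ (C = G %[mod m])%N) \/
  ((B = G %[mod m])%N /\ (C = F %[mod m])%N).
Proof.
move=> AD.
have s : (B + C = F + G %[mod m])%N.
  apply/eqP; rewrite -(eqn_modDl A) addnA sum_eqmod.
  by rewrite -!addnA -[X in X == _]modnDml -AD modnDml.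
have := eqE 1; rewrite !mul1n (rdiff_mod AD) -!mulrA => /mulfI.
rewrite rdiff_eq0 coprime_eqmod0 // => /(_ isT).
have : w ^+ B * w ^+ C = w ^+ F * w ^+ G.
  by rewrite -!exprD; apply/eqP; rewrite (eq_prim_root_expr w_prim) s.
have eqw x y : (w ^+ x == w ^+ y) -> (x = y %[mod m])%N.
  by rewrite (eq_prim_root_expr w_prim) => /eqP.
rewrite /rdiff => p e.
have : (w ^+ B - w ^+ F) * (w ^+ B - w ^+ G) == 0.
  have {}e : w ^+ B + w ^+ C = w ^+ F + w ^+ G.
    transitivity (1 + w ^+ B * w ^+ C - (1 - w ^+ B) * (1 - w ^+ C)); first by ring.
    by rewrite e p; ring.
  apply/eqP; transitivity (w ^+ B ^+ 2 - (w ^+ F + w ^+ G) * w ^+ B + w ^+ F * w ^+ G).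
    by ring.
  by rewrite -e -p; ring.
rewrite mulf_eq0 !subr_eq0 => /orP[/eqw h|/eqw h]; [left|right]; split=> //.
  by apply/eqP; rewrite -(eqn_modDl B) s -modnDml -h modnDml.
by apply/eqP; rewrite -(eqn_modDl B) s addnC -modnDml -h modnDml.
Qed.

End ThreeFactors.

(** As soon as one exponent on the left matches one on the right, the other two pairs match as well.
    Otherwise A = B + C and B = A + C give 2 C = 0, impossible for a unit modulo m > 2. *)
Lemma three_factors_perm A B C D F G : (2 < m)%N ->
  coprime A m -> coprime B m -> coprime C m ->
  coprime D m -> coprime F m -> coprime G m ->
  (forall t, E (t * A) * E (t * B) * E (t * C) = E (t * D) * E (t * F) * E (t * G)) ->
  [\/ (A = D %[mod m])%N /\
       ((B = F %[mod m])%N /\ (C = G %[mod m])%N \/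
        (B = G %[mod m])%N /\ (C = F %[mod m])%N),
      (A = F %[mod m])%N |
      (A = G %[mod m])%N /\
       ((B = F %[mod m])%N /\ (C = D %[mod m])%N \/
        (B = D %[mod m])%N /\ (C = F %[mod m])%N)].
Proof.
move=> m2 cA cB cC cD cF cG e.
have first_case X Y Z : coprime X m -> coprime Y m -> coprime Z m ->
   (forall t, E (t * X) * E (t * Y) * E (t * Z) = E (t * A) * E (t * B) * E (t * C)) ->
   [|| X == D %[mod m], X == F %[mod m], X == G %[mod m] | X == Y + Z %[mod m]].
  by move=> cX cY cZ h; apply: three_factors_first => // t; rewrite h.
have hA := first_case A B C cA cB cC (fun t => erefl).
have hB : [|| B == D %[mod m], B == F %[mod m], B == G %[mod m] | B == A + C %[mod m]].
  by apply: first_case => // t; ring.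
have hC : [|| C == D %[mod m], C == F %[mod m], C == G %[mod m] | C == A + B %[mod m]].
  by apply: first_case => // t; ring.
have rest X Y Z U V W := @three_factors_rest X Y Z U V W m2.
have swapD : forall t, E (t * D) * E (t * F) * E (t * G)
    = E (t * F) * E (t * D) * E (t * G) by move=> t; ring.
have swapG : forall t, E (t * D) * E (t * F) * E (t * G)
    = E (t * G) * E (t * D) * E (t * F) by move=> t; ring.
have swapB : forall t, E (t * B) * E (t * A) * E (t * C)
    = E (t * D) * E (t * F) * E (t * G) by move=> t; rewrite -e; ring.
have swapC : forall t, E (t * C) * E (t * A) * E (t * B)
    = E (t * D) * E (t * F) * E (t * G) by move=> t; rewrite -e; ring.
case/or4P: hA => /eqP hA.
- by constructor 1; split=> //; exact: rest cD cF cG e hA.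
- by constructor 2.
- have e' t : E (t * A) * E (t * B) * E (t * C) = E (t * G) * E (t * F) * E (t * D).
    by rewrite e; ring.
  constructor 3; split=> //.
  by case: (rest A B C G F D cG cF cD e' hA); [left|right].
case/or4P: hB => /eqP hB.
- have [[h1 h2]|[h1 h2]] := rest B A C D F G cD cF cG swapB hB.
    by constructor 2.
  by constructor 3; split=> //; right.
- have e' t : E (t * B) * E (t * A) * E (t * C) = E (t * F) * E (t * D) * E (t * G).
    by rewrite swapB swapD.
  have [[h1 h2]|[h1 h2]] := rest B A C F D G cF cD cG e' hB.
    by constructor 1; split=> //; left.
  by constructor 3; split=> //; left.
- have e' t : E (t * B) * E (t * A) * E (t * C) = E (t * G) * E (t * D) * E (t * F).
    by rewrite swapB swapG.
  have [[h1 h2]|[h1 h2]] := rest B A C G D F cG cD cF e' hB.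
    by constructor 1; split=> //; right.
  by constructor 2.
case/or4P: hC => /eqP hC.
- have [[h1 h2]|[h1 h2]] := rest C A B D F G cD cF cG swapC hC.
    by constructor 2.
  by constructor 3; split=> //; left.
- have e' t : E (t * C) * E (t * A) * E (t * B) = E (t * F) * E (t * D) * E (t * G).
    by rewrite swapC swapD.
  have [[h1 h2]|[h1 h2]] := rest C A B F D G cF cD cG e' hC.
    by constructor 1; split=> //; right.
  by constructor 3; split=> //; right.
- have e' t : E (t * C) * E (t * A) * E (t * B) = E (t * G) * E (t * D) * E (t * F).
    by rewrite swapC swapG.
  have [[h1 h2]|[h1 h2]] := rest C A B G D F cG cD cF e' hC.
    by constructor 1; split=> //; left.
  by constructor 2.
have : (0 = 2 * C %[mod m])%N.
  apply/eqP; rewrite -(eqn_modDl A) addn0 mul2n -addnn addnA.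
  by rewrite {1}hA -[in X in _ == X]modnDml -hB modnDml.
rewrite mod0n => /esym/eqP; rewrite -/(dvdn _ _) dvdn_mul_coprime // => /dvdn_leq.
by move=> /(_ isT); rewrite leqNgt m2.
Qed.

End RootOfUnityDifferences.

(** * The gap identity at roots of unity and the case of equal bases *)

Section GapIdentity.
Variables (R : realType) (m : nat) (w : R[i]).
Hypothesis w_prim : m.-primitive_root w.
Implicit Types (t n x y k : nat).
Local Notation E := (rdiff w).

Let m_gt0 : (0 < m)%N := prim_order_gt0 w_prim.

(** The squared modulus as an element of R; the norm on [R[i]] is itself complex-valued. *)
Definition sqnorm (z : R[i]) : R := complex.Re z ^+ 2 + complex.Im z ^+ 2.

Lemma sqnormM z1 z2 : sqnorm (z1 * z2) = sqnorm z1 * sqnorm z2.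
Proof. by case: z1 => a b; case: z2 => c d; rewrite /sqnorm /=; ring. Qed.

Lemma sqnorm1 : sqnorm 1 = 1.
Proof. by rewrite /sqnorm /= expr1n expr0n addr0. Qed.

Lemma sqnormX z n : sqnorm (z ^+ n) = sqnorm z ^+ n.
Proof. by elim: n => [|n IH]; rewrite ?sqnorm1 // !exprS sqnormM IH. Qed.

Lemma sqnorm_rdiff y : sqnorm (E y) = kernel_denom w y 1.
Proof.
have := co2Dsi2 w_prim y; rewrite /sqnorm /kernel_denom /rdiff /co /si.
case: (w ^+ y) => c d /= h; transitivity (1 - 2 * c + (c ^+ 2 + d ^+ 2)); first by ring.
by rewrite h; ring.
Qed.

Lemma sqnorm_rdiff_gt0 y : ~~ (m %| y)%N -> 0 < sqnorm (E y).
Proof. by move=> my; rewrite sqnorm_rdiff (kernel_denom_gt0 w_prim). Qed.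

(** On the unit circle |1 - z|^2 determines the real part of z, so the two powers of w are equal or
    conjugate. *)
Lemma sqnorm_rdiff_eq x y : sqnorm (E x) = sqnorm (E y) ->
  (x = y %[mod m])%N \/ (m %| x + y)%N.
Proof.
rewrite !sqnorm_rdiff /kernel_denom => h.
have c : co w x = co w y by move: h; rewrite expr1n; lra.
have : (si w x - si w y) * (si w x + si w y) == 0.
  have := co2Dsi2 w_prim x; have := co2Dsi2 w_prim y; rewrite c => h1 h2.
  apply/eqP; transitivity ((co w y ^+ 2 + si w x ^+ 2) - (co w y ^+ 2 + si w y ^+ 2)).
    by ring.
  by rewrite h1 h2 subrr.
rewrite mulf_eq0 => /orP[|] /eqP s; [left|right].
  apply/eqP; rewrite -(eq_prim_root_expr w_prim).
  move: c s; rewrite /co /si; case: (w ^+ x) => ? ?; case: (w ^+ y) => ? ? /= -> /eqP.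
  by rewrite subr_eq0 => /eqP ->.
rewrite -(co_eq1 w_prim) coD c (_ : si w x = - si w y); last by apply/eqP; rewrite -addr_eq0 s.
by rewrite mulNr opprK -!expr2 (co2Dsi2 w_prim).
Qed.

Definition geom_prod (a b k t : nat) : R[i] :=
  \prod_(i < k.+1) E (t * (a ^ (k - i) * b ^ i)).

(* With [z = w ^ t], this is the vanishing at [z] of the polynomial of the gaps after
   multiplication by [(1 - z) * geom_prod t * (1 - z ^ (a ^ k.+1))]. *)
Definition gap_identity (a b k : nat) : Prop :=
  forall t, E t * geom_prod a b k (a * t) = geom_prod a b k t * E (t * a ^ k.+1).

Lemma rdiff0 t : (m %| t)%N -> E t = 0.
Proof. by move=> mt; apply/eqP; rewrite (rdiff_eq0 w_prim). Qed.

Lemma geom_prod0 a b k t : (m %| t)%N -> geom_prod a b k t = 0.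
Proof. by move=> mt; rewrite /geom_prod big_ord_recl rdiff0 ?mul0r // dvdn_mulr. Qed.

Section EqualBases.
Variables a b k : nat.
Hypotheses (a_coprime : coprime a m) (ab : (a = b %[mod m])%N).

Let eqmodX u v n : (u = v %[mod m])%N -> (u ^ n = v ^ n %[mod m])%N.
Proof. by move=> e; rewrite -modnXm e modnXm. Qed.

Let eqmodMl s u v : (u = v %[mod m])%N -> (s * u = s * v %[mod m])%N.
Proof. by move=> e; rewrite -modnMmr e modnMmr. Qed.

Let geom_prod_eq t : geom_prod a b k t = E (t * a ^ k) ^+ k.+1.
Proof.
rewrite -[X in _ ^+ X]card_ord -prodr_const; apply: eq_bigr => i _.
apply: (rdiff_mod w_prim); apply: eqmodMl.
have ik : (i <= k)%N by rewrite -ltnS.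
have -> : (a ^ k = a ^ (k - i) * a ^ i)%N by rewrite -expnD subnK.
by apply: eqmodMl; apply: eqmodX; exact: esym.
Qed.

Lemma gap_identity_eqP : gap_identity a b k <->
  forall t, ~~ (m %| t)%N -> E t * E (t * a ^ k.+1) ^+ k = E (t * a ^ k) ^+ k.+1.
Proof.
have n0 t : ~~ (m %| t)%N -> E (t * a ^ k.+1) != 0.
  by rewrite (rdiff_eq0 w_prim) dvdn_mul_coprime // coprimeXl.
have e t : (a * t * a ^ k = t * a ^ k.+1)%N by rewrite expnS; ring.
split=> [h t mt|h t].
  have := h t; rewrite !geom_prod_eq e => h'; apply: (mulIf (n0 t mt)).
  by rewrite -h' -mulrA -exprSr.
have [mt|mt] := boolP (m %| t)%N.
  by rewrite (rdiff0 mt) (geom_prod0 _ _ _ mt) !mul0r.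
by rewrite !geom_prod_eq e -(h t mt) exprSr mulrA.
Qed.

Hypothesis k_gt0 : (0 < k)%N.

(* The maximum of [|1 - w ^ (a ^ n)|] over [n] propagates along the orbit of [a]. *)
Let pow_max (M x y : R) : 0 < M -> 0 <= x <= M -> 0 <= y <= M ->
  x * y ^+ k = M ^+ k.+1 -> y = M.
Proof.
move=> M0 /andP[x0 xM] /andP[y0 yM] e; apply/eqP; rewrite eq_le yM /=.
rewrite -(ler_pXn2r k_gt0) ?nnegrE ?(ltW M0) // -(ler_pM2l M0) -exprS -e.
by rewrite ler_wpM2r // exprn_ge0.
Qed.

Let f n : R := sqnorm (E (a ^ n)).

(** At t = a^n the identity reads [f n * f (n + k.+1) ^+ k = f (n + k) ^+ k.+1], so a maximum at n +
    k passes to n + k + 1. By periodicity f is constant, and [f 1 = f 0] leaves a = 1 or a = -1. *)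
Lemma gap_identity_eq_pm1 : (1 < m)%N -> gap_identity a b k ->
  (a = 1 %[mod m])%N \/ (m %| a + 1)%N.
Proof.
move=> m1 /gap_identity_eqP h.
have mn n : ~~ (m %| a ^ n)%N by rewrite coprime_eqmod0 // coprimeXl.
have f0 n : 0 < f n by exact: sqnorm_rdiff_gt0.
have fe n : f n * f (n + k.+1)%N ^+ k = f (n + k)%N ^+ k.+1.
  by rewrite /f -!sqnormX -sqnormM !expnD h.
have phi : (0 < totient m)%N by rewrite totient_gt0.
have fper n : f (n + totient m)%N = f n.
  rewrite /f expnD (rdiff_mod w_prim (y := a ^ n)) //.
  by rewrite -modnMmr Euler_exp_totient // modnMmr muln1.
have fperM q n : f (n + q * totient m)%N = f n.
  by elim: q => [|q IH]; rewrite ?mul0n ?addn0 // mulSn addnCA addnC fper IH.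
have [N Nmax] : exists N, forall n, f n <= f N.
  have [|N _ Nmax] := @Order.TotalTheory.arg_maxP _ _ _ (Ordinal phi) xpredT (fun i : 'I_(totient m) => f i).
    by [].
  exists N => n; rewrite (divn_eq n (totient m)) addnC fperM.
  exact: (Nmax (Ordinal (ltn_pmod n phi))).
have next n : (k <= n)%N -> f n = f N -> f n.+1 = f N.
  move=> kn fn; have := fe (n - k)%N; rewrite addnS subnK // fn.
  by apply: pow_max; rewrite ?f0 ?Nmax ?(ltW (f0 _)).
(* Shifting by k periods makes every index at least k, as the propagation step demands. *)
have all n : f (N + k * totient m + n)%N = f N.
  elim: n => [|n IH]; first by rewrite addn0 fperM.
  rewrite addnS; apply: next => //.
  by rewrite -addnA addnCA (leq_trans _ (leq_addr _ _)) // leq_pmulr.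
have const n : f n = f N.
  rewrite -(all (n + (totient m - 1) * (N + k * totient m))%N) -(fperM (N + k * totient m)%N n).
  congr f; have : (totient m = totient m - 1 + 1)%N by rewrite subnK.
  by move: (_ - 1)%N => q ->; ring.
have e : f 1%N = f 0%N by rewrite !const.
have [|] := sqnorm_rdiff_eq e; first by rewrite expn1 expn0; left.
by rewrite expn1 expn0; right.
Qed.

End EqualBases.
End GapIdentity.

Lemma eqmodX m u v n : (u = v %[mod m])%N -> (u ^ n = v ^ n %[mod m])%N.
Proof. by move=> e; rewrite -modnXm e modnXm. Qed.

Lemma eqmodMl m s u v : (u = v %[mod m])%N -> (s * u = s * v %[mod m])%N.
Proof. by move=> e; rewrite -modnMmr e modnMmr. Qed.

Lemma eqmodMr m s u v : (u = v %[mod m])%N -> (u * s = v * s %[mod m])%N.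
Proof. by move=> e; rewrite -modnMml e modnMml. Qed.

Lemma eqmod_mul1 m t u : (u = 1 %[mod m])%N -> (t * u = t %[mod m])%N.
Proof. by move=> e; rewrite -modnMmr e modnMmr muln1. Qed.

Lemma big_powers_shift (T : Type) (idx : T) (op : Monoid.com_law idx) m r K j
    (F : nat -> T) :
  (forall x y, (x = y %[mod m])%N -> F x = F y) -> (r ^ K = 1 %[mod m])%N ->
  \big[op/idx]_(i < K) F (r ^ (i + j))%N = \big[op/idx]_(i < K) F (r ^ i)%N.
Proof.
move=> Fm rK; elim: j => [|j IH]; first by apply: eq_bigr => i _; rewrite addn0.
rewrite -IH; case: K rK {IH} => [|K] rK; first by rewrite !big_ord0.
rewrite big_ord_recr [RHS]big_ord_recl /= Monoid.mulmC; congr (op _ _).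
  by apply: Fm; rewrite addnS -addSn add0n expnD -modnMml rK modnMml mul1n.
by apply: eq_bigr => i _; rewrite addnS -addSn.
Qed.

(** * The cases a = b = -1 and a^K = b^K = 1 *)

Section GapIdentityCases.
Variables (R : realType) (m : nat) (w : R[i]).
Hypothesis w_prim : m.-primitive_root w.
Implicit Types (t n x y : nat).
Local Notation E := (rdiff w).
Let Emod := rdiff_mod w_prim.
Let E0 := rdiff_eq0 w_prim.

(** Powers of a alternate between 1 and -1, so the identity becomes [E (t * a) ^+ K = E t ^+ K] for
    the even number K among k and k + 1. As negating the exponent costs - w^(- t), this says w^(t K)
    = 1. *)
Lemma gap_identity_neg1 a b k : (1 < m)%N -> (a = b %[mod m])%N -> (m %| a + 1)%N ->
  gap_identity w a b k <-> if odd k then (m %| k.+1)%N else (m %| k)%N.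
Proof.
move=> m1 ab a1.
have a0 : (0 < a)%N by case: a a1 {ab} => // /(dvdn_leq (isT : 0 < 0 + 1)%N); rewrite leqNgt m1.
have aa : (a ^ 2 = 1 %[mod m])%N.
  apply/eqP; rewrite eqn_mod_dvd ?expn_gt0 ?a0 // -{2}(exp1n 2) subn_sqr.
  exact: dvdn_mull.
have ca : coprime a m by apply: (@coprime_mul_eq1 m a a); rewrite mulnn.
have apow j : (a ^ j = a ^ (odd j) %[mod m])%N.
  rewrite -{1}[j]odd_double_half expnD -mul2n expnM.
  by rewrite -modnMmr (eqmodX _ aa) exp1n modnMmr muln1.
have Ew t : E (t * a) * w ^+ t = - E t.
  by apply: (rdiff_opp w_prim); rewrite -mulnS -addn1 dvdn_mull.
have En0 t : ~~ (m %| t)%N -> E t != 0 by rewrite E0.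
have key t K : ~~ odd K -> ~~ (m %| t)%N ->
    E (t * a) ^+ K = E t ^+ K <-> (m %| t * K)%N.
  move=> oK mt; have h : E (t * a) ^+ K * w ^+ (t * K) = E t ^+ K.
    by rewrite exprM -exprMn Ew exprNn -signr_odd (negbTE oK) expr0 mul1r.
  rewrite (prim_order_dvd w_prim); split=> [e|/eqP e]; last by rewrite -h e mulr1.
  apply/eqP; apply: (mulfI (expf_neq0 K (En0 t mt))).
  by rewrite mulr1 -{1}e h.
have m1' : ~~ (m %| 1)%N by rewrite dvdn1 gtn_eqF.
rewrite (gap_identity_eqP w_prim k ca ab); case: ifP => ok.
  have e1 t : E (t * a ^ k.+1) = E t.
    by apply: Emod; rewrite -modnMmr apow /= ok expn0 modnMmr muln1.
  have e2 t : E (t * a ^ k) = E (t * a).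
    by apply: Emod; rewrite -modnMmr apow ok expn1 modnMmr.
  split=> [h|h t mt]; last first.
    by rewrite e1 e2 -exprS; apply/esym/key; rewrite /= ?ok // dvdn_mull.
  rewrite -[k.+1]mul1n; apply/key; rewrite /= ?ok //.
  by have := h 1%N m1'; rewrite e1 e2 -exprS => ->.
have e1 t : E (t * a ^ k.+1) = E (t * a).
  by apply: Emod; rewrite -modnMmr apow /= ok expn1 modnMmr.
have e2 t : E (t * a ^ k) = E t.
  by apply: Emod; rewrite -modnMmr apow ok expn0 modnMmr muln1.
split=> [h|h t mt]; last first.
  rewrite e1 e2 exprS; congr (_ * _); apply/key; rewrite ?ok // dvdn_mull //.
rewrite -[k]mul1n; apply/key; rewrite ?ok //.
have := h 1%N m1'; rewrite e1 e2 exprS => /mulfI; apply.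
exact: En0.
Qed.

Section PowersToOne.
Variables a b r K : nat.
Hypotheses (a_coprime : coprime a m) (ar : (a * r = b %[mod m])%N)
  (aK : (a ^ K = 1 %[mod m])%N) (bK : (b ^ K = 1 %[mod m])%N) (K_gt0 : (0 < K)%N).

Definition power_prod t : R[i] := \prod_(i < K) E (t * r ^ i).
Local Notation Q := power_prod.

Lemma pow_ratio1 : (r ^ K = 1 %[mod m])%N.
Proof.
apply: (@eqmod_mulr_cancel m (a ^ K)); first by rewrite coprimeXl.
by rewrite -expnMn mulnC (eqmodX K ar) bK mul1n aK.
Qed.

Let Qmod x y : (x = y %[mod m])%N -> Q x = Q y.
Proof. by move=> e; apply: eq_bigr => i _; apply: Emod; exact: eqmodMr. Qed.

Let term t k (i : 'I_k.+1) : (t * (a ^ (k - i) * b ^ i) = t * a ^ k * r ^ i %[mod m])%N.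
Proof.
have -> : (t * a ^ k * r ^ i = t * (a ^ (k - i) * (a * r) ^ i))%N.
  by rewrite -{1}(@subnK i k) ?(ltnW (ltn_ord i)) -1?ltnS // expnD expnMn; ring.
by apply: eqmodMl; apply: eqmodMl; apply: eqmodX.
Qed.

Let Q0 t : (m %| t)%N -> Q t = 0.
Proof.
move=> mt; rewrite /power_prod (bigD1 (Ordinal K_gt0)) //=.
by rewrite (rdiff0 w_prim) ?mul0r // dvdn_mulr.
Qed.

(** The last of the K + 1 factors of [geom_prod] repeats the first because r^K = 1; the extra
    factors [E t] and [E (a * t)] cancel. *)
Lemma gap_identity_prod : gap_identity w a b K <-> forall t, Q (a * t) = Q t.
Proof.
have P t : geom_prod w a b K t = Q t * E t.
  rewrite /geom_prod big_ord_recr /=; congr (_ * _).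
    apply: eq_bigr => i _; apply: Emod.
    have := @term t K (widen_ord (leqnSn K) i); rewrite /= => ->.
    by apply: eqmodMr; exact: eqmod_mul1.
  apply: Emod; have := @term t K ord_max; rewrite /= => ->.
  by rewrite (eqmod_mul1 _ pow_ratio1) (eqmod_mul1 _ aK).
have e t : E (t * a ^ K.+1) = E (a * t).
  by apply: Emod; rewrite expnS mulnA -modnMmr aK modnMmr muln1 mulnC.
split=> h t; have := h t; rewrite !P e; last first.
  by move=> ->; ring.
have [mt _|mt] := boolP (m %| t)%N; first by rewrite !Q0 // dvdn_mull.
have n1 : E t != 0 by rewrite E0.
have n2 : E (a * t) != 0 by rewrite E0 mulnC dvdn_mul_coprime.
by rewrite mulrA [Q t * E t]mulrC => /(mulIf n2) /(mulfI n1).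
Qed.

(** Here [geom_prod] has exactly K factors and a^k is the inverse of a, so the identity says that Q
    is invariant under t -> a^(-1) t. *)
Lemma gap_identity_prodS k : K = k.+1 ->
  gap_identity w a b k <-> forall t, Q (a * t) = Q t.
Proof.
move=> Kk.
have P t : geom_prod w a b k t = Q (t * a ^ k).
  rewrite /geom_prod /power_prod Kk; apply: eq_bigr => i _.
  by apply: Emod; exact: term.
have e1 t : E (t * a ^ k.+1) = E t.
  by apply: Emod; rewrite -modnMmr -Kk aK modnMmr muln1.
have e2 t : Q (a * t * a ^ k) = Q t.
  apply: Qmod; rewrite (_ : _ * _ = t * a ^ k.+1)%N; last by rewrite expnS; ring.
  by rewrite -modnMmr -Kk aK modnMmr muln1.
split=> h t; last first.
  rewrite !P e1 e2; suff -> : Q (t * a ^ k) = Q t by rewrite mulrC.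
  elim: k {P e1 e2 Kk} => [|j IH]; first by rewrite muln1.
  by rewrite expnS mulnCA h.
have [mt|mt] := boolP (m %| t)%N; first by rewrite !Q0 // dvdn_mull.
have mat : ~~ (m %| a * t)%N by rewrite mulnC dvdn_mul_coprime.
have n1 : E (a * t) != 0 by rewrite E0.
by have := h (a * t)%N; rewrite !P e1 e2 mulrC e2 => /(mulIf n1).
Qed.

End PowersToOne.
End GapIdentityCases.

Lemma ln_prod (R : realType) K (F : nat -> R) : (forall i, 0 < F i) ->
  ln (\prod_(i < K) F i) = \sum_(i < K) ln (F i).
Proof.
move=> F0; elim: K => [|K IH]; first by rewrite !big_ord0 ln1.
by rewrite !big_ord_recr /= lnM ?posrE ?prodr_gt0 // IH.
Qed.

Section SignedPowers.
Variables (m r K : nat).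
Hypotheses (m_gt0 : (0 < m)%N) (rK : (r ^ K = 1 %[mod m])%N) (K_gt0 : (0 < K)%N).

(** The subgroup generated by -1 and r; since r^K = 1, nonnegative exponents already yield
    inverses. *)
Definition signed_power : pred nat :=
  fun n => `[< exists e i, (n = m.-1 ^ e * r ^ i %[mod m])%N >].

Lemma pred_sqr1 : (m.-1 ^ 2 = 1 %[mod m])%N.
Proof.
case: m m_gt0 => // [[|n]] _ /=; first by rewrite !modn1.
by rewrite (_ : _ ^ 2 = n * n.+2 + 1)%N ?modnMDl //; ring.
Qed.

Lemma signed_power_subgroup : residue_subgroup m signed_power.
Proof.
have rK1 : (r * r ^ K.-1 = 1 %[mod m])%N by rewrite -expnS prednK.
have cr : coprime r m by exact: coprime_mul_eq1 rK1.
have cm : coprime m.-1 m by apply: (@coprime_mul_eq1 m _ m.-1); rewrite mulnn pred_sqr1.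
have S n x : (n = x %[mod m])%N -> signed_power n = signed_power x.
  by move=> e; congr asbool; apply/propext; split => -[s [i h]]; exists s, i; rewrite -h e.
have M x y : signed_power x -> signed_power y -> signed_power (x * y).
  move=> /asboolP [e [i hx]] /asboolP [e' [i' hy]]; apply/asboolP.
  exists (e + e')%N, (i + i')%N.
  rewrite (eqmodMr _ hx) (eqmodMl _ hy); congr (_ %% _)%N.
  by rewrite !expnD; ring.
have I x : signed_power x -> exists2 x', signed_power x' & (x * x' = 1 %[mod m])%N.
  move=> /asboolP [e [i hx]]; exists (m.-1 ^ e * (r ^ K.-1) ^ i)%N.
    by apply/asboolP; exists e, (K.-1 * i)%N; rewrite expnM.
  rewrite (eqmodMr _ hx).
  rewrite (_ : _ * _ = (m.-1 ^ 2) ^ e * (r * r ^ K.-1) ^ i)%N; last first.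
    by rewrite !expnMn -!expnM mulnC; ring.
  by rewrite (eqmodMr _ (eqmodX _ pred_sqr1)) (eqmodMl _ (eqmodX _ rK1)) !exp1n.
split=> [n||x|x y hx|].
- by apply: S; rewrite modn_mod.
- by apply/asboolP; exists 0%N, 0%N.
- move=> /asboolP [e [i hx]].
  by rewrite -coprime_modl hx coprime_modl coprimeMl !coprimeXl.
- apply/idP/idP => [h|]; last exact: M.
  have [x' hx' e] := I x hx.
  have ey : (y = x' * (x * y) %[mod m])%N.
    by rewrite mulnA [(x' * x)%N]mulnC (eqmodMr _ e) mul1n.
  by rewrite (S _ _ ey); exact: M.
- by apply/asboolP; exists 1%N, 0%N; rewrite muln1 expn1.
Qed.

End SignedPowers.

Section PowerProductInvariance.
Variables (R : realType) (m : nat) (w : R[i]).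
Hypothesis w_prim : m.-primitive_root w.
Implicit Types (t n x y : nat).
Local Notation E := (rdiff w).
Let Emod := rdiff_mod w_prim.
Let m_gt0 : (0 < m)%N := prim_order_gt0 w_prim.

Variables (a r K : nat).
Hypotheses (a_coprime : coprime a m) (rK : (r ^ K = 1 %[mod m])%N) (K_gt0 : (0 < K)%N).
Local Notation Q := (power_prod w r K).

Let ell := @log_dist R w.

Let ell_mod x y : (x = y %[mod m])%N -> ell x = ell y.
Proof. by move=> e; rewrite /ell /log_dist /kernel_denom (co_mod w_prim e). Qed.

Let ell_opp e x : ell (m.-1 ^ e * x) = ell x.
Proof.
elim: e => [|e IH]; first by rewrite mul1n.
by rewrite expnS -mulnA -IH /ell /log_dist /kernel_denom (coN w_prim).
Qed.

(** Franz's theorem concerns sums U over H, but Q yields sums V over the exponents i < K, where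
    powers of r may repeat and -1 may or may not occur. Summing over both s in H and i < K gives
    [K%:R * U y] as the order of H times [V y], so the invariance passes from V to U. *)
Lemma power_prod_invariant_signed_power : (forall t, Q (a * t) = Q t) ->
  signed_power m r a.
Proof.
move=> QaQ; have H_sub := signed_power_subgroup m_gt0 rK K_gt0.
set H := signed_power m r in H_sub *.
pose U y := \sum_(0 <= s < m) (H s)%:R * ell (s * y).
pose V y := \sum_(i < K) ell (r ^ i * y).
have cr : coprime r m.
  by apply: (@coprime_mul_eq1 m r (r ^ K.-1)); rewrite -expnS prednK.
have H_r i : H (r ^ i)%N by apply/asboolP; exists 0%N, i; rewrite mul1n.
have UH u y : H u -> U (u * y)%N = U y.
  move=> Hu; rewrite -[RHS](@periodic_sum_mul _ _ m_gt0 _ u) ?(residue_coprime H_sub) //.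
    by apply: eq_bigr => s _; rewrite (residue_mul H_sub _ Hu) (mulnC u s) mulnA.
  move=> x; rewrite (residue_mod H_sub); congr (_ * _).
  by apply: ell_mod; rewrite modnMml.
have VH s y : H s -> V (s * y)%N = V y.
  move=> /asboolP [e [j hs]].
  rewrite -[RHS](@big_powers_shift _ _ _ m r K j (fun x => ell (x * y))) //; last first.
    by move=> x x' ex; apply: ell_mod; exact: eqmodMr.
  apply: eq_bigr => i _; rewrite -[RHS](ell_opp e); apply: ell_mod.
  rewrite (_ : m.-1 ^ e * (r ^ _ * _) = r ^ i * (m.-1 ^ e * r ^ j * y))%N; last by rewrite expnD; ring.
  by apply: eqmodMl; exact: eqmodMr.
have KU y : K%:R * U y = (\sum_(0 <= s < m) (H s)%:R) * V y.
  rewrite mulr_suml.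
  transitivity (\sum_(i < K) U (r ^ i * y)%N).
    rewrite (eq_bigr (fun=> U y)) ?sumr_const ?card_ord ?mulr_natl // => i _.
    exact: UH.
  rewrite exchange_big /=; apply: eq_bigr => s _; rewrite -mulr_sumr.
  have [Hs|_] := boolP (H s); last by rewrite !mul0r.
  by rewrite -(VH s y Hs); congr (_ * _); apply: eq_bigr => i _; rewrite mulnCA.
have VaV y : (0 < y < m)%N -> V (a * y)%N = V y.
  move=> /andP[y0 ym].
  have my : ~~ (m %| y)%N by apply/negP => /(dvdn_leq y0); rewrite leqNgt ym.
  have lnQ t : ~~ (m %| t)%N -> ln (sqnorm (Q t)) = V t.
    move=> mt; rewrite /power_prod (big_morph _ (@sqnormM R) (sqnorm1 R)).
    rewrite (@ln_prod R K (fun i => sqnorm (E (t * r ^ i)))) => [|i].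
      by apply: eq_bigr => i _; rewrite (sqnorm_rdiff w_prim) mulnC.
    by rewrite (sqnorm_rdiff_gt0 w_prim) // dvdn_mul_coprime // coprimeXl.
  by rewrite -!lnQ ?QaQ // mulnC dvdn_mul_coprime.
have [b ba] := mod_inverse_exists a_coprime.
have Hb : H b.
  apply: (franz_independence w_prim H_sub (a := a)); first by rewrite mulnC.
  move=> y y_lt; have K0 : K%:R != 0 :> R by rewrite pnatr_eq0 -lt0n.
  by apply: (mulfI K0); rewrite -!/(U _) !KU VaV.
by rewrite -(residue_mul H_sub a Hb) (residue_eqmod H_sub ba) (residue1 H_sub).
Qed.

Lemma power_prod_mul_power j t : (a = r ^ j %[mod m])%N -> Q (a * t) = Q t.
Proof.
move=> e; rewrite -[RHS](@big_powers_shift _ _ _ m r K j (fun x => E (t * x))) //.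
  apply: eq_bigr => i _; apply: Emod.
  rewrite (_ : t * r ^ (i + j) = r ^ j * t * r ^ i)%N; last by rewrite expnD; ring.
  by apply: eqmodMr; exact: eqmodMr.
by move=> x y exy; apply: Emod; exact: eqmodMl.
Qed.

(** Conjugating each factor gives Q(a t) w^(t S) = (-1)^K Q(t), so the invariance means w^(t S) =
    (-1)^K for every t not divisible by m. *)
Lemma power_prod_mul_neg_power j : (2 < m)%N -> (m %| a + r ^ j)%N ->
  (forall t, Q (a * t) = Q t) <-> ~~ odd K /\ (m %| \sum_(i < K) r ^ i)%N.
Proof.
move=> m2 aj; set S := (\sum_(i < K) r ^ i)%N.
have QW t : Q (a * t) * w ^+ (t * S) = (-1) ^+ K * Q t.
  have -> : w ^+ (t * S) = \prod_(i < K) w ^+ (t * r ^ (i + j)).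
    rewrite (@big_powers_shift _ _ _ m r K j (fun x => w ^+ (t * x))) //.
      by rewrite -expr_sum -big_distrr.
    by move=> x y e; apply/eqP; rewrite (eq_prim_root_expr w_prim); apply/eqP; exact: eqmodMl.
  have -> : Q t = \prod_(i < K) E (t * r ^ (i + j)).
    rewrite (@big_powers_shift _ _ _ m r K j (fun x => E (t * x))) //.
    by move=> x y e; apply: Emod; exact: eqmodMl.
  rewrite -[in (-1) ^+ _](card_ord K) -prodr_const -!big_split /=.
  apply: eq_bigr => i _; rewrite mulN1r; apply: (rdiff_opp w_prim).
  rewrite (_ : _ + _ = (a + r ^ j) * (t * r ^ i))%N; last by rewrite expnD; ring.
  exact: dvdn_mulr.
have cr : coprime r m.
  by apply: (@coprime_mul_eq1 m r (r ^ K.-1)); rewrite -expnS prednK.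
have Q0 t : ~~ (m %| t)%N -> Q t != 0.
  move=> mt; apply/prodf_neq0 => i _.
  by rewrite (rdiff_eq0 w_prim) dvdn_mul_coprime // coprimeXl.
split=> [h|[oK mS] t]; last first.
  have := QW t; rewrite -signr_odd (negbTE oK) expr0 mul1r => <-.
  have /eqP -> : w ^+ (t * S) == 1 by rewrite -(prim_order_dvd w_prim) dvdn_mull.
  by rewrite mulr1.
have wS t : ~~ (m %| t)%N -> w ^+ (t * S) = (-1) ^+ K.
  by move=> mt; apply: (mulfI (Q0 t mt)); rewrite [RHS]mulrC -QW h.
have w1 : w ^+ S = (-1) ^+ K.
  by rewrite -[S]mul1n wS // dvdn1 gtn_eqF // ltnW.
(* The value at t = 2, allowed because m > 2, is the square of the one at t = 1, so (-1)^K = 1. *)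
have oK : ~~ odd K.
  apply/negP => oK; have := wS 2; rewrite mulnC exprM w1 -signr_odd oK expr1 sqrrN expr1n.
  have m2' : ~~ (m %| 2)%N by apply/negP => /(@dvdn_leq m 2 isT); rewrite leqNgt m2.
  move=> /(_ m2') /eqP; by rewrite -subr_eq0 opprK -mulr2n pnatr_eq0.
split=> //; rewrite (prim_order_dvd w_prim) w1 -signr_odd (negbTE oK).
by rewrite expr0.
Qed.

End PowerProductInvariance.

(** Here p, pa, pb, X are P at z, z^a, z^b, z^(ab). The identity for (a, b) at z and z^b and that
    for (b, a) at z and z^a reach P(z^(ab)) along two routes. *)
Lemma eliminate_middle (F : comPzRingType) (x p e pa f q pb g ea eb X : F) :
  x * pa = p * e -> ea * X = pa * f -> x * pb = p * q -> eb * X = pb * g ->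
  p * (e * f * eb) = p * (q * g * ea).
Proof.
move=> h1 h2 h3 h4.
transitivity ((p * e) * f * eb); first by ring.
rewrite -h1; transitivity (x * (pa * f) * eb); first by ring.
rewrite -h2; transitivity (x * (eb * X) * ea); first by ring.
rewrite h4; transitivity ((x * pb) * g * ea); first by ring.
by rewrite h3; ring.
Qed.

(** * Classification of the solutions of the gap identities *)

Section Classification.
Variables (R : realType) (m : nat) (w : R[i]).
Hypothesis w_prim : m.-primitive_root w.
Implicit Types (t n x y : nat).
Local Notation E := (rdiff w).
Let Emod := rdiff_mod w_prim.
Let m_gt0 : (0 < m)%N := prim_order_gt0 w_prim.

Lemma gap_identity_one a b k : (a = 1 %[mod m])%N -> gap_identity w a b k.
Proof.
move=> a1 t; have e : E (t * a ^ k.+1) = E t.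
  by apply: Emod; apply: eqmod_mul1; rewrite (eqmodX _ a1) exp1n.
rewrite e mulrC; congr (_ * _); apply: eq_bigr => i _; apply: Emod.
by rewrite (eqmodMr _ (eqmodMr t a1)) mul1n.
Qed.

Lemma geom_prodC a b k t : geom_prod w a b k t = geom_prod w b a k t.
Proof.
rewrite /geom_prod (reindex_inj rev_ord_inj); apply: eq_bigr => i _ /=.
have ik : (i <= k)%N by rewrite -ltnS.
by rewrite subSS (subKn ik) [(a ^ i * _)%N]mulnC.
Qed.

Variables a b k r : nat.
Hypotheses (ca : coprime a m) (cb : coprime b m) (ar : (a * r = b %[mod m])%N).

Definition power_case K : Prop :=
  [/\ (a <> b %[mod m])%N, (a ^ K = 1 %[mod m])%N, (b ^ K = 1 %[mod m])%N &
      (exists i, (a = r ^ i %[mod m])%N) \/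
      [/\ exists i, (m %| a + r ^ i)%N, ~~ odd K & (m %| \sum_(i < K) r ^ i)%N]].

Definition gap_cases : Prop :=
  [\/ (a = 1 %[mod m])%N \/ (b = 1 %[mod m])%N,
      [/\ (a = b %[mod m])%N, (m %| a + 1)%N &
          if odd k then (m %| k.+1)%N else (m %| k)%N],
      power_case k | power_case k.+1].

Let small1 u : (m <= 2)%N -> coprime u m -> (u = 1 %[mod m])%N.
Proof.
move=> m2; case: m m_gt0 m2 => [|[|[|]]] // _ _; first by rewrite !modn1.
by rewrite coprime_sym prime_coprime // dvdn2 negbK !modn2 => ->.
Qed.

Lemma gap_identity_powerP K : (2 < m)%N -> (0 < K)%N ->
  (a ^ K = 1 %[mod m])%N -> (b ^ K = 1 %[mod m])%N ->
  (forall t, power_prod w r K (a * t) = power_prod w r K t) <->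
  (exists i, (a = r ^ i %[mod m])%N) \/
  [/\ exists i, (m %| a + r ^ i)%N, ~~ odd K & (m %| \sum_(i < K) r ^ i)%N].
Proof.
move=> m2 K0 aK bK; have rK := pow_ratio1 ca ar aK bK.
split=> [h|[[i e]|[[i e] oK mS]] t]; last 2 first.
- exact: (power_prod_mul_power w_prim _ _ e).
- by apply: (power_prod_mul_neg_power w_prim rK K0 m2 e).2.
have /asboolP[e [i hi]] := power_prod_invariant_signed_power w_prim ca rK K0 h.
have e2 : (m.-1 ^ e = m.-1 ^ (odd e) %[mod m])%N.
  rewrite -{1}[e]odd_double_half expnD -mul2n expnM.
  by rewrite (eqmod_mul1 _ _) // (eqmodX _ (pred_sqr1 m_gt0)) exp1n.
move: hi; rewrite (eqmodMr _ e2); case: (odd e) => hi; last first.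
  by left; exists i; rewrite hi mul1n.
right; have me : (m %| a + r ^ i)%N.
  apply/eqP; rewrite -modnDml hi modnDml expn1 addnC -mulSn prednK //.
  by rewrite modnMr.
have [oK mS] := (power_prod_mul_neg_power w_prim rK K0 m2 me).1 h.
by split=> //; exists i.
Qed.

Lemma gap_cases_identity : gap_cases -> gap_identity w a b k \/ gap_identity w b a k.
Proof.
have [m2|m2] := leqP m 2.
  by left; apply: gap_identity_one; exact: small1.
case=> [[a1|b1]|[ab a1 kk]|[_ aK bK c]|[_ aK bK c]].
- by left; exact: gap_identity_one.
- by right; exact: gap_identity_one.
- by left; apply/(gap_identity_neg1 w_prim k (ltnW m2) ab a1).
- left; have [k0|k0] := posnP k; last first.
    by apply/(gap_identity_prod w_prim ca ar aK bK k0)/gap_identity_powerP.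
  (* For k = 0 the product has a single factor, and both sides are [E t] times [E (a * t)]. *)
  by rewrite k0 => t; rewrite /geom_prod !big_ord1 /= !expn0 expn1 !muln1 [(a * t)%N]mulnC mulrC.
- left; apply: (gap_identity_prodS w_prim ca ar aK (ltn0Sn k) erefl).2.
  exact/gap_identity_powerP.
Qed.

(** Elimination matches the exponents a^(k+1), a b^(k+1), b with b^(k+1), a^(k+1) b, a. For a <> b,
    a^(k+1) = b^(k+1) gives powers k + 1 equal to 1, a^(k+1) = a^(k+1) b gives b = 1, and a^(k+1) =
    a gives either a = 1 or a^k = b^k = 1. *)
Lemma gap_identity_cases : (0 < k)%N ->
  gap_identity w a b k -> gap_identity w b a k -> gap_cases.
Proof.
move=> k0 ida idb; have [m2|m2] := leqP m 2.
  by constructor 1; left; exact: small1.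
have [ab|ab] := eqVneq (a %% m)%N (b %% m)%N.
  have [a1|a1] := gap_identity_eq_pm1 w_prim ca ab k0 (ltnW m2) ida.
    by constructor 1; left.
  constructor 2; split=> //.
  by apply/(gap_identity_neg1 w_prim k (ltnW m2) ab a1).
have powP K : (a ^ K = 1 %[mod m])%N -> (b ^ K = 1 %[mod m])%N ->
    (0 < K)%N -> (K = k \/ K = k.+1) -> power_case K.
  move=> aK bK K0 Kk; split=> //; first exact/eqP.
  apply/(gap_identity_powerP m2 K0 aK bK); case: Kk => Kk.
    by apply/(gap_identity_prod w_prim ca ar aK bK K0); rewrite Kk.
  by apply/(gap_identity_prodS w_prim ca ar aK K0 Kk).
have case_k : (a ^ k = 1 %[mod m])%N -> (b ^ k = 1 %[mod m])%N -> gap_cases.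
  by move=> aK bK; constructor 3; apply: powP => //; left.
have case_Sk : (a ^ k.+1 = 1 %[mod m])%N -> (b ^ k.+1 = 1 %[mod m])%N -> gap_cases.
  by move=> aK bK; constructor 4; apply: powP => //; right.
have cX u n : coprime u m -> coprime (u ^ n) m by move=> cu; rewrite coprimeXl.
have cM u v : coprime u m -> coprime v m -> coprime (u * v) m.
  by move=> cu cv; rewrite coprimeMl cu.
have triple t : E (t * a ^ k.+1) * E (t * (a * b ^ k.+1)) * E (t * b)
   = E (t * b ^ k.+1) * E (t * (a ^ k.+1 * b)) * E (t * a).
  have [mt|mt] := boolP (m %| t)%N.
    by rewrite !(rdiff0 w_prim (t := t * _)) ?dvdn_mulr // !mulr0.
  have Et0 n : ~~ (m %| n)%N -> E n != 0 by rewrite (rdiff_eq0 w_prim).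
  have P0 : geom_prod w a b k t != 0.
    apply/prodf_neq0 => i _; apply: Et0.
    by rewrite dvdn_mul_coprime // cM ?cX.
  have h1 := ida t; have h2 := ida (b * t)%N; have h3 := idb t; have h4 := idb (a * t)%N.
  rewrite -!(geom_prodC a b) in h3 h4.
  rewrite [(b * (a * t))%N]mulnCA in h4.
  have e1 : (t * (a ^ k.+1 * b) = b * t * a ^ k.+1)%N by ring.
  have e2 : (t * (a * b ^ k.+1) = a * t * b ^ k.+1)%N by ring.
  rewrite e1 e2 (mulnC t a) (mulnC t b); apply: (mulfI P0).
  set X := geom_prod w a b k (a * (b * t)) in h2 h4.
  exact: (eliminate_middle h1 h4 h3 h2).
have dropM u v : coprime v m -> (v = u * v %[mod m])%N -> (u = 1 %[mod m])%N.
  by move=> cv e; apply: (eqmod_mulr_cancel cv); rewrite mul1n.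
have [] := three_factors_perm w_prim m2 (cX _ _ ca) (cM _ _ ca (cX _ _ cb)) cb
  (cX _ _ cb) (cM _ _ (cX _ _ ca) cb) ca triple.
- case=> h1 [[h2 h3]|[h2 h3]]; first by rewrite h3 eqxx in ab.
  have b1 : (b ^ k.+1 = 1 %[mod m])%N by apply: (dropM _ a) => //; rewrite mulnC h2.
  by apply: case_Sk => //; rewrite h1.
- move=> h; constructor 1; right; apply: (dropM _ (a ^ k.+1)%N) => //; first exact: cX.
  by rewrite mulnC.
- case=> h1 h; have a1 : (a ^ k = 1 %[mod m])%N.
    by apply: (dropM _ a) => //; rewrite -expnSr h1.
  case: h => [[h2 h3]|[h2 h3]].
    by apply: case_k => //; apply: (dropM _ b) => //; rewrite -expnSr -h3.
  constructor 1; left; apply: (dropM _ (b ^ k.+1)%N) => //; first exact: cX.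
Qed.

End Classification.

(** * Gaps of geometric monoids *)

Section AperyList.
Implicit Types (a b k n : nat).
Local Open Scope nat_scope.

(* The Apery set of the monoid with respect to [a ^ k]: its least elements in each
   class modulo [a ^ k]. *)
Fixpoint apery_list a b k : seq nat :=
  if k is k'.+1 then
    [seq a * w + c * b ^ k'.+1 | w <- apery_list a b k', c <- iota 0 a]
  else [:: 0].

Lemma size_apery_list a b k : size (apery_list a b k) = a ^ k.
Proof. by elim: k => //= k IH; rewrite size_allpairs IH size_iota -expnSr. Qed.

Lemma geom_monoidS a b k n : geom_monoid a b k.+1 n <->
  exists s x, geom_monoid a b k s /\ n = a * s + x * b ^ k.+1.
Proof.
split=> [[c ->]|[s [x [[c ->] ->]]]].
  exists (\sum_(i < k.+1) c (widen_ord (leqnSn _) i) * (a ^ (k - i) * b ^ i)), (c ord_max).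
  split; first by exists (fun i => c (widen_ord (leqnSn _) i)).
  rewrite big_ord_recr /= subnn expn0 mul1n; congr (_ + _).
  rewrite big_distrr; apply: eq_bigr => i _ /=.
  have ik : i <= k by rewrite -ltnS.
  by rewrite subSn // expnS; ring.
exists (fun i : 'I_k.+2 => if unlift ord_max i is Some j then c j else x).
rewrite [in RHS]big_ord_recr /= unlift_none subnn expn0 mul1n; congr (_ + _).
rewrite big_distrr; apply: eq_bigr => i _ /=.
have -> : widen_ord (leqnSn k.+1) i = lift ord_max i.
  by apply: val_inj => /=; rewrite /bump leqNgt ltn_ord.
rewrite liftK; have ik : i <= k by rewrite -ltnS.
by rewrite subSn // expnS; ring.
Qed.

Lemma geom_monoidD a b k s y : geom_monoid a b k s -> geom_monoid a b k (s + y * b ^ k).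
Proof.
case=> c ->; exists (fun i => c i + (i == ord_max) * y).
rewrite big_ord_recr [in RHS]big_ord_recr /= eqxx subnn expn0 !mul1n mulnDl addnA.
congr (_ + _ + _); apply: eq_bigr => i _ /=.
by rewrite -val_eqE /= ltn_eqF // mul0n addn0.
Qed.

(** In a s + x b^(k+1), the coefficient x is reduced modulo a: its multiple of a is absorbed into s
    as a multiple of b^k, and the remainder is the digit c of [apery_list]. *)
Lemma geom_monoidP a b k n : 0 < a ->
  geom_monoid a b k n <-> exists w j, w \in apery_list a b k /\ n = w + a ^ k * j.
Proof.
move=> a0; elim: k n => [|k IH] n.
  split=> [[c ->]|[w [j [_ ->]]]].
    by exists 0, (c ord0); rewrite mem_head big_ord1 /= !expn0 !mul1n muln1.
  by exists (fun _ => w + j); rewrite big_ord1 /= !expn0 mul1n !muln1.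
rewrite geom_monoidS; split=> [[s [x [sk ->]]]|[w' [j [/allpairsP[[w c] /= [wk _ ->]] ->]]]].
  have [w [j [wk e]]] := (IH (s + (x %/ a * b) * b ^ k)).1 (geom_monoidD _ sk).
  exists (a * w + x %% a * b ^ k.+1), j; split.
    by apply: allpairs_f => //; rewrite mem_iota ltn_mod.
  have ex : x * b ^ k.+1 = a * (x %/ a * b * b ^ k) + x %% a * b ^ k.+1.
    by rewrite {1}(divn_eq x a) expnS; ring.
  by rewrite ex addnA -mulnDr e !expnS; ring.
exists (w + a ^ k * j), c; split; first by apply/IH; exists w, j.
by rewrite !expnS; ring.
Qed.

Section Coprime.
Variables a b : nat.
Hypotheses (a_gt0 : 0 < a) (ab : coprime a b).

(** Modulo a only c b^(k+1) survives, which determines c since b is a unit; cancelling a from the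
    rest determines w modulo a^k. *)
Lemma apery_list_uniq_mod k : uniq (apery_list a b k) /\
  {in apery_list a b k &, injective (fun w => w %% a ^ k)}.
Proof.
elim: k => [|k [uW injW]].
  by split=> // x y; rewrite !inE => /eqP -> /eqP ->.
pose f (w c : nat) := a * w + c * b ^ k.+1.
have injf w c w' c' : w \in apery_list a b k -> w' \in apery_list a b k ->
    c < a -> c' < a -> f w c = f w' c' %[mod a ^ k.+1] -> w = w' /\ c = c'.
  move=> hw hw' ca ca' e.
  have ea : f w c = f w' c' %[mod a].
    by rewrite -(@modn_dvdm (a ^ k.+1)) ?dvdn_exp // e modn_dvdm ?dvdn_exp.
  have cc : c = c'.
    move: ea; rewrite /f ![a * _]mulnC !modnMDl => /eqmod_mulr_cancel.
    rewrite coprimeXl ?(coprime_sym b) // => /(_ isT).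
    by rewrite !modn_small.
  split=> //; apply: injW => //.
  move: e; rewrite /f cc => /eqP; rewrite eqn_modDr.
  by rewrite expnS -!muln_modr // eqn_pmul2l // => /eqP.
split.
  apply: allpairs_uniq; rewrite ?iota_uniq //.
  move=> [w c] [w' c'] /allpairsP [[w1 c1] /= [h1 h2 [-> ->]]].
  move=> /allpairsP [[w2 c2] /= [h3 h4 [-> ->]]] e.
  move: h2 h4; rewrite !mem_iota /= => h2 h4.
  by have [] := injf w1 c1 w2 c2 h1 h3 h2 h4 (congr1 (modn^~ _) e) => -> ->.
move=> _ _ /allpairsP [[w1 c1] /= [h1 h2 ->]] /allpairsP [[w2 c2] /= [h3 h4 ->]] e.
move: h2 h4; rewrite !mem_iota /= => h2 h4.
by have [-> ->] := injf w1 c1 w2 c2 h1 h3 h2 h4 e.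
Qed.

End Coprime.
End AperyList.

Section GapList.
Variables a b k : nat.
Hypotheses (a_gt0 : (0 < a)%N) (ab : coprime a b).
Implicit Types (n w j : nat).
Local Notation q := (a ^ k)%N.
Local Notation W := (apery_list a b k).

(** In each class modulo q the gaps are the numbers below its Apery element w. *)
Definition gap_list : seq nat :=
  [seq w %% q + q * j | w <- W, j <- iota 0 (w %/ q)]%N.

Let q_gt0 : (0 < q)%N. Proof. by rewrite expn_gt0 a_gt0. Qed.

Let W_uniq := (apery_list_uniq_mod a_gt0 ab k).1.
Let W_inj := (apery_list_uniq_mod a_gt0 ab k).2.

Lemma perm_apery_list_mod : perm_eq [seq w %% q | w <- W]%N (iota 0 q).
Proof.
have u : uniq [seq w %% q | w <- W]%N by rewrite map_inj_in_uniq.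
have s : {subset [seq w %% q | w <- W]%N <= iota 0 q}.
  by move=> x /mapP[w _ ->]; rewrite mem_iota ltn_mod.
apply: uniq_perm; rewrite ?iota_uniq //.
by have [] := uniq_min_size u s _; rewrite ?size_map ?size_apery_list ?size_iota.
Qed.

Lemma apery_list_cover n : exists2 w, w \in W & (w = n %[mod q])%N.
Proof.
have : (n %% q)%N \in iota 0 q by rewrite mem_iota ltn_mod.
by rewrite -(perm_mem perm_apery_list_mod) => /mapP[w hw ->]; exists w.
Qed.

Lemma mem_gap_list n : n \in gap_list <-> ~ geom_monoid a b k n.
Proof.
have [w hw wn] := apery_list_cover n.
have Sn : geom_monoid a b k n <-> (w <= n)%N.
  rewrite (geom_monoidP b k n a_gt0); split=> [[w' [j [hw' en]]]|wn'].
    have -> : w = w'; last by rewrite en leq_addr.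
    by apply: W_inj => //; rewrite wn en mulnC addnC modnMDl.
  exists w, ((n - w) %/ q)%N; split=> //.
  by rewrite mulnC divnK ?subnKC // -eqn_mod_dvd //; apply/eqP.
split=> [/allpairsPdep[w' [j [hw' + en]]]|nS].
  rewrite mem_iota add0n /= => jw /Sn wn'.
  have ww : w = w'.
    by apply: W_inj => //; rewrite wn en [(q * j)%N]mulnC addnC modnMDl modn_mod.
  move: wn'; rewrite en ww {1}(divn_eq w' q) addnC leq_add2l mulnC leq_pmul2l //.
  by rewrite leqNgt jw.
have nw : (n < w)%N by rewrite ltnNge; apply/negP => /Sn.
apply/allpairsPdep; exists w, (n %/ q)%N; split=> //.
  rewrite mem_iota add0n /= ltn_divLR // .
  have := divn_eq w q; rewrite wn => e; move: nw; rewrite {1}e {1}(divn_eq n q) ltn_add2r.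
  rewrite ltn_pmul2r // => h.
  rewrite (leq_trans _ (leq_mul h (leqnn q))) // mulSn addnC.
  by rewrite {1}(divn_eq n q) ltn_add2l ltn_mod.
by rewrite wn addnC mulnC -divn_eq.
Qed.

Lemma uniq_gap_list : uniq gap_list.
Proof.
apply: allpairs_uniq_dep => //; first by move=> *; exact: iota_uniq.
move=> [w j] [w' j'] /= /allpairsPdep[w1 [j1 [h1 _ [e1 e2]]]].
move=> /allpairsPdep[w2 [j2 [h2 _ [e3 e4]]]]; rewrite e1 e2 e3 e4 => e.
have ww : w1 = w2.
  apply: W_inj => //; have := congr1 (modn^~ q) e.
  by rewrite ![(q * _)%N]mulnC ![(_ %% _ + _)%N]addnC !modnMDl !modn_mod.
move: e; rewrite ww => /addnI /eqP; rewrite eqn_pmul2l // => /eqP ->.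
by [].
Qed.

Section Sums.
Variable F : comNzRingType.
Implicit Type z : F.

(** In the class of w the powers telescope to z^(w mod q) - z^w. Keeping the factor 1 - z^q keeps
    the formula valid where it vanishes. *)
Lemma gap_list_sum z :
  (\sum_(n <- gap_list) z ^+ n) * (1 - z ^+ q) =
  \sum_(0 <= n < q) z ^+ n - \sum_(w <- W) z ^+ w.
Proof.
have -> : \sum_(0 <= n < q) z ^+ n = \sum_(w <- W) z ^+ (w %% q).
  rewrite -(big_map (fun w => w %% q)%N xpredT (fun n => z ^+ n)) /index_iota subn0.
  by rewrite (perm_big _ perm_apery_list_mod).
rewrite -sumrB big_allpairs_dep mulr_suml; apply: eq_bigr => w _.
have H r J : (\sum_(j <- iota 0 J) z ^+ (r + q * j)) * (1 - z ^+ q)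
    = z ^+ r - z ^+ (r + q * J).
  have -> : iota 0 J = index_iota 0 J by rewrite /index_iota subn0.
  elim: J => [|J IH]; first by rewrite big_geq // mul0r muln0 addn0 subrr.
  by rewrite big_nat_recr //= mulrDl IH mulnS !exprD; ring.
by rewrite H addnC mulnC -divn_eq.
Qed.

End Sums.
End GapList.

(** The recursion of [apery_list] replaces z by z^a and multiplies by a geometric sum in
    z^(b^(k+1)), whose numerator and denominator extend the two products. *)
Lemma apery_list_sum (F : comNzRingType) a b k (z : F) :
  (\sum_(w <- apery_list a b k) z ^+ w) * \prod_(i < k) (1 - z ^+ (a ^ (k - i.+1) * b ^ i.+1))
  = \prod_(i < k) (1 - z ^+ (a ^ (k - i) * b ^ i.+1)).
Proof.
elim: k z => [|k IH] z; first by rewrite big_seq1 expr0 !big_ord0 mul1r.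
have -> : \sum_(w <- apery_list a b k.+1) z ^+ w = (\sum_(w <- apery_list a b k) (z ^+ a) ^+ w)
    * \sum_(0 <= c < a) (z ^+ (b ^ k.+1)) ^+ c.
  rewrite /= big_allpairs_dep mulr_suml; apply: eq_bigr => w _.
  rewrite mulr_sumr /index_iota subn0; apply: eq_bigr => c _.
  by rewrite -!exprM -exprD [(c * _)%N]mulnC.
rewrite big_ord_recr /= subnn expn0 mul1n.
have -> : \prod_(i < k) (1 - z ^+ (a ^ (k.+1 - i.+1) * b ^ i.+1))
   = \prod_(i < k) (1 - (z ^+ a) ^+ (a ^ (k - i.+1) * b ^ i.+1)).
  apply: eq_bigr => i _; rewrite -exprM mulnA -expnS; by rewrite -subSn.
rewrite [RHS]big_ord_recr /= subSnn expn1.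
have -> : \prod_(i < k) (1 - z ^+ (a ^ (k.+1 - i) * b ^ i.+1))
   = \prod_(i < k) (1 - (z ^+ a) ^+ (a ^ (k - i) * b ^ i.+1)).
  apply: eq_bigr => i _; rewrite -exprM mulnA -expnS.
  by rewrite -subSn // ltnW.
rewrite -IH.
have e : (\sum_(0 <= c < a) (z ^+ (b ^ k.+1)) ^+ c) * (1 - z ^+ (b ^ k.+1))
    = 1 - z ^+ (a * b ^ k.+1).
  rewrite big_mkord -opprB mulrN mulrC -subrX1 -exprM opprB.
  by rewrite mulnC.
by rewrite -e; ring.
Qed.

(** * Gap sums at roots of unity *)

Section GapSumsAtRootsOfUnity.
Variables (R : realType) (m : nat) (w : R[i]).
Hypothesis w_prim : m.-primitive_root w.
Implicit Types (t n c : nat).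
Local Notation E := (rdiff w).
Let m_gt0 : (0 < m)%N := prim_order_gt0 w_prim.

Section FixedBases.
Variables a b k : nat.
Hypotheses (a_gt0 : (0 < a)%N) (ab : coprime a b).
Local Notation L := (gap_list a b k).
Let G t : R[i] := \sum_(n <- L) w ^+ (t * n).

(** G(z) (1 - z^q) = (1 - z^q) / (1 - z) - N / D, where N / D is the Apery sum; P(z) = (1 - z^q) D
    and P(z^a) = (1 - z^(a^(k+1))) N, and denominators are cleared. *)
Let G_formula t : E t * G t * geom_prod w a b k t * E (t * a ^ k.+1)
  = geom_prod w a b k t * E (t * a ^ k.+1) - E t * geom_prod w a b k (a * t).
Proof.
set z := w ^+ t.
have Ez n : E (t * n) = 1 - z ^+ n by rewrite /rdiff exprM.
have -> : G t = \sum_(n <- L) z ^+ n by apply: eq_bigr => n _; rewrite exprM.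
pose D := \prod_(i < k) (1 - z ^+ (a ^ (k - i.+1) * b ^ i.+1)).
pose N := \prod_(i < k) (1 - z ^+ (a ^ (k - i) * b ^ i.+1)).
have -> : geom_prod w a b k t = (1 - z ^+ (a ^ k)) * D.
  rewrite /geom_prod big_ord_recl /= subn0 expn0 muln1 Ez; congr (_ * _).
  by apply: eq_bigr => i _; rewrite Ez.
have -> : geom_prod w a b k (a * t) = E (t * a ^ k.+1) * N.
  rewrite /geom_prod big_ord_recl /= subn0 expn0 muln1 expnS; congr (E _ * _).
    by ring.
  apply: eq_bigr => i _; rewrite -Ez; congr E.
  by rewrite -(subnSK (ltn_ord i)) expnS /bump /= add1n; ring.
have geom : (\sum_(0 <= n < a ^ k) z ^+ n) * (1 - z) = 1 - z ^+ (a ^ k).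
  by rewrite big_mkord -opprB mulrN mulrC -subrX1 opprB.
have Et : E t = 1 - z by [].
have h1 := gap_list_sum k a_gt0 ab z; have h2 := apery_list_sum a b k z.
rewrite -/D -/N in h2; rewrite Et -h2 -geom.
set S := \sum_(n <- L) _ in h1 *; set Q := \sum_(0 <= n < _) _ in h1 geom *.
set A := \sum_(n <- _) _ in h1 h2 *; set e := E _.
transitivity ((S * (1 - z ^+ (a ^ k))) * (1 - z) * D * e).
  by rewrite geom; ring.
by rewrite h1; ring.
Qed.

Lemma gap_sums_vanish_identity : coprime a m -> coprime b m ->
  (forall t, ~~ (m %| t)%N -> \sum_(n <- L) w ^+ (t * n) = 0) <-> gap_identity w a b k.
Proof.
move=> ca cb; have n0 t : ~~ (m %| t)%N -> E t != 0 by rewrite (rdiff_eq0 w_prim).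
split=> [h t|h t mt].
  have [mt|mt] := boolP (m %| t)%N.
    by rewrite (rdiff0 w_prim mt) (geom_prod0 w_prim _ _ _ mt) !mul0r.
  have := G_formula t; rewrite /G h // mulr0 !mul0r => /esym/eqP.
  by rewrite subr_eq0 => /eqP.
have := G_formula t; rewrite h subrr => /eqP; rewrite !mulf_eq0.
have /negbTE -> := n0 t mt.
have /negbTE -> : geom_prod w a b k t != 0.
  apply/prodf_neq0 => i _; apply: n0.
  by rewrite dvdn_mul_coprime // coprimeMl !coprimeXl.
have /negbTE -> : E (t * a ^ k.+1) != 0 by apply: n0; rewrite dvdn_mul_coprime // coprimeXl.
by rewrite !orbF => /eqP.
Qed.

(** If a prime p divides b and m, then z = w^(m/p) has order p while p divides every Apery element,
    so the Apery sum is q = a^k. Vanishing of the gap sum makes the sum of z^n over n < q equal to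
    q, yet the real part of z is less than 1 and q > 1. *)
Lemma gap_sums_vanish_coprime : (1 < a)%N -> (0 < k)%N ->
  (forall t, ~~ (m %| t)%N -> \sum_(n <- L) w ^+ (t * n) = 0) -> coprime b m.
Proof.
move=> a1 k0 h; apply: contraT => nc.
set p := pdiv (gcdn b m).
have g1 : (1 < gcdn b m)%N by rewrite ltn_neqAle eq_sym nc gcdn_gt0 m_gt0 orbT.
have pp : prime p by exact: pdiv_prime.
have pb : (p %| b)%N by apply: dvdn_trans (dvdn_gcdl b m); exact: pdiv_dvd.
have pm : (p %| m)%N by apply: dvdn_trans (dvdn_gcdr b m); exact: pdiv_dvd.
pose t := (m %/ p)%N.
have t0 : (0 < t)%N by rewrite divn_gt0 ?prime_gt0 // dvdn_leq.
have tm : (t < m)%N by rewrite ltn_Pdiv // prime_gt1.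
have mt : ~~ (m %| t)%N by apply/negP => /(dvdn_leq t0); rewrite leqNgt tm.
have Wp u : u \in apery_list a b k -> (p %| u)%N.
  elim: k u => [|j IH] u /=; first by rewrite inE => /eqP ->.
  move=> /allpairsP[[v c] /= [hv _ ->]].
  by apply: dvdn_add; apply: dvdn_mull; [exact: IH | rewrite expnS dvdn_mulr].
have hz n : (w ^+ t) ^+ n = w ^+ (t * n) by rewrite exprM.
have := gap_list_sum k a_gt0 ab (w ^+ t).
rewrite (eq_bigr _ (fun n _ => hz n)) h // mul0r => /esym/eqP; rewrite subr_eq0.
have -> : \sum_(u <- apery_list a b k) (w ^+ t) ^+ u = (a ^ k)%:R.
  rewrite (eq_big_seq (fun=> 1)) => [|u /Wp pu].
    by rewrite big_const_seq count_predT size_apery_list iter_addr addr0.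
  apply/eqP; rewrite hz -(prim_order_dvd w_prim).
  by rewrite -{1}(divnK pm) dvdn_pmul2l.
move=> /eqP e.
have Re_sum : \sum_(0 <= n < a ^ k) co w (t * n) = (a ^ k)%:R.
  have ReD (x y : R[i]) : complex.Re (x + y) = complex.Re x + complex.Re y.
    by case: x; case: y.
  have := congr1 (@complex.Re R) e; rewrite (big_morph _ ReD (erefl : complex.Re 0 = 0)).
  rewrite (eq_bigr (fun n => co w (t * n))) => [->|n _]; last by rewrite hz.
  by rewrite -(rmorph_nat (real_complex R)).
have q1 : (1 < a ^ k)%N by rewrite -(exp1n k) ltn_exp2r.
have := eqxx (\sum_(0 <= n < a ^ k) (1 - co w (t * n))).
rewrite {1}sumrB Re_sum sumr_const_nat subn0 subrr eq_sym.
rewrite (bigD1_seq 1%N) ?iota_uniq ?mem_index_iota //= muln1 gt_eqF //.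
apply: ltr_wpDr; first by apply: sumr_ge0 => n _; rewrite subr_ge0 (co_le1 w_prim).
by rewrite subr_gt0 lt_neqAle (co_eq1 w_prim) mt (co_le1 w_prim).
Qed.

End FixedBases.

(** These sums are the nonconstant Fourier coefficients of the class counts; if they vanish, every
    count times m is the size of s. *)
Lemma equal_counts_vanish (s : seq nat) :
  (forall c d, count (fun n => n == c %[mod m])%N s = count (fun n => n == d %[mod m])%N s)
  <-> (forall t, ~~ (m %| t)%N -> \sum_(n <- s) w ^+ (t * n) = 0).
Proof.
split=> [h t mt|h c d].
  have classes n : w ^+ (t * n) = \sum_(0 <= c < m) (n == c %[mod m])%:R * w ^+ (t * c).
    rewrite (bigD1_seq (n %% m)%N) ?iota_uniq ?mem_index_iota ?ltn_mod //=.
    rewrite modn_mod eqxx mul1r big1_seq ?addr0.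
      by apply/eqP; rewrite (eq_prim_root_expr w_prim) modnMmr.
    move=> c /andP[cn]; rewrite mem_index_iota => /andP[_ cm].
    by rewrite [(c %% m)%N]modn_small // eq_sym (negbTE cn) mul0r.
  rewrite (eq_bigr _ (fun n _ => classes n)) exchange_big /=.
  transitivity (\sum_(0 <= c < m) (count (fun n => n == 0 %[mod m])%N s)%:R * w ^+ (t * c)).
    apply: eq_bigr => c _; rewrite -mulr_suml; congr (_ * _).
    by rewrite -natr_sum (h 0%N c) -sum1_count [in RHS]big_mkcond.
  rewrite -mulr_sumr (eq_bigr (fun c => w ^+ (c * t))) => [|c _]; last by rewrite mulnC.
  by rewrite (sum_prim_root w_prim) (negbTE mt) mulr0.
have H c' : (m%:R * (count (fun n => n == c' %[mod m])%N s)%:R : R[i]) = (size s)%:R.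
  transitivity (\sum_(0 <= t < m) w ^+ (t * (m.-1 * c')) * \sum_(n <- s) w ^+ (t * n)).
    rewrite (eq_bigr (fun t => \sum_(n <- s) w ^+ (t * (n + m.-1 * c')))) => [|t _]; last first.
      by rewrite mulr_sumr; apply: eq_bigr => n _; rewrite -exprD mulnDr addnC.
    rewrite exchange_big /= -sum1_count big_mkcond natr_sum mulr_sumr.
    apply: eq_bigr => n _; rewrite (sum_prim_root w_prim).
    have -> : (m %| n + m.-1 * c')%N = (n == c' %[mod m])%N.
      have e : (c' + m.-1 * c' = 0 %[mod m])%N by rewrite -mulSn prednK // modnMr mod0n.
      by rewrite -(eqn_modDr (m.-1 * c')) e mod0n.
    by case: ifP; rewrite ?mulr1 ?mulr0.
  rewrite (bigD1_seq 0%N) ?iota_uniq ?mem_index_iota // mul0n expr0 mul1r /=.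
  rewrite [X in _ + X]big1_seq ?addr0 => [|t].
    rewrite (eq_bigr (fun=> 1)) => [|n _]; last exact: expr0.
    by rewrite big_const_seq count_predT iter_addr addr0.
  rewrite mem_index_iota => /andP[t0 /andP[_ tm]]; rewrite h ?mulr0 //.
  by apply/negP => /(dvdn_leq _); rewrite lt0n t0 leqNgt tm => /(_ isT).
have m0 : m%:R != 0 :> R[i] by rewrite pnatr_eq0 -lt0n.
by apply/eqP; rewrite -(eqr_nat R[i]); apply/eqP/(mulfI m0); rewrite !H.
Qed.

End GapSumsAtRootsOfUnity.

Section SetCardinality.
Local Open Scope classical_set_scope.
Local Open Scope card_scope.

Lemma seq_set_card (T : eqType) (x0 : T) (s : seq T) :
  uniq s -> [set` s] #= `I_(size s).
Proof.
move=> us; have -> : [set` s] = nth x0 s @` `I_(size s).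
  apply/seteqP; split=> x /=.
    by move=> xs; exists (index x s); rewrite /= ?index_mem ?nth_index.
  by case=> i /= i_lt <-; rewrite mem_nth.
apply: inj_card_eq => i j; rewrite !inE /= => i_lt j_lt /eqP.
by rewrite nth_uniq // => /eqP.
Qed.

Lemma gaps_equidistributed_counts (S : set nat) (s : seq nat) m :
  (0 < m)%N -> uniq s -> (forall n, n \in s <-> ~ S n) ->
  equidistributed (gaps S) m <->
  (forall c d, count (fun n => n == c %[mod m])%N s = count (fun n => n == d %[mod m])%N s).
Proof.
move=> m0 us sS.
have gapsE : gaps S = [set` map Posz s].
  apply/seteqP; split=> x /=.
    by case=> n nS <-; rewrite map_f //; apply/sS.
  by case/mapP => n /sS nS ->; exists n.
have class c : [set x | gaps S x /\ (x = c %[mod m])%Z]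
    #= `I_(count (fun n => n == `|(c %% m)%Z| %[mod m])%N s).
  rewrite -size_filter -(size_map Posz).
  have -> : [set x | gaps S x /\ (x = c %[mod m])%Z]
      = [set` [seq Posz n | n <- s & (n == `|(c %% m)%Z| %[mod m])%N]].
    have cE : ((`|(c %% m)%Z| %% m)%N%:Z = c %% m)%Z.
      by rewrite -modz_nat gez0_abs ?modz_mod // modz_ge0 // eqz_nat -lt0n.
    rewrite gapsE; apply/seteqP; split=> x /=.
      case=> /mapP[n ns ->] e; apply: map_f; rewrite mem_filter ns andbT.
      by rewrite -eqz_nat cE -modz_nat e.
    case/mapP => n; rewrite mem_filter => /andP[e ns] ->; split; first exact: map_f.
    by rewrite modz_nat (eqP e) cE.
  by apply: (seq_set_card 0); rewrite map_inj_uniq ?filter_uniq // => x y [].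
split=> [[_ h] c d|h].
  have modc x : (`|(x%:Z %% m)%Z| %% m = x %% m)%N by rewrite modz_nat absz_nat modn_mod.
  have cc := class c%:Z; rewrite card_eq_sym in cc.
  have := card_eq_trans cc (card_eq_trans (h c%:Z d%:Z) (class d%:Z)).
  by move/card_eq_II; rewrite !modc.
split; first by rewrite gapsE; exact: finite_seq.
move=> c d; apply: card_eq_trans (class c) _; rewrite card_eq_sym.
by rewrite (h _ `|(d %% m)%Z|%N); exact: class.
Qed.

Lemma geom_monoidC a b k : geom_monoid a b k = geom_monoid b a k.
Proof.
have sub u v : geom_monoid u v k `<=` geom_monoid v u k.
  move=> n [c ->]; exists (c \o @rev_ord _).
  rewrite (reindex_inj rev_ord_inj); apply: eq_bigr => i _ /=.
  have ik : (i <= k)%N by rewrite -ltnS.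
  by rewrite subSS (subKn ik) [(u ^ i * _)%N]mulnC.
by apply/seteqP; split; exact: sub.
Qed.

End SetCardinality.

Section Equidistribution.
Variables (R : realType) (m : nat) (w : R[i]).
Hypothesis w_prim : m.-primitive_root w.
Variables a b k : nat.
Hypotheses (a_gt1 : (1 < a)%N) (k_gt0 : (0 < k)%N).
Hypothesis ab : coprime a b.

Let a_gt0 := ltnW a_gt1.

Let vanish_iff : equidistributed (gaps (geom_monoid a b k)) m <->
  (forall t, ~~ (m %| t)%N -> \sum_(n <- gap_list a b k) w ^+ (t * n) = 0).
Proof.
rewrite -(equal_counts_vanish w_prim).
apply: gaps_equidistributed_counts; first exact: prim_order_gt0 w_prim.
  exact: uniq_gap_list.
by move=> n; exact: mem_gap_list.
Qed.

Lemma equidistributed_coprime :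
  equidistributed (gaps (geom_monoid a b k)) m -> coprime b m.
Proof. by move=> /vanish_iff; exact: gap_sums_vanish_coprime. Qed.

Lemma equidistributed_gap_identity : coprime a m -> coprime b m ->
  equidistributed (gaps (geom_monoid a b k)) m <-> gap_identity w a b k.
Proof. by move=> ca cb; rewrite vanish_iff; exact: gap_sums_vanish_identity. Qed.

End Equidistribution.

(** * Passage to integers and to the unit group *)

Lemma eqz_mod_nat (m x y : nat) : (x%:Z = y%:Z %[mod m])%Z <-> (x = y %[mod m])%N.
Proof. by rewrite !modz_nat; split=> [[]|->]. Qed.

Lemma eqz_mod_opp (m x y : nat) : (x%:Z = - y%:Z %[mod m])%Z <-> (m %| x + y)%N.
Proof.
split=> [/eqP|h]; last apply/eqP; rewrite eqz_mod_dvd opprK -PoszD //.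
Qed.

(** For m > 1 the generating set is a single unit, so the subgroup is cyclic and, being finite,
    consists of nonnegative powers. *)
Lemma class_in_unit_subgroup (m : nat) (r : int) (r0 : nat) (x : int) : (1 < m)%N -> coprime r0 m ->
  (r0%:Z = r %[mod m])%Z ->
  class_in (unit_subgroup m r) x <-> exists i, ((r0 ^ i)%N%:Z = x %[mod m])%Z.
Proof.
move=> m1 cr e.
have ur : (r0%:R : 'Z_m) \is a GRing.unit by rewrite unitZpE // coprime_sym.
pose u0 : {unit 'Z_m} := FinRing.unit _ ur.
have val_pow i : (FinRing.uval (u0 ^+ i)%g : nat) = (r0 ^ i %% m)%N.
  by rewrite FinRing.val_unitX /= -natrX val_Zp_nat.
have gen : [set u : {unit 'Z_m} | repr_unit u r]%SET = [set u0]%SET.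
  apply/setP => u; rewrite !inE; apply/idP/eqP => [|->]; rewrite /repr_unit -e.
    move/eqP/eqz_mod_nat => h; apply: val_inj; apply: val_inj.
    rewrite /= val_Zp_nat // -h modn_small //.
    by have := ltn_ord (FinRing.uval u); rewrite [X in (_ < X)%N -> _]Zp_cast.
  by have := val_pow 1%N; rewrite expg1 expn1 => ->; rewrite -modz_nat modz_mod.
rewrite /class_in /unit_subgroup gen; split.
  case=> u /= /cycleP[i ->]; rewrite /repr_unit val_pow => /eqP <-.
  by exists i; rewrite -modz_nat modz_mod.
case=> i h; exists (u0 ^+ i)%g; first exact: mem_cycle.
by rewrite /repr_unit val_pow -modz_nat modz_mod h.
Qed.

Lemma dvdz_sum_pow (m : nat) (r : int) (r0 K : nat) : (r0%:Z = r %[mod m])%Z ->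
  (m %| \sum_(i < K) r ^+ i)%Z = (m %| \sum_(i < K) r0 ^ i)%N.
Proof.
move=> e.
have h : (m%:Z %| \sum_(i < K) r ^+ i - (\sum_(i < K) r0 ^ i)%N%:Z)%Z.
  rewrite -[(_)%N%:Z]natz natr_sum -sumrB; apply: rpred_sum => i _.
  rewrite natrX natz subrXX; apply: dvdz_mulr.
  by rewrite -eqz_mod_dvd e.
by rewrite -[X in (_ %| X)%Z](subrK (\sum_(i < K) r0 ^ i)%N%:Z) rpredDl.
Qed.

Lemma nat_ratio_exists (a b m : nat) (a' r : int) : (0 < m)%N ->
  (a%:Z * a' = 1 %[mod m])%Z -> (r = a' * b%:Z %[mod m])%Z ->
  exists r0 : nat, (r0%:Z = r %[mod m])%Z /\ (a * r0 = b %[mod m])%N.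
Proof.
move=> m0 ha hr; have r0E : (`|(r %% m)%Z|%N%:Z = r %[mod m])%Z.
  by rewrite gez0_abs ?modz_mod // modz_ge0 // eqz_nat -lt0n.
exists `|(r %% m)%Z|%N; split=> //; apply/eqz_mod_nat.
rewrite PoszM -modzMmr r0E modzMmr -modzMmr hr modzMmr mulrA.
by rewrite -modzMml ha modzMml mul1r.
Qed.

(** The monoid is symmetric in a and b, so equidistribution is equivalent to each of the two gap
    identities separately: both are available for the classification, and either one proves the
    converse. *)
Lemma equidistributed_gap_casesP (a b k m r : nat) :
  (1 < a)%N -> (1 < b)%N -> (0 < k)%N -> (0 < m)%N -> coprime a b ->
  coprime a m -> coprime b m -> (a * r = b %[mod m])%N ->
  equidistributed (gaps (geom_monoid a b k)) m <-> gap_cases m a b k r.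
Proof.
move=> a1 b1 k0 m0 ab ca cb ar.
have [w w_prim] := @closed_prim_root_exists Rdefinitions.R[i] m m0.
have ba : coprime b a by rewrite coprime_sym.
have ida := equidistributed_gap_identity w_prim k a1 ab ca cb.
have idb := equidistributed_gap_identity w_prim k b1 ba cb ca.
rewrite geom_monoidC in idb; split=> [h|].
  by apply: (gap_identity_cases w_prim ca cb ar k0); [exact: ida.1 | exact: idb.1].
by move=> /(gap_cases_identity w_prim ca ar)[/ida|/idb].
Qed.

Lemma power_case_class_in (a b K m r : nat) (r' : int) :
  (1 < m)%N -> coprime r m -> (r%:Z = r' %[mod m])%Z ->
  power_case m a b r K <->
  ((a%:Z <> b%:Z %[mod m])%Z /\ (a%:Z ^+ K = 1 %[mod m])%Z /\
     (b%:Z ^+ K = 1 %[mod m])%Z /\ class_in (unit_subgroup m r') a%:Z) \/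
  ((a%:Z <> b%:Z %[mod m])%Z /\ (a%:Z ^+ K = 1 %[mod m])%Z /\
     (b%:Z ^+ K = 1 %[mod m])%Z /\ class_in (unit_subgroup m r') (- a%:Z) /\
     ~~ odd K /\ (m %| \sum_(i < K) r' ^+ i)%Z).
Proof.
move=> m1 cr rr'.
have neq : (a%:Z <> b%:Z %[mod m])%Z <-> (a <> b %[mod m])%N.
  by split=> h e; apply: h; apply/eqz_mod_nat.
have pow1 x : (x%:Z ^+ K = 1 %[mod m])%Z <-> (x ^ K = 1 %[mod m])%N.
  by rewrite -[1]/(1%:Z) -[_ ^+ K](rmorphXn Posz) eqz_mod_nat.
have pos : class_in (unit_subgroup m r') a%:Z <-> exists i, (a = r ^ i %[mod m])%N.
  rewrite (class_in_unit_subgroup _ m1 cr rr'); split=> -[i h]; exists i.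
    by move/eqz_mod_nat: h.
  by apply/eqz_mod_nat.
have neg : class_in (unit_subgroup m r') (- a%:Z) <-> exists i, (m %| a + r ^ i)%N.
  rewrite (class_in_unit_subgroup _ m1 cr rr'); split=> -[i h]; exists i.
    by move/eqz_mod_opp: h; rewrite addnC.
  by apply/eqz_mod_opp; rewrite addnC.
rewrite (dvdz_sum_pow _ rr') neq !pow1 pos neg /power_case.
split=> [[h1 h2 h3 [h4|[h4 h5 h6]]]|[[h1 [h2 [h3 h4]]]|[h1 [h2 [h3 [h4 [h5 h6]]]]]]].
- by left.
- by right.
- by split=> //; left.
- by split=> //; right.
Qed.

Theorem mainTheorem1 (a b k m : nat)
    (a_gt1 : (1 < a)%N) (b_gt1 : (1 < b)%N) (k_gt0 : (0 < k)%N)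
    (m_gt0 : (0 < m)%N) (coprime_ab : coprime a b) :
  equidistributed (gaps (geom_monoid a b k)) m
  <->
  coprime (a * b) m /\
  forall a' r : int,
    (a%:Z * a' = 1 %[mod m])%Z -> (r = a' * b%:Z %[mod m])%Z ->
    let R := unit_subgroup m r in
    (* (1) *)
    ((a%:Z = 1 %[mod m])%Z \/ (b%:Z = 1 %[mod m])%Z) \/
    (* (2) *)
    ((a%:Z = -1 %[mod m])%Z /\ (b%:Z = -1 %[mod m])%Z /\
      ~~ odd k /\ (m %| k)%N) \/
    (* (3) *)
    ((a%:Z = -1 %[mod m])%Z /\ (b%:Z = -1 %[mod m])%Z /\
      odd k /\ (m %| k.+1)%N) \/
    (* (4) *)
    ((a%:Z <> b%:Z %[mod m])%Z /\
      (a%:Z ^+ k = 1 %[mod m])%Z /\ (b%:Z ^+ k = 1 %[mod m])%Z /\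
      class_in R a%:Z) \/
    (* (5) *)
    ((a%:Z <> b%:Z %[mod m])%Z /\
      (a%:Z ^+ k = 1 %[mod m])%Z /\ (b%:Z ^+ k = 1 %[mod m])%Z /\
      class_in R (- a%:Z) /\ ~~ odd k /\
      (m %| \sum_(i < k) r ^+ i)%Z) \/
    (* (6) *)
    ((a%:Z <> b%:Z %[mod m])%Z /\
      (a%:Z ^+ k.+1 = 1 %[mod m])%Z /\ (b%:Z ^+ k.+1 = 1 %[mod m])%Z /\
      class_in R a%:Z) \/
    (* (7) *)
    ((a%:Z <> b%:Z %[mod m])%Z /\
      (a%:Z ^+ k.+1 = 1 %[mod m])%Z /\ (b%:Z ^+ k.+1 = 1 %[mod m])%Z /\
      class_in R (- a%:Z) /\ odd k /\
      (m %| \sum_(i < k.+1) r ^+ i)%Z).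
Proof.
have [w w_prim] := @closed_prim_root_exists Rdefinitions.R[i] m m_gt0.
have coprime_ba : coprime b a by rewrite coprime_sym.
have coprime_r r0 : coprime b m -> (a * r0 = b %[mod m])%N -> coprime r0 m.
  move=> cb ar; have : coprime (a * r0) m by rewrite -coprime_modl ar coprime_modl.
  by rewrite coprimeMl => /andP[].
have one x : (x%:Z = 1 %[mod m])%Z <-> (x = 1 %[mod m])%N by exact: eqz_mod_nat m x 1.
have opp1 x : (x%:Z = -1 %[mod m])%Z <-> (m %| x + 1)%N by exact: eqz_mod_opp m x 1.
split=> [eqd|[cab h]].
  have cb := equidistributed_coprime w_prim a_gt1 k_gt0 coprime_ab eqd.
  have ca : coprime a m.
    apply: (equidistributed_coprime w_prim b_gt1 k_gt0 coprime_ba).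
    by rewrite geom_monoidC.
  split=> [|a' r ha hr R]; first by rewrite coprimeMl ca.
  (* For m = 1 alternative (1) holds; the description of [class_in] by powers is for m > 1. *)
  have [m1|m1] := leqP m 1.
    left; left; apply/one; have -> : m = 1%N by apply/eqP; rewrite eqn_leq m1.
    by rewrite !modn1.
  have [r0 [r0r ar]] := nat_ratio_exists m_gt0 ha hr.
  have cr := coprime_r r0 cb ar.
  have powP K := power_case_class_in a b K m1 cr r0r.
  have [[/one a1|/one b1]|[e /opp1 a1 kk]|/powP c|/powP c] :=
    (equidistributed_gap_casesP a_gt1 b_gt1 k_gt0 m_gt0 coprime_ab ca cb ar).1 eqd.
  - by left; left.
  - by left; right.
  - have b1 : (b%:Z = -1 %[mod m])%Z by move/eqz_mod_nat: e => <-.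
    right; case: (odd k) kk => kk; [right; left|left]; by [].
  - by case: c => c; [do 3 right; left|do 4 right; left].
  - case: c => [c|[c1 [c2 [c3 [c4 [ok c5]]]]]]; first by do 5 right; left.
    by do 6 right; move: ok; rewrite /= negbK.
have [ca cb] : coprime a m /\ coprime b m by move: cab; rewrite coprimeMl => /andP[].
(* The assumption ranges over all inverses and ratios; it is instantiated at the inverse given by
   Euler's theorem. *)
have [a' a'a] := mod_inverse_exists ca.
have ha : (a%:Z * a'%:Z = 1 %[mod m])%Z by rewrite -PoszM mulnC; apply/one.
have hr : ((a'%:Z * b%:Z) = a'%:Z * b%:Z %[mod m])%Z by [].
have [r0 [r0r ar]] := nat_ratio_exists m_gt0 ha hr.
have cr := coprime_r r0 cb ar.
apply/(equidistributed_gap_casesP a_gt1 b_gt1 k_gt0 m_gt0 coprime_ab ca cb ar).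
have [m1|m1] := leqP m 1.
  constructor 1; left; have -> : m = 1%N by apply/eqP; rewrite eqn_leq m1.
  by rewrite !modn1.
have powP K := power_case_class_in a b K m1 cr r0r.
have e : (a%:Z = -1 %[mod m])%Z -> (b%:Z = -1 %[mod m])%Z -> (a = b %[mod m])%N.
  by move=> a1 b1; apply/eqz_mod_nat; rewrite a1.
case: (h _ _ ha hr) => /= [[/one a1|/one b1]|].
- by constructor 1; left.
- by constructor 1; right.
case=> [[a1 [b1 [ok kk]]]|].
  by constructor 2; rewrite (negbTE ok); split; [exact: e|exact/opp1|].
case=> [[a1 [b1 [ok kk]]]|].
  by constructor 2; rewrite ok; split; [exact: e|exact/opp1|].
case=> [c|]; first by constructor 3; apply/powP; left.
case=> [c|]; first by constructor 3; apply/powP; right.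
case=> [c|[c1 [c2 [c3 [c4 [ok c5]]]]]]; first by constructor 4; apply/powP; left.
by constructor 4; apply/powP; right; rewrite /= negbK.
Qed.
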